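(* Let $a=(a_i)_{i\in\mathbb Z}$ be a sequence of integers $a_i\ge2$ with $P\ne\varnothing$, let $H$ be a nontrivial subgroup of $S$, and let $G=N\rtimes H$. Then the $C^*$-algebra $\overline{\mathcal Q}(a,H)=C_0(\Omega)\rtimes_{\alpha^{\mathrm{aff}}}G$, where $\alpha^{\mathrm{aff}}_{(n,h)}(f)(x)=f(h^{-1}\cdot(x-n))$, is simple and purely infinite.
   Context: For a sequence $a=(a_i)_{i\in\mathbb Z}$ of integers $a_i\ge2$, let $N=\{\frac{j}{a_{-1}\cdots a_{-k}}: j\in\mathbb Z,\ k\ge1\}\subset\mathbb Q$ (discrete additive group). Let $\mathcal U$ be the family of all subgroups $\frac mn\mathbb Z$ of $N$ with $m,n$ positive integers such that $m$ divides $a_0\cdots a_j$ for some $j\ge0$ and $n$ divides $a_{-1}\cdots a_{-k}$ for some $k\ge1$. The group of $a$-adic numbers $\Omega$ is the Hausdorff completion of $N$ with respect to the group topology having $\mathcal U$ as a neighbourhood basis at $0$; it is a totally disconnected locally compact abelian group containing $N$ as a dense subgroup. $P$ is the set of primes $p$ dividing $a_k$ for infinitely many $k<0$ and for infinitely many $k\ge0$, and $S$ is the subgroup of the multiplicative group $\mathbb Q^\times_+$ of positive rationals generated by $P$. For $s\in S$, multiplication by $s$ is an automorphism of $N$ that permutes $\mathcal U$, hence extends by continuity to an automorphism $x\mapsto s\cdot x$ of $\Omega$. For a subgroup $H\subset S$ (discrete), $N\rtimes H$ is the semidirect product for the multiplication action; it acts on $\Omega$ by $(r,h)\cdot x=r+h\cdot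 x$. *)

(* Defs.v *)
From HB Require Import structures.
From mathcomp Require Import all_boot all_order all_algebra.
From mathcomp Require Import all_classical all_reals all_analysis.
From mathcomp Require Import complex ring.

Set Implicit Arguments.
Unset Strict Implicit.
Unset Printing Implicit Defensive.

Import Order.TTheory GRing.Theory Num.Theory numFieldNormedType.Exports.

Local Open Scope classical_set_scope.
Local Open Scope ring_scope.

(* The carrier of a completeNormedModType is not a ring in general, and a
   C*-algebra need not be unital, so the product is part of the mixin.  Norms
   take their values in the nonnegative reals inside R[i]. *)
HB.mixin Record isCStarAlgebra (R : realType) A
    & CompleteNormedModule R[i] A := {
  cmul : A -> A -> A;
  cstar : A -> A;
  cmulA : associative cmul;
  cmulDl : left_distributive cmul +%R;
  cmulDr : right_distributive cmul +%R;
  cscalerAl : forall (k : R[i]) x y, k *: cmul x y = cmul (k *: x) y;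
  cscalerAr : forall (k : R[i]) x y, k *: cmul x y = cmul x (k *: y);
  cstarK : involutive cstar;
  cstarD : {morph cstar : x y / x + y};
  cstarZ : forall (k : R[i]) x, cstar (k *: x) = k^* *: cstar x;
  cstarM : forall x y, cstar (cmul x y) = cmul (cstar y) (cstar x);
  cnormM : forall x y, `|cmul x y| <= `|x| * `|y|;
  cnorm_star : forall x, `|cmul (cstar x) x| = `|x| ^+ 2
}.

#[short(type="cstarAlgType")]
HB.structure Definition CStarAlgebra (R : realType) :=
  {A of isCStarAlgebra R A & CompleteNormedModule R[i] A}.

Notation "x ** y" := (cmul x y) (at level 40, left associativity) : ring_scope.
Notation "x ^#*" := (cstar x) (at level 2, format "x ^#*") : ring_scope.

Section CStarNotions.
Context {R : realType} {A : cstarAlgType R}.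
Implicit Types (I B : set A) (p q x y : A).

Definition closed_subspace I : Prop :=
  [/\ closed I, I 0, forall x y, I x -> I y -> I (x + y)
    & forall (k : R[i]) x, I x -> I (k *: x)].

Definition closed_ideal I : Prop :=
  closed_subspace I /\ forall x y, I x -> I (x ** y) /\ I (y ** x).

Definition cstar_subalgebra B : Prop :=
  [/\ closed_subspace B, forall x y, B x -> B y -> B (x ** y)
    & forall x, B x -> B x^#*].

Definition positive x : Prop := exists y, x = y^#* ** y.

Definition hereditary B : Prop :=
  cstar_subalgebra B /\
  forall x y, B y -> positive x -> positive (y - x) -> B x.

Definition projection p : Prop := p^#* = p /\ p ** p = p.

Definition murray_von_neumann p q : Prop :=
  exists v, v^#* ** v = p /\ v ** v^#* = q.

Definition infinite_projection p : Prop :=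
  projection p /\
  exists q, [/\ projection q, p ** q = q, q <> p & murray_von_neumann p q].

End CStarNotions.

Definition simple_cstar {R : realType} (A : cstarAlgType R) : Prop :=
  (exists x : A, x <> 0) /\
  forall I : set A, closed_ideal I -> I = [set 0] \/ I = setT.

Definition purely_infinite {R : realType} (A : cstarAlgType R) : Prop :=
  forall B : set A, hereditary B -> (exists2 x, B x & x <> 0) ->
  exists2 p, B p & infinite_projection p.

HB.mixin Record isHilbert (R : realType) V & CompleteNormedModule R[i] V := {
  inner : V -> V -> R[i];
  innerDl : forall u v w, inner (u + v) w = inner u w + inner v w;
  innerZl : forall (k : R[i]) u v, inner (k *: u) v = k * inner u v;
  innerC : forall u v, inner v u = (inner u v)^*;
  inner_norm : forall u, inner u u = `|u| ^+ 2
}.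

#[short(type="hilbertType")]
HB.structure Definition Hilbert (R : realType) :=
  {V of isHilbert R V & CompleteNormedModule R[i] V}.

Section CrossedProduct.
Context {R : realType} {X : topologicalType} {G : groupType}.
Local Notation C := R[i].

Definition C0 : set (X -> C) :=
  [set f | continuous (f : X -> C^o) /\
    forall e : C, 0 < e ->
      exists2 K : set X, compact K & forall x, ~ K x -> `|f x| < e].

Definition conj_fun (f : X -> C) : X -> C := fun x => (f x)^*.

Variable alpha : G -> (X -> C) -> (X -> C).

(* The *-algebra C_c(G, C_0(X)), with product
   (F F')(g) = \sum_h F(h) alpha_h(F'(h^-1 g)) and involution sending F to
   g |-> alpha_g(conj(F(g^-1))). *)
Definition Cc : set (G -> X -> C) :=
  [set F | finite_set [set g | F g <> cst 0] /\ forall g, C0 (F g)].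

Definition convolution (F F' : G -> X -> C) : G -> X -> C := fun g x =>
  \sum_(h \in [set: G]) F h x * alpha h (F' (h^-1 * g)%g) x.

Definition involution (F : G -> X -> C) : G -> X -> C := fun g =>
  alpha g (conj_fun (F g^-1%g)).

(* pi is only constrained on C_0(X). *)
Record covariant_rep (V : hilbertType R)
    (pi : (X -> C) -> V -> V) (U : G -> V -> V) : Prop := {
  rep_linear : forall f, C0 f -> linear (pi f);
  rep_bounded : forall f, C0 f -> continuous (pi f);
  repD : forall f f' v, C0 f -> C0 f' -> pi (f \+ f') v = pi f v + pi f' v;
  repZ : forall (k : C) f v, C0 f -> pi (k \*o f) v = k *: pi f v;
  repM : forall f f' v, C0 f -> C0 f' -> pi (f \* f') v = pi f (pi f' v);
  rep_star : forall f u v, C0 f ->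
    inner (pi f u) v = inner u (pi (conj_fun f) v);
  unitary_linear : forall g, linear (U g);
  unitary_inner : forall g u v, inner (U g u) (U g v) = inner u v;
  unitary1 : forall v, U 1%g v = v;
  unitaryM : forall g h v, U (g * h)%g v = U g (U h v);
  covariance : forall g f v, C0 f -> pi (alpha g f) (U g v) = U g (pi f v)
}.

Definition integrated (V : hilbertType R) (pi : (X -> C) -> V -> V)
    (U : G -> V -> V) (F : G -> X -> C) (v : V) : V :=
  \sum_(g \in [set: G]) pi (F g) (U g v).

Definition universal_bound (F : G -> X -> C) (M : C) : Prop :=
  0 <= M /\
  forall (V : hilbertType R) (pi : (X -> C) -> V -> V) (U : G -> V -> V),
    covariant_rep pi U -> forall v, `|integrated pi U F v| <= M * `|v|.

(* j exhibits A as the completion of C_c(G, C_0(X)) for the universal norm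
   sup { ||(pi x U)(F)|| : (pi, U) covariant representation }. *)
Record crossed_product (A : cstarAlgType R) (j : (G -> X -> C) -> A) : Prop := {
  cpD : forall F F', Cc F -> Cc F' -> j (fun g => F g \+ F' g) = j F + j F';
  cpZ : forall (k : C) F, Cc F -> j (fun g => k \*o F g) = k *: j F;
  cpM : forall F F', Cc F -> Cc F' -> j (convolution F F') = j F ** j F';
  cp_star : forall F, Cc F -> j (involution F) = (j F)^#*;
  cp_dense : dense (j @` Cc);
  cp_norm : forall F, Cc F ->
    universal_bound F `|j F| /\ forall M, universal_bound F M -> `|j F| <= M
}.

End CrossedProduct.
Arguments C0 R X : clear implicits.
Arguments Cc R X G : clear implicits.

Record adic_seq := AdicSeq {
  adic_fun :> int -> nat;
  adic_ge2 : forall i, (2 <= adic_fun i)%N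
}.

Section Adic.
Variable a : adic_seq.

Definition negprod (k : nat) : nat := \prod_(1 <= i < k.+1) a (- i%:Z).
Definition posprod (j : nat) : nat := \prod_(0 <= i < j.+1) a i%:Z.

Definition Nset : set rat :=
  [set x | exists (j : int) (k : nat), (1 <= k)%N /\ x = j%:~R / (negprod k)%:R].

Definition Pset : set nat :=
  [set p | [/\ prime p,
    infinite_set [set k : int | k < 0 /\ (p %| a k)%N] &
    infinite_set [set k : int | 0 <= k /\ (p %| a k)%N]]].

Definition Npred : {pred rat} := fun x => x \in Nset.

End Adic.

Definition mul_subgroup (K : set rat) : Prop :=
  [/\ forall x, K x -> 0 < x, K 1, forall x y, K x -> K y -> K (x * y)
    & forall x, K x -> K x^-1].

Definition Sset (a : adic_seq) : set rat :=
  smallest mul_subgroup [set p%:R | p in Pset a].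

Record S_subgroup (a : adic_seq) := SSubgroup {
  subgroup_set :> set rat;
  subgroup_mul : mul_subgroup subgroup_set;
  subgroup_S : subgroup_set `<=` Sset a
}.

Section AdicLemmas.
Variable a : adic_seq.

Lemma negprod_gt0 k : (0 < negprod a k)%N.
Proof. by apply: prodn_gt0 => i; apply: ltn_trans (adic_ge2 a _). Qed.

Lemma negprod_neq0 k : (negprod a k)%:R != 0 :> rat.
Proof. by rewrite pnatr_eq0 -lt0n negprod_gt0. Qed.

Lemma dvdn_negprod k l : (k <= l)%N -> (negprod a k %| negprod a l)%N.
Proof.
by move=> kl; rewrite /negprod [X in (_ %| X)%N](big_cat_nat _ (n := k.+1))//=; exact: dvdn_mulr.
Qed.

Lemma Nset_weaken (j : int) k l : (k <= l)%N ->
  exists j' : int, j%:~R / (negprod a k)%:R = j'%:~R / (negprod a l)%:R :> rat.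
Proof.
move=> /dvdn_negprod/dvdnP[m lE]; exists (j * m%:Z).
apply/eqP; rewrite eqr_div ?negprod_neq0// lE natrM intrM; apply/eqP.
by rewrite mulrA -pmulrn.
Qed.

Lemma Nset_zmod_closed : zmod_closed (Npred a).
Proof.
split; first by apply: mem_set; exists 0, 1%N; rewrite mul0r.
move=> x y /set_mem[j [k [k1 ->]]] /set_mem[j' [k' [k'1 ->]]]; apply: mem_set.
have [i ->] := Nset_weaken j (leq_maxl k k').
have [i' ->] := Nset_weaken j' (leq_maxr k k').
exists (i - i'), (maxn k k'); split; first by rewrite leq_max k1.
by rewrite -mulrBl intrB.
Qed.

Lemma infinite_neg_index (p k : nat) :
  infinite_set [set i : int | i < 0 /\ (p %| a i)%N] ->
  exists2 l : nat, (k < l)%N & (p %| a (- l%:Z))%N.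
Proof.
move=> infp; apply: contrapT => nol; apply: infp.
apply: (@sub_finite_set _ _ ((fun l : nat => - l%:Z) @` `I_k.+1)); last first.
  exact/finite_image/finite_II.
move=> i /= [i0 pi]; exists `|i|%N; last first.
  by rewrite abszE ltr0_norm// opprK.
rewrite ltnNge; apply/negP => ki; apply: nol; exists `|i|%N => //.
by rewrite abszE ltr0_norm// opprK.
Qed.

Lemma mul_subgroup_NsetK :
  mul_subgroup [set s : rat | 0 < s /\ forall x, Nset a x <-> Nset a (s * x)].
Proof.
split=> [x []//||x y [x0 xN] [y0 yN]|x [x0 xN]].
- by split=> // x; rewrite mul1r.
- by split=> [|z]; [exact: mulr_gt0|rewrite -mulrA -xN -yN].
- split=> [|z]; first by rewrite invr_gt0.
  by rewrite [in X in _ <-> X]xN mulVKf// gt_eqF.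
Qed.

Lemma Nset_S s x : Sset a s -> Nset a x -> Nset a (s * x).
Proof.
move=> Ss; suff [_ /(_ x)[]//] :
    [set s : rat | 0 < s /\ forall x, Nset a x <-> Nset a (s * x)] s.
apply: Ss; split; first exact: mul_subgroup_NsetK.
move=> _ [p [pp infp _] <-]; split; first by rewrite ltr0n prime_gt0.
move=> {}x; split=> -[j [k [k1 xE]]].
  by exists (p%:Z * j), k; split=> //; rewrite xE intrM mulrA -pmulrn.
have p0 : p%:R != 0 :> rat by rewrite pnatr_eq0 -lt0n prime_gt0.
have -> : x = j%:~R / (p * negprod a k)%:R.
  by rewrite natrM invfM mulrCA -xE mulKf.
have [l kl /dvdnP[m aE]] := infinite_neg_index k infp.
case: l => // l in kl aE *.
have /dvdnP[n nE] := @dvdn_negprod k l kl.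
exists (j * (m * n)%:Z), l.+1; split => //.
apply/eqP; rewrite eqr_div ?negprod_neq0 ?natrM ?mulf_neq0 ?negprod_neq0//.
rewrite {1}/negprod big_nat_recr//= -/(negprod a l) aE nE.
by rewrite intrM -!pmulrn !natrM; apply/eqP; ring.
Qed.

End AdicLemmas.

HB.instance Definition _ (a : adic_seq) :=
  GRing.isZmodClosed.Build rat (Npred a) (Nset_zmod_closed a).

Record N (a : adic_seq) := MkN { Nval :> rat; _ : Nval \in Npred a }.
HB.instance Definition _ a := [isSub for @Nval a].
HB.instance Definition _ a := [Choice of N a by <:].
HB.instance Definition _ a := [SubChoice_isSubZmodule of N a by <:].

Section NTheory.
Variable a : adic_seq.

Lemma NvalP (x : N a) : Nset a (Nval x).
Proof. by case: x => x /= /[!inE]. Qed.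

Definition Nmul (s : rat) (Ss : Sset a s) (x : N a) : N a :=
  MkN (mem_set (Nset_S Ss (NvalP x))).

End NTheory.

Definition semidirect (a : adic_seq) (H : S_subgroup a) : Type :=
  (N a * {h : rat | h \in subgroup_set H})%type.

Section Semidirect.
Variables (a : adic_seq) (H : S_subgroup a).
Local Notation HT := {h : rat | h \in subgroup_set H}.

Lemma HTP (h : HT) : subgroup_set H (val h).
Proof. by case: h => h /= /[!inE]. Qed.

Definition HT1 : HT.
Proof. by exists 1; apply: mem_set; case: (subgroup_mul H). Defined.

Definition HTmul (h k : HT) : HT.
Proof.
exists (val h * val k); apply: mem_set.
by case: (subgroup_mul H) => _ _ + _; apply; exact: HTP.
Defined.

Definition HTinv (h : HT) : HT.
Proof.
exists (val h)^-1; apply: mem_set.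
by case: (subgroup_mul H) => _ _ _; apply; exact: HTP.
Defined.

Definition HNmul (h : HT) : N a -> N a := Nmul (subgroup_S (HTP h)).

Definition sd_one : semidirect H := (0, HT1).
Definition sd_mul (g g' : semidirect H) : semidirect H :=
  (g.1 + HNmul g.2 g'.1, HTmul g.2 g'.2).
Definition sd_inv (g : semidirect H) : semidirect H :=
  (- HNmul (HTinv g.2) g.1, HTinv g.2).

Lemma HT_neq0 (h : HT) : val h != 0.
Proof. by case: (subgroup_mul H) => /(_ _ (HTP h)) /lt0r_neq0. Qed.

Lemma sd_mulA : associative sd_mul.
Proof.
move=> [n h] [m k] [l r]; congr pair; apply: val_inj; rewrite /= ?mulrA//.
by rewrite mulrDr addrA mulrA.
Qed.

Lemma sd_mul1g : left_id sd_one sd_mul.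
Proof.
by move=> [n h]; congr pair; apply: val_inj; rewrite /= ?mul1r// add0r.
Qed.

Lemma sd_mulg1 : right_id sd_one sd_mul.
Proof.
by move=> [n h]; congr pair; apply: val_inj; rewrite /= ?mulr0 ?addr0 ?mulr1.
Qed.

Lemma sd_mulVg : left_inverse sd_one sd_inv sd_mul.
Proof.
move=> [n h]; congr pair; apply: val_inj; rewrite /= ?addNr//.
by rewrite mulVf// HT_neq0.
Qed.

Lemma sd_mulgV : right_inverse sd_one sd_inv sd_mul.
Proof.
move=> [n h]; congr pair; apply: val_inj; rewrite /= ?mulfV ?HT_neq0//.
by rewrite mulrN mulVKf ?HT_neq0// subrr.
Qed.

HB.instance Definition _ := Choice.on (semidirect H).
HB.instance Definition _ := isGroup.Build (semidirect H)
  sd_mulA sd_mul1g sd_mulg1 sd_mulVg sd_mulgV.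

End Semidirect.

Definition adic_basis (a : adic_seq) : set (set (N a)) :=
  [set U | exists m n j k : nat,
    [/\ (0 < m)%N, (0 < n)%N, (m %| posprod a j)%N,
        (1 <= k)%N /\ (n %| negprod a k)%N
      & U = [set x | exists z : int, Nval x = m%:R / n%:R * z%:~R]]].

(* Omega is a complete Hausdorff topological group, iota : N -> Omega has dense
   range, and the topology of N with neighbourhood basis adic_basis at 0 is the
   one induced by iota; this determines (Omega, iota) up to isomorphism. *)
Record hausdorff_completion (a : adic_seq) (Omega : UniformZmodule.type)
    (iota : {additive N a -> Omega}) : Prop := {
  completion_hausdorff : hausdorff_space Omega;
  completion_complete : forall F : set_system Omega,
    ProperFilter F -> cauchy F -> exists x : Omega, F --> x;
  completion_dense : dense (range iota);
  completion_nbhs0 : forall B : set (N a),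
    filter_from (@adic_basis a) id B <->
    exists2 V, nbhs (0 : Omega) V & iota @^-1` V `<=` B
}.

(* dot s is multiplication by s on Omega, the extension by continuity of the
   multiplication by s on N; its values for s outside S are irrelevant. *)
Definition extends_multiplication (a : adic_seq) (Omega : UniformZmodule.type)
    (iota : {additive N a -> Omega}) (dot : rat -> Omega -> Omega) : Prop :=
  forall (s : rat) (Ss : Sset a s),
    continuous (dot s) /\ forall x : N a, dot s (iota x) = iota (Nmul Ss x).

Definition alpha_aff (R : realType) (a : adic_seq) (H : S_subgroup a)
    (Omega : UniformZmodule.type) (iota : {additive N a -> Omega})
    (dot : rat -> Omega -> Omega)
    (g : semidirect H) (f : Omega -> R[i]) : Omega -> R[i] :=
  fun x => f (dot (val g.2)^-1 (x - iota g.1)).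

(* Main.v *)
Require Import Defs.
From HB Require Import structures.
From mathcomp Require Import all_boot all_order all_algebra.
From mathcomp Require Import all_classical all_reals all_analysis.
From mathcomp Require Import complex finmap ring lra zify.
From mathcomp Require Import showcase.summability.

(* A nonzero y in the crossed product is approximated by a finitely supported F.
   The group is amenable, so Fourier multipliers supported on finite sets are
   contractive and converge pointwise to the identity; hence F has a coefficient
   bounded away from 0.  The action is topologically free: some compact open ball
   B meets none of its translates by the g <> 1 occurring in F^* F, and cutting
   with p = 1_B leaves only the diagonal term, so p (k y^* y) p is close to p for
   a suitable scalar k > 0.  Thus p lies in every closed ideal containing y, and
   is equivalent to a projection of every hereditary subalgebra containing y.
   Since N is dense, every orbit meets B, so that the ideal generated by 1_B is
   everything.  Finally, some h = u / v > 1 in H maps the v cosets of v q Z in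
   the ball t + q Z to v of its u cosets of u q Z, and 1_B is infinite. *)

Set Implicit Arguments.
Unset Strict Implicit.
Unset Printing Implicit Defensive.

Import Order.TTheory GRing.Theory Num.Theory numFieldNormedType.Exports.

Local Open Scope classical_set_scope.
Local Open Scope ring_scope.

(** * C*-algebras *)

(** The algebra is known only through its universal norm: no conditional expectation onto C_0(Omega)
    is given. Lower bounds come from two covariant representations on square-summable families: an
    arbitrary one tensored with left translation on G, which makes Fourier multipliers contractive,
    and the permutation representation on N. Amenability is spent on one point: a multiplied element
    is supported on the fixed finite set K K^-1, so that small coefficients force a small norm.

    Algebras have no unit in general and no functional calculus is set up. Square roots are taken
    only of 1 - t with t of norm at most 1/2, as fixed points of contractions; this is why corners
    are approximated within 1/2. Functions on Omega are compared on the dense subgroup N, where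
    identities become arithmetic of rationals. *)

Section RealNorm.
Context {R : realType} {V : normedModType R[i]}.
Implicit Types u v : V.

(** Norms live in the nonnegative part of [R[i]]; their real parts lie in a totally ordered field,
    where [lra] and [nra] apply. *)
Definition rnorm v : R := complex.Re `|v|.

Lemma rnormE v : `|v| = real_complex R (rnorm v).
Proof.
have := normr_ge0 v; rewrite /rnorm; case: `|v| => x y.
by rewrite lecE /= => /andP[/eqP -> _].
Qed.

Lemma rnorm_ge0 v : 0 <= rnorm v.
Proof. by have := normr_ge0 v; rewrite rnormE ler0c. Qed.

Lemma rnormD u v : rnorm (u + v) <= rnorm u + rnorm v.
Proof. by have := ler_normD u v; rewrite !rnormE -rmorphD lecR. Qed.

Lemma rnormN v : rnorm (- v) = rnorm v.
Proof. by rewrite /rnorm normrN. Qed.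

Lemma rnormB u v : rnorm (u - v) <= rnorm u + rnorm v.
Proof. by rewrite -(rnormN v) rnormD. Qed.

Lemma rnormC u v : rnorm (u - v) = rnorm (v - u).
Proof. by rewrite -rnormN opprB. Qed.

Lemma rnorm0 : rnorm 0 = 0.
Proof. by rewrite /rnorm normr0. Qed.

Lemma rnorm0_eq0 v : rnorm v <= 0 -> v = 0.
Proof.
move=> v0; apply/eqP; rewrite -normr_eq0 rnormE; apply/eqP.
by rewrite (_ : rnorm v = 0)//; apply/le_anti; rewrite v0 rnorm_ge0.
Qed.

Lemma rnorm_gt0 v : v <> 0 -> 0 < rnorm v.
Proof. by move=> v0; rewrite ltNge; apply/negP => /rnorm0_eq0. Qed.

Lemma rnorm_sum I (r : seq I) (P : pred I) (F : I -> V) :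
  rnorm (\sum_(i <- r | P i) F i) <= \sum_(i <- r | P i) rnorm (F i).
Proof.
elim/big_ind2 : _ => [|a b c d ab cd|//]; first by rewrite rnorm0.
by apply: le_trans (rnormD _ _) _; apply: lerD.
Qed.

Lemma rnorm_dist u v w : rnorm (u - w) <= rnorm (u - v) + rnorm (v - w).
Proof. by rewrite (le_trans _ (rnormD _ _))// addrA subrK. Qed.

Lemma rnormZ (k : R[i]) v : rnorm (k *: v) = complex.Re `|k| * rnorm v.
Proof.
rewrite /rnorm normrZ rnormE.
have -> : `|k| = real_complex R (complex.Re `|k|) by rewrite RRe_real.
by rewrite -rmorphM.
Qed.

Lemma rnormZr (k : R) v : 0 <= k -> rnorm (real_complex R k *: v) = k * rnorm v.
Proof. by move=> k0; rewrite rnormZ ger0_norm ?ler0c. Qed.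

Lemma rnorm_ball v (e : R) (w : V) :
  ball v (real_complex R e) w = (rnorm (v - w) < e).
Proof. by rewrite -ball_normE /ball_ /= rnormE ltcR. Qed.

Lemma rnorm_denseP (S : set V) : dense S ->
  forall v (e : R), 0 < e -> exists2 w, S w & rnorm (v - w) < e.
Proof.
move=> dS v e e0.
have [||w [/= vw Sw]] := dS (ball v (real_complex R e)).
- by exists v; rewrite rnorm_ball subrr rnorm0.
- by apply: ball_open; rewrite ltcR.
- by exists w => //; rewrite -rnorm_ball.
Qed.

Lemma rnorm_closedP (S : set V) : closed S ->
  forall v, (forall e : R, 0 < e -> exists2 w, S w & rnorm (v - w) < e) -> S v.
Proof.
move=> cS v Sv; apply: cS => B /nbhs_ballP[e /= e0 eB].
have eE : e = real_complex R (complex.Re e) by rewrite RRe_real// gtr0_real.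
move: e0; rewrite eE ltcR => /Sv[w Sw vw]; exists w; split => //.
by apply: eB; rewrite eE rnorm_ball.
Qed.

End RealNorm.

Lemma rnorm_cauchy_cvg {R : realType} {V : completeNormedModType R[i]}
    (x : nat -> V) :
  (forall e : R, 0 < e -> exists n, forall m, (n <= m)%N -> rnorm (x n - x m) < e) ->
  exists l, forall e : R, 0 < e -> exists n, forall m, (n <= m)%N -> rnorm (l - x m) < e.
Proof.
move=> xC; have /cauchy_cvg/cvg_ex[l xl] : cauchy (x @ \oo).
  apply/cauchy_exP => e e0.
  have eE : e = real_complex R (complex.Re e) by rewrite RRe_real// gtr0_real.
  move: e0; rewrite eE ltcR => /xC[n nP]; exists (x n).
  by exists n => //= m /nP xnm; rewrite /= rnorm_ball.
exists l => e e0; have /xl[n _ nP] : nbhs l (ball l (real_complex R e)).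
  by apply: nbhsx_ballx; rewrite ltcR.
by exists n => m /nP; rewrite /= rnorm_ball.
Qed.

(** Banach's theorem on the closed ball of radius [r], by iteration from 0. It takes the place of
    functional calculus: square roots and inverses are found as fixed points. *)
Lemma half_contraction_fixpoint {R : realType} {V : completeNormedModType R[i]}
    (f : V -> V) (r : R) : 0 <= r ->
  (forall x, rnorm x <= r -> rnorm (f x) <= r) ->
  (forall x y, rnorm x <= r -> rnorm y <= r ->
     rnorm (f x - f y) <= rnorm (x - y) / 2) ->
  exists2 x, rnorm x <= r & f x = x.
Proof.
move=> r0 fr fc; pose x n := iter n f 0.
have xr n : rnorm (x n) <= r by elim: n => [|n /fr//]; rewrite /x /= rnorm0.
have x2 n m : (n <= m)%N -> rnorm (x n - x m) <= 2 * r / 2 ^+ n.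
  elim: n m => [|n IH] [|m]//= nm.
  - by rewrite subrr rnorm0 expr0 divr1 mulr_ge0.
  - rewrite expr0 divr1; apply: le_trans (rnormB _ _) _.
    by rewrite rnorm0 add0r (le_trans (xr m.+1))// mulr_natl mulr2n lerDl.
  - apply: le_trans (fc _ _ (xr _) (xr _)) _.
    by rewrite exprSr invfM mulrA ler_pM2r ?invr_gt0 ?IH.
have small (e : R) : 0 < e -> exists n, 2 * r / 2 ^+ n < e.
  move=> e0; have [n nP] : exists n : nat, 2 * r / e < n%:R.
    by exists (Num.truncn (2 * r / e)).+1; rewrite truncnS_gt.
  exists n; rewrite ltr_pdivrMr ?exprn_gt0// -ltr_pdivrMl// mulrC.
  apply: (lt_trans nP); rewrite -natrX ltr_nat ltn_expl//.
have [e /small[n ne]|l xl] := @rnorm_cauchy_cvg R V x.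
  by exists n => m /x2 nm; apply: le_lt_trans ne.
have lr : rnorm l <= r.
  apply/ler_addgt0Pl => e /xl[n /(_ n (leqnn n)) nP].
  rewrite -(subrK (x n) l); apply: le_trans (rnormD _ _) _.
  exact: lerD (ltW nP) (xr n).
exists l => //; apply/subr0_eq/rnorm0_eq0/ler_addgt0Pl => e e0.
have e2 : 0 < e / 2 by rewrite divr_gt0.
have [n nP] := xl _ e2; rewrite addr0.
apply: le_trans (rnorm_dist _ (x n.+1) _) _.
rewrite [leRHS](splitr e) lerD//.
  apply: le_trans (fc _ _ lr (xr n)) _.
  have := nP n (leqnn n); have := rnorm_ge0 (l - x n); lra.
by rewrite rnormC ltW// nP.
Qed.

(** * Projections, closed ideals and hereditary subalgebras *)

Section CStarTheory.
Context {R : realType} {A : cstarAlgType R}.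
Implicit Types (x y z p q s t : A) (k : R[i]).

Lemma cmul0l x : 0 ** x = 0.
Proof. by apply: (addIr (0 ** x)); rewrite -cmulDl !add0r. Qed.

Lemma cmul0r x : x ** 0 = 0.
Proof. by apply: (addIr (x ** 0)); rewrite -cmulDr !add0r. Qed.

Lemma cmulNl x y : (- x) ** y = - (x ** y).
Proof. by apply/eqP; rewrite -addr_eq0 -cmulDl addNr cmul0l. Qed.

Lemma cmulNr x y : x ** (- y) = - (x ** y).
Proof. by apply/eqP; rewrite -addr_eq0 -cmulDr addNr cmul0r. Qed.

Lemma cmulBl x y z : (x - y) ** z = x ** z - y ** z.
Proof. by rewrite cmulDl cmulNl. Qed.

Lemma cmulBr x y z : x ** (y - z) = x ** y - x ** z.
Proof. by rewrite cmulDr cmulNr. Qed.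

Lemma cmul_suml I (r : seq I) (P : pred I) (F : I -> A) x :
  (\sum_(i <- r | P i) F i) ** x = \sum_(i <- r | P i) F i ** x.
Proof. by elim/big_rec2 : _ => [|i a b _ <-]; rewrite ?cmul0l// cmulDl. Qed.

Lemma cmul_sumr I (r : seq I) (P : pred I) (F : I -> A) x :
  x ** (\sum_(i <- r | P i) F i) = \sum_(i <- r | P i) x ** F i.
Proof. by elim/big_rec2 : _ => [|i a b _ <-]; rewrite ?cmul0r// cmulDr. Qed.

Lemma cstar0 : 0^#* = 0 :> A.
Proof. by apply: (addIr 0^#*); rewrite -cstarD !add0r. Qed.

Lemma cstarN x : (- x)^#* = - x^#*.
Proof. by apply/eqP; rewrite -addr_eq0 -cstarD addNr cstar0. Qed.

Lemma cstarB x y : (x - y)^#* = x^#* - y^#*.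
Proof. by rewrite cstarD cstarN. Qed.

Lemma cstar_sum I (r : seq I) (P : pred I) (F : I -> A) :
  (\sum_(i <- r | P i) F i)^#* = \sum_(i <- r | P i) (F i)^#*.
Proof. by elim/big_rec2 : _ => [|i a b _ <-]; rewrite ?cstar0// cstarD. Qed.

Lemma cstarZr (k : R) x : (real_complex R k *: x)^#* = real_complex R k *: x^#*.
Proof. by rewrite cstarZ [_^*]conjc_real. Qed.

Lemma rnormM x y : rnorm (x ** y) <= rnorm x * rnorm y.
Proof. by have := cnormM x y; rewrite !rnormE -rmorphM lecR. Qed.

Lemma rnorm_starM x : rnorm (x^#* ** x) = rnorm x ^+ 2.
Proof.
by apply: complexI; rewrite rmorphXn /= -!rnormE cnorm_star.
Qed.

Lemma rnorm_star x : rnorm x^#* = rnorm x.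
Proof.
suff H y : rnorm y <= rnorm y^#*.
  by apply/le_anti; rewrite H andbT -{2}(cstarK x) H.
have [->|/eqP y0] := eqVneq y 0; first by rewrite cstar0.
rewrite -(ler_pM2r (rnorm_gt0 y0)) -expr2 -rnorm_starM.
by rewrite rnormM.
Qed.

Lemma starM_eq0 x : x^#* ** x = 0 -> x = 0.
Proof.
move=> xx; apply: rnorm0_eq0; have := rnorm_starM x; rewrite xx rnorm0.
by move/esym/eqP; rewrite sqrf_eq0 => /eqP ->.
Qed.

Lemma rnorm_projection p : projection p -> rnorm p <= 1.
Proof.
move=> [ps pp]; have := rnorm_starM p; rewrite ps pp.
by have := rnorm_ge0 p; nra.
Qed.

(* s = 1 - sqrt (1 - t), as the fixed point of s |-> (t + s^2) / 2; written
   without 1 because the algebra need not be unital. *)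
Lemma half_sqrt t : t^#* = t -> rnorm t <= 1 / 2 ->
  exists s, [/\ s^#* = s, rnorm s <= 1 / 2 & t = s + s - s ** s].
Proof.
move=> ts t2; pose h : R[i] := real_complex R (1 / 2).
pose f s := h *: (t + s ** s).
have h0 : 0 <= 1 / 2 :> R by lra.
have [||s s2 fs] := @half_contraction_fixpoint R A f _ h0.
- move=> x x2; rewrite /f rnormZr//.
  have := rnormD t (x ** x); have := rnormM x x; have := rnorm_ge0 x; nra.
- move=> x y x2 y2; rewrite /f -scalerBr rnormZr// opprD addrACA subrr add0r.
  have -> : x ** x - y ** y = (x - y) ** x + y ** (x - y).
    by rewrite cmulBl cmulBr addrA subrK.
  have := rnormD ((x - y) ** x) (y ** (x - y)).
  have := rnormM (x - y) x; have := rnormM y (x - y).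
  have := rnorm_ge0 x; have := rnorm_ge0 (x - y); have := rnorm_ge0 y; nra.
have ss : s + s = t + s ** s.
  rewrite -{1 2}fs /f -scalerDl -rmorphD /=.
  by rewrite (_ : 1 / 2 + 1 / 2 = 1) ?scale1r//; lra.
exists s; split => //; last by rewrite ss addrK.
(* The fixed point lemma gives no uniqueness. Here s^* solves the same equation, and d = s^* - s
   satisfies 2 d = d s^* + s d, so that 2 |d| <= |d|. *)
have ss' : s^#* + s^#* = t + s^#* ** s^#* by rewrite -cstarD ss cstarD cstarM ts.
apply/subr0_eq/rnorm0_eq0; set d := s^#* - s.
have dE : d + d = d ** s^#* + s ** d.
  rewrite /d addrACA -opprD ss ss' opprD addrACA subrr add0r.
  by rewrite cmulBl cmulBr addrA subrK.
have : rnorm (d + d) = 2 * rnorm d.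
  by rewrite -mulr2n -scaler_nat rnormZ normr_nat -(rmorph_nat (real_complex R)).
rewrite dE; have := rnormD (d ** s^#*) (s ** d).
have := rnormM d s^#*; have := rnormM s d; rewrite rnorm_star.
have := rnorm_ge0 s; have := rnorm_ge0 d; nra.
Qed.

(** In the corner with unit [p], c = p b p is the square of p - s, where s comes from [half_sqrt]
    for p - c. The inverse of p - s is its Neumann series, found as the fixed point of g |-> p + s
    g; it lies in the ball of radius 2 because |p| <= 1 and |s| <= 1/2. *)
Lemma corner_inverse_sqrt p b : projection p -> b^#* = b ->
  rnorm (p - p ** b ** p) <= 1 / 2 ->
  exists d, [/\ d^#* = d, p ** d = d, d ** p = d & d ** (p ** b ** p) ** d = p].
Proof.
move=> pp bs; have [ps p2] := pp; set c := p ** b ** p => c2.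
have cs : c^#* = c by rewrite /c !cstarM ps bs cmulA.
have pc : p ** c = c by rewrite /c !cmulA p2.
have [s [ss s2 sE]] : exists s, [/\ s^#* = s, rnorm s <= 1 / 2 &
    p - c = s + s - s ** s] by apply: half_sqrt => //; rewrite cstarB ps cs.
(* Multiplying 2 s - s^2 = p - c by p on the left shows that d = s - p s satisfies 2 d = d s, and
   |s| <= 1/2 forces d = 0. *)
have p_s : p ** s = s.
  apply/esym/subr0_eq/rnorm0_eq0; set d := s - _.
  have dE : d + d = d ** s.
    have : s + s - s ** s = p ** (s + s - s ** s).
      by rewrite -sE cmulBr p2 pc.
    rewrite cmulBr cmulDr cmulA => E.
    rewrite /d addrACA -opprD -(subrK (s ** s) (s + s)) E cmulBl.
    set a := p ** s + p ** s; rewrite addrAC [a - _ + _]addrAC subrr add0r.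
    by rewrite addrC.
  have : rnorm (d + d) = 2 * rnorm d.
    by rewrite -mulr2n -scaler_nat rnormZ normr_nat -(rmorph_nat (real_complex R)).
  rewrite dE; have := rnormM d s.
  have := rnorm_ge0 s; have := rnorm_ge0 d; nra.
have s_p : s ** p = s by have := congr1 cstar p_s; rewrite cstarM ps ss.
have cE : c = (p - s) ** (p - s).
  rewrite cmulBl !cmulBr p2 p_s s_p -(subKr p c) sE.
  by rewrite !opprB addrA addrACA -opprD addrC addrCA.
pose f g := p + s ** g.
have h0 : 0 <= 2 :> R by [].
have [||g g2 fg] := @half_contraction_fixpoint R A f _ h0.
- move=> x x2; rewrite /f; have := rnormD p (s ** x); have := rnormM s x.
  by have := rnorm_projection pp; have := rnorm_ge0 s; have := rnorm_ge0 x; nra.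
- move=> x y _ _; rewrite /f opprD addrACA subrr add0r -cmulBr.
  by have := rnormM s (x - y); have := rnorm_ge0 (x - y); nra.
have pg : p ** g = g by rewrite -fg /f cmulDr p2 cmulA p_s.
have eg : (p - s) ** g = p by rewrite cmulBl pg -{1}fg /f addrK.
have ge : g^#* ** (p - s) = p.
  by have := congr1 cstar eg; rewrite cstarM cstarB ps ss.
have gs : g^#* = g.
  rewrite -[RHS]pg -[in RHS]ge -cmulA eg.
  by have := congr1 cstar pg; rewrite cstarM ps.
have gp : g ** p = g by have := congr1 cstar pg; rewrite cstarM ps gs.
exists g; split => //; rewrite cE !cmulA -{1}gs ge -cmulA eg//.
Qed.

(** The element y d^* d y^* is dominated by M y y^*, which lies in [B]. *)
Lemma hereditary_conj (B : set A) y d : hereditary B -> B y ->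
  B (y ** (d^#* ** d) ** y^#*).
Proof.
move=> [[[_ B0 BD BZ] BM Bs] Bh] By.
(* M exceeds 2 |d^* d|, so that d^* d / M falls under [half_sqrt]; the added 1 keeps M positive when
   d = 0. *)
pose t := d^#* ** d; pose M := 2 * (rnorm t + 1).
have t0 := rnorm_ge0 t; have M0 : 0 < M by rewrite /M; lra.
have ts : t^#* = t by rewrite cstarM cstarK.
pose u := real_complex R M^-1 *: t.
have [s [ss s2 uE]] : exists s, [/\ s^#* = s, rnorm s <= 1 / 2 &
    u = s + s - s ** s].
  apply: half_sqrt; first by rewrite cstarZr ts.
  rewrite /u rnormZr ?invr_ge0 ?(ltW M0)// mulrC ler_pdivrMr//.
  by rewrite /M; lra.
pose r := real_complex R (Num.sqrt M).
have rr : r * r = real_complex R M.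
  by rewrite -rmorphM -expr2 sqr_sqrtr// ltW.
apply: (Bh _ (real_complex R M *: (y ** y^#*))).
- by apply: BZ; apply: BM => //; apply: Bs.
- by exists (d ** y^#*); rewrite cstarM cstarK !cmulA.
(* M y y^* - y d^* d y^* = M y (1 - u) y^* = M (y (1 - s)) (y (1 - s))^* *)
exists (r *: (y - y ** s)^#*).
rewrite cstarZr cstarK -cscalerAl -cscalerAr scalerA rr.
have -> : d^#* ** d = real_complex R M *: u.
  by rewrite /u scalerA -rmorphM mulfV ?gt_eqF// scale1r.
rewrite -cscalerAr -cscalerAl -scalerBr; congr (_ *: _).
rewrite cstarB cstarM ss cmulBl !cmulBr uE cmulBr cmulDr !cmulBl cmulDl !cmulA.
by rewrite -(addrA (y ** s ** y^#*)) opprD addrA.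
Qed.

(** (v - v p)^* (v - v p) expands to 0, and the C*-identity applies. *)
Lemma partial_isometry_mulr v p : projection p -> v^#* ** v = p -> v ** p = v.
Proof.
move=> [ps pp] vp; apply/esym/subr0_eq/starM_eq0.
rewrite cstarB cstarM ps cmulBl !cmulBr !cmulA vp -(cmulA p _ v) vp !pp.
by rewrite !subrr.
Qed.

(** Conjugation by v carries a proper subprojection r of p, and the partial isometry w between them,
    to v r v^* and v w v^*. Multiplying by v^* and v brings v r v^* = q back to r = p. *)
Lemma murray_von_neumann_infinite p q : projection q ->
  murray_von_neumann p q -> infinite_projection p -> infinite_projection q.
Proof.
move=> qq [v [vp vq]] [pp [r [rr pr rnp [w [wp wr]]]]]; split => //.
have [ps p2] := pp; have [rs r2] := rr.
have vpv := partial_isometry_mulr pp vp; have wpw := partial_isometry_mulr pp wp.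
have psv : p ** v^#* = v^#* by rewrite -{2}vpv cstarM ps.
have pw : p ** w = w.
  have rw : r ** w = w by rewrite -wr -cmulA wp.
  by rewrite -{1}rw cmulA pr.
have rp : r ** p = r by have := congr1 cstar pr; rewrite cstarM ps rs.
exists (v ** r ** v^#*); split.
- split; first by rewrite !cstarM cstarK rs cmulA.
  by rewrite !cmulA -(cmulA _ _ v) vp -(cmulA _ p) pr -(cmulA v) r2.
- by rewrite -vq !cmulA -(cmulA _ _ v) vp vpv.
- move=> E; apply: rnp; have := congr1 (fun x => v^#* ** x ** v) E.
  rewrite -vq !cmulA vp pr -!cmulA vp rp => ->.
  by rewrite !p2.
exists (v ** w ** v^#*); split.
- rewrite !cstarM cstarK !cmulA -(cmulA _ _ v) vp -(cmulA _ p) pw.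
  by rewrite -(cmulA _ _ w) wp vpv.
- rewrite !cstarM cstarK !cmulA -(cmulA _ _ v) vp -(cmulA _ p).
  by rewrite cmulA -(cmulA v) wpw -(cmulA v) wr.
Qed.

(** The element d of [corner_inverse_sqrt] exhibits p as d p b p d. *)
Lemma corner_in_closed_ideal (I : set A) p b : closed_ideal I -> I b ->
  b^#* = b -> projection p -> rnorm (p - p ** b ** p) <= 1 / 2 -> I p.
Proof.
move=> [_ Imul] Ib bs pp /(corner_inverse_sqrt pp bs)[d [_ _ _ <-]].
have [_ pb] := Imul b p Ib; have [pbp _] := Imul _ p pb.
by have [_ h] := Imul _ d pbp; have [] := Imul _ d h.
Qed.

(** With d from [corner_inverse_sqrt], v = sqrt(k) y d satisfies v^* v = p, and v v^* = k y d^2 y^*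
    lies in [B] by [hereditary_conj]. *)
Lemma corner_in_hereditary (B : set A) p y (k : R) : hereditary B -> B y ->
  projection p -> 0 < k ->
  rnorm (p - p ** (real_complex R k *: (y^#* ** y)) ** p) <= 1 / 2 ->
  exists q, [/\ B q, projection q & murray_von_neumann p q].
Proof.
move=> hB By pp k0.
have yys : (real_complex R k *: (y^#* ** y))^#* = real_complex R k *: (y^#* ** y).
  by rewrite cstarZr cstarM cstarK.
move=> /(corner_inverse_sqrt pp yys)[d [ds pd dp dE]].
pose r := real_complex R (Num.sqrt k).
have rr : r * r = real_complex R k.
  by rewrite -rmorphM -expr2 sqr_sqrtr// ltW.
pose v := r *: (y ** d).
have vp : v^#* ** v = p.
  rewrite -[RHS]dE /v cstarZr -cscalerAl -cscalerAr scalerA rr cstarM ds.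
  by rewrite -cscalerAr -cscalerAl -!cscalerAr -!cscalerAl !cmulA dp -!cmulA pd.
have vpv := partial_isometry_mulr pp vp.
exists (v ** v^#*); split; last by exists v.
  have -> : v ** v^#* = real_complex R k *: (y ** (d^#* ** d) ** y^#*).
    by rewrite /v cstarZr -cscalerAl -cscalerAr scalerA rr cstarM !cmulA ds.
  have [[[_ _ _ BZ] _ _] _] := hB.
  by apply: BZ; apply: hereditary_conj.
split; first by rewrite cstarM cstarK.
by rewrite !cmulA -(cmulA _ _ v) vp vpv.
Qed.

End CStarTheory.

(** * Hilbert spaces of square-summable families *)

Section HilbertTheory.
Context {R : realType} {V : hilbertType R}.
Implicit Types u v w : V.

Lemma innerDr u v w : inner u (v + w) = inner u v + inner u w.
Proof. by rewrite innerC innerDl rmorphD /= -!innerC. Qed.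

Lemma innerZr (k : R[i]) u v : inner u (k *: v) = k^* * inner u v.
Proof. by rewrite innerC innerZl rmorphM /= -innerC. Qed.

Lemma innerNl u v : inner (- u) v = - inner u v.
Proof. by rewrite -scaleN1r innerZl mulN1r. Qed.

Lemma innerNr u v : inner u (- v) = - inner u v.
Proof. by rewrite innerC innerNl rmorphN /= -innerC. Qed.

Lemma inner_rnorm u : inner u u = real_complex R (rnorm u ^+ 2).
Proof. by rewrite inner_norm rnormE rmorphXn. Qed.

Lemma rnormD_sqr u v : rnorm (u + v) ^+ 2 =
  rnorm u ^+ 2 + rnorm v ^+ 2 + 2 * complex.Re (inner u v).
Proof.
apply: complexI; rewrite -inner_rnorm innerDl !innerDr !inner_rnorm.
rewrite (innerC u v); case: (inner u v) => a b.
by simpc; apply/eqP; rewrite eq_complex /=; apply/andP; split; apply/eqP; ring.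
Qed.

(** The real form of polarization; together with [Im_inner] it recovers the inner product from the
    norm. *)
Lemma rnorm_parallelogram u v : complex.Re (inner u v) =
  (rnorm (u + v) ^+ 2 - rnorm (u - v) ^+ 2) / 4.
Proof.
rewrite !rnormD_sqr rnormN innerNr raddfN /=; lra.
Qed.

Lemma rnormD_sqr_le u v : rnorm (u + v) ^+ 2 <= 2 * rnorm u ^+ 2 + 2 * rnorm v ^+ 2.
Proof. by have := sqr_ge0 (rnorm (u - v)); rewrite !rnormD_sqr rnormN innerNr raddfN /=; lra. Qed.

Lemma Im_inner u v : complex.Im (inner u v) = complex.Re (inner u ('i *: v)).
Proof.
rewrite innerZr; case: (inner u v) => a b.
by rewrite -complexiE [_^*]/= ; simpc.
Qed.

End HilbertTheory.

(** * The scalar field as a Hilbert space *)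

Section ComplexHilbert.
Context {R : realType}.

Lemma normc_le_ReIm (z : R[i]) :
  `|z| <= real_complex R (`|complex.Re z| + `|complex.Im z|).
Proof.
rewrite {1}(complexE z); apply: le_trans (ler_normD _ _) _.
rewrite normrM !normc_def /= !expr0n /= !expr1n !addr0 add0r sqrtr1 mul1r.
by rewrite -rmorphD /= lecR !sqrtr_sqr.
Qed.

Lemma complex_complete (F : set_system R[i]^o) :
  ProperFilter F -> cauchy F -> cvg F.
Proof.
move=> FF /cauchy_ballP F_cauchy.
have Fpart (h : R[i] -> R) : {morph h : x y / x - y} ->
    (forall z, `|h z| <= complex.Re `|z|) -> cvg ((h : R[i]^o -> R) @ F).
  move=> hB hle; apply: R_complete; apply/cauchy_ballP => e e0.
  have ce0 : 0 < real_complex R e by rewrite ltcR.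
  have [/= [U1 U2] [FU1 FU2] UU] := F_cauchy _ ce0.
  exists (h @` U1, h @` U2).
    by split; [apply: filterS FU1|apply: filterS FU2] => z Uz; exists z.
  move=> [_ _] /= [[z Uz <-] [w Uw <-]].
  have := UU (z, w); rewrite /= -!ball_normE /ball_ /= => /(_ (conj Uz Uw)) zw.
  rewrite -hB; apply: le_lt_trans (hle _) _.
  by move: zw; rewrite ltcE /= => /andP[].
have /cvg_ex[a Fa] : cvg ((@complex.Re R : R[i]^o -> R) @ F).
  apply: Fpart => [[? ?] [? ?]//|z].
  by rewrite normc_def /= -sqrtr_sqr ler_wsqrtr// lerDl sqr_ge0.
have /cvg_ex[b Fb] : cvg ((@complex.Im R : R[i]^o -> R) @ F).
  apply: Fpart => [[? ?] [? ?]//|z].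
  by rewrite normc_def /= -sqrtr_sqr ler_wsqrtr// lerDr sqr_ge0.
apply/cvg_ex; exists (Complex a b).
apply/cvgrPdist_lt => e e0.
have eE : e = real_complex R (complex.Re e) by rewrite RRe_real// gtr0_real.
have e2 : 0 < complex.Re e / 2 by move: e0; rewrite eE ltcR => ?; rewrite divr_gt0.
move/cvgrPdist_lt: Fa => /(_ _ e2) Fa; move/cvgrPdist_lt: Fb => /(_ _ e2) Fb.
near=> z; apply: le_lt_trans (normc_le_ReIm _) _.
rewrite eE ltcR raddfB [complex.Im _]raddfB /= (splitr (complex.Re e)).
by apply: ltrD; near: z.
Unshelve. all: by end_near. Qed.

Definition cplx (R : realType) : Type := R[i]^o.

HB.instance Definition _ := NormedModule.on (cplx R).
HB.instance Definition _ := Uniform_isComplete.Build (cplx R) complex_complete.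

Definition cplx_inner (u v : cplx R) : R[i] := u * v^*.

Fact cplx_innerDl u v w : cplx_inner (u + v) w = cplx_inner u w + cplx_inner v w.
Proof. exact: mulrDl. Qed.

Fact cplx_innerZl (k : R[i]) u v : cplx_inner (k *: u) v = k * cplx_inner u v.
Proof. by rewrite /cplx_inner mulrA. Qed.

Fact cplx_innerC u v : cplx_inner v u = (cplx_inner u v)^*.
Proof. by rewrite /cplx_inner rmorphM /= conjCK mulrC. Qed.

Fact cplx_inner_norm (u : cplx R) : cplx_inner u u = `|u| ^+ 2.
Proof. exact/esym/(@normCK R[i] u). Qed.

HB.instance Definition _ := isHilbert.Build R (cplx R)
  cplx_innerDl cplx_innerZl cplx_innerC cplx_inner_norm.

End ComplexHilbert.

(* Square-summable families indexed by an arbitrary set *)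
Local Existing Instance totally_filter.

Section SquareSummable.
Context {R : realType} {T : choiceType} {V : hilbertType R}.
Implicit Types (f g : T -> V) (J : {fset T}).

Definition sqsum f J : R := \sum_(t <- J) rnorm (f t) ^+ 2.

Lemma sqsum_ge0 f J : 0 <= sqsum f J.
Proof. by apply: sumr_ge0 => t _; rewrite sqr_ge0. Qed.

Lemma sqsum_le f J K : (J `<=` K)%fset -> sqsum f J <= sqsum f K.
Proof.
move=> JK; rewrite /sqsum (big_fsetID _ (fun x => x \in J) K) /=.
rewrite (_ : [fset x in K | x \in J]%fset = J) ?lerDl ?sumr_ge0// => [t _|].
  by rewrite sqr_ge0.
apply/fsetP => t; rewrite !inE /=.
by apply/andP/idP => [[]//|tJ]; rewrite (fsubsetP JK).
Qed.

Lemma sqsum_indicator (K : {fset T}) (v : V) J :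
  sqsum (fun t => if t \in K then v else 0) J <= #|` K|%:R * rnorm v ^+ 2.
Proof.
apply: le_trans (sqsum_le _ (fsubsetUr K J)) _.
rewrite /sqsum -(@big_fset_incl _ _ _ _ K) ?fsubsetUl//; last first.
  by move=> t _ /negPf tK; rewrite tK rnorm0 expr0n.
rewrite big_seq (eq_bigr (fun=> rnorm v ^+ 2)) => [|t tK]; last by rewrite tK.
by rewrite -big_seq big_const_seq count_predT iter_addr_0 mulr_natl.
Qed.

(** Square-summability as boundedness of the finite partial sums, which involves neither an order on
    [T] nor countability. *)
Definition l2_pred : {pred T -> V} :=
  fun f => `[< exists M, forall J, sqsum f J <= M >].

Lemma l2_predP f : reflect (exists M, forall J, sqsum f J <= M) (f \in l2_pred).
Proof. exact: asboolP. Qed.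

Fact l2_submod_closed : GRing.subsemimod_closed l2_pred.
Proof.
split; [split|].
- apply/l2_predP; exists 0 => J; rewrite /sqsum big1// => t _.
  by rewrite rnorm0 expr0n.
- move=> f g /l2_predP[M fM] /l2_predP[M' gM]; apply/l2_predP.
  exists (2 * M + 2 * M') => J.
  apply: (@le_trans _ _ (2 * sqsum f J + 2 * sqsum g J)); last first.
    by have := fM J; have := gM J; lra.
  rewrite /sqsum !mulr_sumr -big_split; apply: ler_sum => t _.
  exact: rnormD_sqr_le.
- move=> k f /l2_predP[M fM]; apply/l2_predP.
  exists (complex.Re `|k| ^+ 2 * M) => J.
  rewrite /sqsum (eq_bigr (fun t => complex.Re `|k| ^+ 2 * rnorm (f t) ^+ 2)).
    by rewrite -mulr_sumr ler_wpM2l ?sqr_ge0// fM.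
  by move=> t _; rewrite rnormZ exprMn.
Qed.

HB.instance Definition _ :=
  GRing.isSubmodClosed.Build R[i] (T -> V) l2_pred l2_submod_closed.

Record l2 := MkL2 { l2_fun :> T -> V; _ : l2_fun \in l2_pred }.
HB.instance Definition _ := [isSub for l2_fun].
HB.instance Definition _ := [Choice of l2 by <:].
HB.instance Definition _ := [SubChoice_isSubLmodule of l2 by <:].

Implicit Types (x y z : l2).

Lemma l2P x : exists M, forall J, sqsum x J <= M.
Proof. by case: x => f /= /l2_predP. Qed.

Lemma l2_ext x y : (x : T -> V) =1 y -> x = y.
Proof. by move=> xy; apply: val_inj; apply/funext. Qed.

Lemma l2DE x y t : (x + y) t = x t + y t. Proof. by []. Qed.
Lemma l2NE x t : (- x) t = - x t. Proof. by []. Qed.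
Lemma l2ZE (k : R[i]) x t : (k *: x) t = k *: x t. Proof. by []. Qed.

Lemma l2_sumE I (r : seq I) (P : pred I) (F : I -> l2) t :
  (\sum_(i <- r | P i) F i) t = \sum_(i <- r | P i) F i t.
Proof. by elim/big_rec2 : _ => [//|i a b _ <-]. Qed.

Definition l2_sqnorm x : R := sup [set sqsum x J | J in [set: {fset T}]].

Lemma l2_has_sup x : has_sup [set sqsum x J | J in [set: {fset T}]].
Proof.
split; first by exists (sqsum x fset0); exists fset0.
by have [M xM] := l2P x; exists M => _ [J _ <-].
Qed.

Lemma sqsum_le_sqnorm x J : sqsum x J <= l2_sqnorm x.
Proof. by apply: sup_upper_bound; [exact: l2_has_sup|exists J]. Qed.

Lemma l2_sqnorm_le x M : (forall J, sqsum x J <= M) -> l2_sqnorm x <= M.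
Proof.
move=> xM; apply: ge_sup; first by exists (sqsum x fset0); exists fset0.
by move=> _ [J _ <-].
Qed.

Lemma l2_sqnorm_ge0 x : 0 <= l2_sqnorm x.
Proof. exact: le_trans (sqsum_ge0 x fset0) (sqsum_le_sqnorm _ _). Qed.

Definition l2_norm x : R := Num.sqrt (l2_sqnorm x).

Lemma l2_norm_ge0 x : 0 <= l2_norm x.
Proof. exact: sqrtr_ge0. Qed.

Lemma sqr_l2_norm x : l2_norm x ^+ 2 = l2_sqnorm x.
Proof. by rewrite sqr_sqrtr// l2_sqnorm_ge0. Qed.

Lemma l2_norm_le x (M : R) : 0 <= M ->
  (forall J, sqsum x J <= M ^+ 2) -> l2_norm x <= M.
Proof.
move=> M0 xM; rewrite -(ger0_norm M0) -sqrtr_sqr ler_wsqrtr//.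
exact: l2_sqnorm_le.
Qed.

(** Minkowski's inequality without Cauchy-Schwarz: for c, d > 0 one has (u + v)^2 <= (1 + d/c) u^2 +
    (1 + c/d) v^2, and these weights turn the bounds c^2 and d^2 into (c + d)^2. Bounds equal to 0
    are reached by enlarging [a] and [b] slightly. *)
Lemma sqsum_triangle f g J (a b : R) : 0 <= a -> 0 <= b ->
  sqsum f J <= a ^+ 2 -> sqsum g J <= b ^+ 2 ->
  sqsum (f \+ g) J <= (a + b) ^+ 2.
Proof.
move=> a0 b0 fa gb.
have H (c d : R) : 0 < c -> 0 < d -> sqsum f J <= c ^+ 2 ->
    sqsum g J <= d ^+ 2 -> sqsum (f \+ g) J <= (c + d) ^+ 2.
  move=> c0 d0 fc gd.
  apply: (@le_trans _ _ ((1 + d / c) * sqsum f J + (1 + c / d) * sqsum g J)).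
    rewrite /sqsum !mulr_sumr -big_split; apply: ler_sum => t _ /=.
    have := rnormD (f t) (g t); have := rnorm_ge0 (f t + g t).
    have := rnorm_ge0 (f t); have := rnorm_ge0 (g t).
    move: (rnorm (f t)) (rnorm (g t)) (rnorm (f t + g t)) => u v w v0 u0 w0 wuv.
    have /le_trans -> // : w ^+ 2 <= (u + v) ^+ 2 by rewrite ler_sqr ?nnegrE ?addr_ge0.
    rewrite -subr_ge0.
    have -> : (1 + d / c) * u ^+ 2 + (1 + c / d) * v ^+ 2 - (u + v) ^+ 2 =
        (d * u - c * v) ^+ 2 / (c * d) by field; rewrite !gt_eqF.
    by rewrite divr_ge0 ?sqr_ge0// mulr_ge0 ?ltW.
  have -> : (c + d) ^+ 2 = (1 + d / c) * c ^+ 2 + (1 + c / d) * d ^+ 2.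
    by field; rewrite !gt_eqF.
  by apply: lerD; rewrite ler_wpM2l// addr_ge0// divr_ge0// ltW.
apply/ler_addgt0Pl => e e0.
(* Since d <= 1, (a + b + d)^2 - (a + b)^2 <= d (2 (a + b) + 1) <= e. *)
pose d := Num.min 1 (e / (2 * (a + b) + 4)).
have q0 : 0 < 2 * (a + b) + 4 by lra.
have d0 : 0 < d by rewrite /d lt_min ltr01 divr_gt0.
have d1 : d <= 1 by rewrite /d ge_min lexx.
have de : d * (2 * (a + b) + 4) <= e.
  by rewrite -ler_pdivlMr// /d ge_min lexx orbT.
by apply: le_trans (H (a + d / 2) (b + d / 2) _ _ _ _) _; nra.
Qed.

Fact l2_normD x y : l2_norm (x + y) <= l2_norm x + l2_norm y.
Proof.
apply: l2_norm_le => [|J]; first by rewrite addr_ge0 ?l2_norm_ge0.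
by apply: sqsum_triangle; rewrite ?l2_norm_ge0// sqr_l2_norm sqsum_le_sqnorm.
Qed.

Lemma rnorm_le_l2_norm x t : rnorm (x t) <= l2_norm x.
Proof.
rewrite -(ger0_norm (rnorm_ge0 (x t))) -sqrtr_sqr ler_wsqrtr//.
apply: le_trans (sqsum_le_sqnorm x [fset t]%fset).
by rewrite /sqsum big_seq_fset1.
Qed.

Lemma l2_sqnormZ (k : R[i]) x :
  l2_sqnorm (k *: x) <= complex.Re `|k| ^+ 2 * l2_sqnorm x.
Proof.
apply: l2_sqnorm_le => J; rewrite /sqsum.
rewrite (eq_bigr (fun t => complex.Re `|k| ^+ 2 * rnorm (x t) ^+ 2)).
  by rewrite -mulr_sumr ler_wpM2l ?sqr_ge0// sqsum_le_sqnorm.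
by move=> t _; rewrite l2ZE rnormZ exprMn.
Qed.

Lemma l2_normZ_le (k : R[i]) x : l2_norm (k *: x) <= complex.Re `|k| * l2_norm x.
Proof.
have k0 : 0 <= complex.Re `|k| by rewrite -ler0c RRe_real.
rewrite -[in leRHS](ger0_norm k0) -sqrtr_sqr -sqrtrM ?sqr_ge0//.
by rewrite ler_wsqrtr// l2_sqnormZ.
Qed.

Definition l2_cnorm x : R[i] := real_complex R (l2_norm x).

Fact l2_cnormD x y : l2_cnorm (x + y) <= l2_cnorm x + l2_cnorm y.
Proof. by rewrite /l2_cnorm -rmorphD lecR l2_normD. Qed.

Fact l2_cnormZ (k : R[i]) x : l2_cnorm (k *: x) = `|k| * l2_cnorm x.
Proof.
have kE (h : R[i]) : `|h| = real_complex R (complex.Re `|h|) by rewrite RRe_real.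
rewrite /l2_cnorm kE -rmorphM; congr (real_complex R _).
apply/le_anti; rewrite l2_normZ_le andTb.
have [->|k0] := eqVneq k 0; first by rewrite normr0 mul0r l2_norm_ge0.
have k1 : 0 < complex.Re `|k| by rewrite -ltcR -kE normr_gt0.
rewrite -ler_pdivlMl// -[in leLHS](scale1r x) -(mulVf k0) -scalerA.
apply: le_trans (l2_normZ_le _ _) _; rewrite ler_wpM2r ?l2_norm_ge0//.
by rewrite normfV kE -fmorphV.
Qed.

Fact l2_cnorm_eq0 x : l2_cnorm x = 0 -> x = 0.
Proof.
move=> /complexI x0; apply: l2_ext => t; apply: rnorm0_eq0.
by rewrite -x0 rnorm_le_l2_norm.
Qed.

HB.instance Definition _ := Lmodule_isNormed.Build R[i] l2
  l2_cnormD l2_cnormZ l2_cnorm_eq0.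

Lemma rnorm_l2 x : rnorm x = l2_norm x. Proof. by []. Qed.

(** For given J, one y near x in norm and near f at the finitely many points of J is enough. The
    resulting bound does not depend on J, which makes the pointwise limit square-summable and a
    limit in norm. *)
Lemma l2_cauchy_approx (F : set_system l2) (f : T -> V) :
  ProperFilter F -> (forall t, (fun x : l2 => x t) @ F --> f t) ->
  forall (x : l2) (e : R), 0 < e -> F (ball x (real_complex R e)) ->
  forall J, sqsum (fun t => x t - f t) J <= (e + e) ^+ 2.
Proof.
move=> FF Ff x e e0 Fx J.
(* Chosen so that n d^2 <= e^2; the successor keeps d positive when J is empty. *)
pose n := #|` J|; pose d := e / n.+1%:R.
have n0 : 0 < n.+1%:R :> R by rewrite ltr0n.
have d0 : 0 < d by rewrite divr_gt0.
have [y [xy yf]] : exists y, ball x (real_complex R e) y /\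
    forall t : J, rnorm (f (val t) - y (val t)) < d.
  apply: (@filter_ex _ F); apply: filterI => //.
  apply: filter_forall => t; have /Ff : nbhs (f (val t)) (ball (f (val t)) (real_complex R d)).
    by apply: nbhsx_ballx; rewrite ltcR.
  by rewrite /nbhs /=; apply: filterS => y; rewrite /= rnorm_ball.
have -> : (fun t => x t - f t) = (fun t => x t - y t) \+ (fun t => y t - f t).
  by apply/funext => t /=; rewrite addrA subrK.
apply: sqsum_triangle; rewrite ?(ltW e0)//.
  apply: le_trans (sqsum_le_sqnorm (x - y) J) _.
  rewrite -sqr_l2_norm ler_sqr ?nnegrE ?l2_norm_ge0 ?ltW//.
  by rewrite -rnorm_l2 -rnorm_ball.
apply: (@le_trans _ _ (\sum_(t <- J) d ^+ 2)).
  rewrite /sqsum big_seq [leRHS]big_seq; apply: ler_sum => t tJ.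
  rewrite ler_sqr ?nnegrE ?rnorm_ge0 ?ltW//.
  by rewrite rnormC (yf [` tJ]%fset).
rewrite big_const_seq count_predT iter_addr_0 -/n -mulr_natr /d expr_div_n.
rewrite mulrAC ler_pdivrMr ?exprn_gt0// ler_wpM2l ?sqr_ge0//.
by rewrite -natrX ler_nat; nia.
Qed.

Lemma l2_complete (F : set_system l2) : ProperFilter F -> cauchy F -> cvg F.
Proof.
move=> FF /cauchyP Fc.
have Fr (e : R) : 0 < e -> exists x, F (ball x (real_complex R e)).
  by move=> e0; apply: Fc; rewrite ltcR.
have Ft t : cvg ((fun x : l2 => x t) @ F).
  apply: cauchy_cvg; apply: cauchy_exP => e e0.
  have eE : e = real_complex R (complex.Re e) by rewrite RRe_real// gtr0_real.
  move: e0; rewrite eE ltcR => /Fr[x Fx]; exists (x t).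
  suff : F [set z | ball (x t) (real_complex R (complex.Re e)) (z t)] by [].
  apply: filterS Fx => y; rewrite [ball x _ y]rnorm_ball rnorm_l2 => xy /=.
  by rewrite rnorm_ball; apply: le_lt_trans xy; exact: (rnorm_le_l2_norm (x - y) t).
pose f t := lim ((fun x : l2 => x t) @ F).
have Ff t : (fun x : l2 => x t) @ F --> f t by exact: Ft.
have app := l2_cauchy_approx FF Ff.
have f2 : f \in l2_pred.
  have [x Fx] := Fr 1 ltr01.
  have d2 : (fun t => x t - f t) \in l2_pred.
    by apply/l2_predP; exists ((1 + 1) ^+ 2) => J; apply: app.
  have -> : f = (x : T -> V) - (fun t => x t - f t).
    by apply/funext => t; rewrite !fctE subKr.
  by apply: rpredB => //; case: (x).
apply/cvg_ex; exists (MkL2 f2); apply/cvgrPdist_lt => e e0.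
have eE : e = real_complex R (complex.Re e) by rewrite RRe_real// gtr0_real.
move: e0; rewrite eE ltcR; set r := complex.Re e => r0.
have r4 : 0 < r / 4 by rewrite divr_gt0.
have [x Fx] := Fr _ r4; apply: filterS (Fx) => y.
rewrite rnorm_ball => xy; rewrite rnormE ltcR.
apply: le_lt_trans (rnorm_dist _ x _) _.
have : rnorm (MkL2 f2 - x) <= r / 4 + r / 4.
  rewrite rnormC rnorm_l2; apply: l2_norm_le => [|J]; first by lra.
  exact: app.
by lra.
Qed.

HB.instance Definition _ := Uniform_isComplete.Build l2 l2_complete.

(** Polarization defines the inner product from the norm; the partial sums of t |-> <x t, y t> then
    converge to it because those of the squared norms do. *)
Definition l2_re x y : R := (l2_sqnorm (x + y) - l2_sqnorm (x - y)) / 4.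

Lemma sqsum_cvg x : sqsum x @ totally --> l2_sqnorm x.
Proof.
apply/cvgrPdist_le => e e0.
have [_ [J _ <-] Je] := sup_adherent e0 (l2_has_sup x).
exists J => // K JK; rewrite ger0_norm ?subr_ge0 ?sqsum_le_sqnorm//.
have := sqsum_le x JK; move: Je; rewrite -/(l2_sqnorm x); lra.
Qed.

Arguments sqsum_cvg : clear implicits.

Definition partial_inner x y J : R[i] := \sum_(t <- J) inner (x t) (y t).

Lemma l2_re_cvg x y :
  (fun J => complex.Re (partial_inner x y J)) @ totally --> l2_re x y.
Proof.
rewrite (_ : (fun J => _) = fun J => (sqsum (x + y) J - sqsum (x - y) J) / 4).
  by apply: cvgMr_tmp; apply: cvgB; exact: sqsum_cvg.
apply/funext => J; rewrite /sqsum -sumrB mulr_suml raddf_sum.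
by apply: eq_bigr => t _; rewrite -[LHS]/(complex.Re _) rnorm_parallelogram.
Qed.

Arguments l2_re_cvg : clear implicits.

Definition l2_inner x y : R[i] := Complex (l2_re x y) (l2_re x ('i *: y)).

Lemma l2_im_cvg x y :
  (fun J => complex.Im (partial_inner x y J)) @ totally --> l2_re x ('i *: y).
Proof.
rewrite (_ : (fun J => _) = fun J => complex.Re (partial_inner x ('i *: y) J)).
  exact: l2_re_cvg.
apply/funext => J; rewrite !raddf_sum.
by apply: eq_bigr => t _; rewrite -[LHS]/(complex.Im _) Im_inner l2ZE.
Qed.
Arguments l2_im_cvg : clear implicits.

(** Sesquilinearity is checked on finite partial sums and passes to the limit along finite subsets
    by this uniqueness. *)
Lemma l2_inner_unique x y (c d : {fset T} -> R) (a b : R) :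
  (forall J, partial_inner x y J = Complex (c J) (d J)) ->
  c @ totally --> a -> d @ totally --> b -> l2_inner x y = Complex a b.
Proof.
move=> E ca db; have := l2_re_cvg x y; have := l2_im_cvg x y.
rewrite (_ : (fun J => _) = d); last by apply/funext => J; rewrite E.
rewrite (_ : (fun J => complex.Re _) = c); last by apply/funext => J; rewrite E.
move=> db' ca'; congr Complex.
  exact: (@cvg_unique _ (@Rhausdorff R) _ _ _ _ ca' ca).
exact: (@cvg_unique _ (@Rhausdorff R) _ _ _ _ db' db).
Qed.

Lemma l2_inner_ext x y (z w : l2) :
  (forall J, partial_inner x y J = partial_inner z w J) ->
  l2_inner x y = l2_inner z w.
Proof.
move=> E; apply: l2_inner_unique (l2_re_cvg z w) (l2_im_cvg z w) => J.
by rewrite E; case: partial_inner.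
Qed.

Fact l2_innerDl x y z : l2_inner (x + y) z = l2_inner x z + l2_inner y z.
Proof.
apply: l2_inner_unique (cvgD (l2_re_cvg x z) (l2_re_cvg y z))
  (cvgD (l2_im_cvg x z) (l2_im_cvg y z)) => J.
rewrite /partial_inner (eq_bigr (fun t => inner (x t) (z t) + inner (y t) (z t))).
  rewrite big_split !fctE /=.
  by case: (\sum_(_ <- _) _) => ? ?; case: (\sum_(_ <- _) _).
by move=> t _; rewrite l2DE innerDl.
Qed.

Fact l2_innerZl (k : R[i]) x y : l2_inner (k *: x) y = k * l2_inner x y.
Proof.
case: k => a b.
have := l2_re_cvg x y; have := l2_im_cvg x y => I1 R1.
rewrite [l2_inner x y in RHS]/l2_inner -[RHS]/(Complex _ _) /=.
pose r J := complex.Re (partial_inner x y J).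
pose i J := complex.Im (partial_inner x y J).
apply: (@l2_inner_unique _ _ (fun J => a * r J - b * i J)
  (fun J => a * i J + b * r J)) => [J||]; last 2 first.
- by apply: cvgB; exact: cvgMl_tmp.
- by apply: cvgD; exact: cvgMl_tmp.
rewrite /r /i.
rewrite /partial_inner (eq_bigr (fun t => Complex a b * inner (x t) (y t))).
  by rewrite -mulr_sumr; case: (\sum_(_ <- _) _) => ? ?; simpc.
by move=> t _; rewrite l2ZE innerZl.
Qed.

Fact l2_innerC x y : l2_inner y x = (l2_inner x y)^*.
Proof.
apply: (l2_inner_unique _ (l2_re_cvg x y) (cvgN (l2_im_cvg x y))) => J.
rewrite /partial_inner (eq_bigr (fun t => (inner (x t) (y t))^*)).
  by rewrite -rmorph_sum !fctE /=; case: (\sum_(_ <- _) _).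
by move=> t _; rewrite innerC.
Qed.

Fact l2_inner_norm x : l2_inner x x = `|x| ^+ 2.
Proof.
rewrite rnormE rnorm_l2 -rmorphXn /= sqr_l2_norm.
apply: (l2_inner_unique _ (sqsum_cvg x) (cvg_cst 0)) => J.
rewrite /partial_inner (eq_bigr (fun t => real_complex R (rnorm (x t) ^+ 2))).
  by rewrite -rmorph_sum.
by move=> t _; rewrite inner_rnorm.
Qed.

HB.instance Definition _ := isHilbert.Build R l2
  l2_innerDl l2_innerZl l2_innerC l2_inner_norm.

Lemma inner_l2_ext x y (z w : l2) :
  (forall t, inner (x t) (y t) = inner (z t) (w t)) ->
  inner x y = inner z w.
Proof. by move=> E; apply: l2_inner_ext => J; apply: eq_bigr => t _. Qed.

End SquareSummable.
Arguments l2 {R} T V.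

Lemma rnorm_near_continuous {R : realType} {X : topologicalType}
    {W : normedModType R[i]} (f : X -> W) (x : X) :
  (forall e : R, 0 < e -> \forall y \near x, rnorm (f x - f y) < e) ->
  {for x, continuous f}.
Proof.
move=> fx; apply/cvgrPdist_lt => e e0.
have eE : e = real_complex R (complex.Re e) by rewrite RRe_real// gtr0_real.
move: e0; rewrite eE ltcR => /fx; apply: filterS => y.
by rewrite rnormE ltcR.
Qed.

Lemma linear_morphB {K : pzRingType} {V W : lmodType K} (f : V -> W) :
  linear f -> {morph f : u v / u - v}.
Proof.
by move=> fl u v; rewrite [u - v]addrC -[- v]scaleN1r fl scaleN1r addrC.
Qed.

Lemma linear_morph0 {K : pzRingType} {V W : lmodType K} (f : V -> W) :
  linear f -> f 0 = 0.
Proof. by move=> /linear_morphB fB; rewrite -(subrr 0) fB subrr. Qed.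

Lemma linear_morphD {K : pzRingType} {V W : lmodType K} (f : V -> W) :
  linear f -> {morph f : u v / u + v}.
Proof. by move=> fl u v; have := fl 1 u v; rewrite !scale1r. Qed.

Lemma linear_morphZ {K : pzRingType} {V W : lmodType K} (f : V -> W) :
  linear f -> forall k, {morph f : u / k *: u}.
Proof.
by move=> fl k u; have := fl k u 0; rewrite (linear_morph0 fl) !addr0.
Qed.

Lemma rnorm_bounded_continuous {R : realType} {V W : normedModType R[i]}
    (f : V -> W) (M : R) : 0 <= M -> {morph f : u v / u - v} ->
  (forall v, rnorm (f v) <= M * rnorm v) -> continuous f.
Proof.
move=> M0 fB fM x; apply: rnorm_near_continuous => e e0.
have M1 : 0 < M + 1 by lra.
have : nbhs x (ball x (real_complex R (e / (M + 1)))).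
  by apply: nbhsx_ballx; rewrite ltcR divr_gt0.
apply: filterS => y; rewrite rnorm_ball ltr_pdivlMr// -fB => xy.
apply: le_lt_trans (fM _) _; have := rnorm_ge0 (x - y); nra.
Qed.

(** * Functions vanishing at infinity and induced representations *)

Section C0Theory.
Context {R : realType} {X : topologicalType}.
Local Notation C := R[i].
Implicit Types f g : X -> C.

Definition cnorm (z : C) : R := complex.Re `|z|.

Lemma cnormE (z : C) : `|z| = real_complex R (cnorm z).
Proof. exact: (@rnormE R C^o). Qed.

Lemma cnorm_ge0 (z : C) : 0 <= cnorm z.
Proof. exact: (@rnorm_ge0 R C^o). Qed.

Lemma cnormD (z w : C) : cnorm (z + w) <= cnorm z + cnorm w.
Proof. exact: (@rnormD R C^o). Qed.

Lemma cnorm_mul (z w : C) : cnorm (z * w) = cnorm z * cnorm w.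
Proof. by apply: complexI; rewrite rmorphM -!cnormE normrM. Qed.

Lemma cnormJ (z : C) : cnorm z^* = cnorm z.
Proof. by rewrite /cnorm norm_conjC. Qed.

Lemma C0_near f : C0 R X f -> forall x (e : R), 0 < e ->
  \forall y \near x, cnorm (f x - f y) < e.
Proof.
move=> [fc _] x e e0; have := fc x; move/cvgrPdist_lt => /(_ (real_complex R e)).
rewrite ltcR => /(_ e0); apply: filterS => y.
by rewrite cnormE ltcR.
Qed.

Lemma C0_vanish f : C0 R X f -> forall e : R, 0 < e ->
  exists2 K : set X, compact K & forall x, ~ K x -> cnorm (f x) < e.
Proof.
move=> [_ fv] e e0; have [|K Kc Kf] := fv (real_complex R e); first by rewrite ltcR.
by exists K => // x /Kf; rewrite cnormE ltcR.
Qed.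

Lemma C0P f : (forall x (e : R), 0 < e -> \forall y \near x, cnorm (f x - f y) < e) ->
  (forall e : R, 0 < e ->
    exists2 K : set X, compact K & forall x, ~ K x -> cnorm (f x) < e) ->
  C0 R X f.
Proof.
move=> fc fv; split=> [x|e e0].
  by apply: (@rnorm_near_continuous _ _ C^o) => e e0; exact: fc.
have eE : e = real_complex R (complex.Re e) by rewrite RRe_real// gtr0_real.
move: e0; rewrite eE ltcR => /fv[K Kc Kf]; exists K => // x /Kf.
by rewrite cnormE ltcR.
Qed.

Lemma C0_bounded f : C0 R X f -> exists2 M : R, 0 <= M & forall x, cnorm (f x) <= M.
Proof.
move=> f0; have [K Kc Kf] := C0_vanish f0 ltr01.
have [M0 [_ fM]] : bounded_set ((cnorm \o f : X -> R) @` K).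
  apply: compact_bounded; apply: continuous_compact => //.
  apply: continuous_subspaceT => x; apply/cvgrPdist_lt => e e0.
  have := C0_near f0 x e0; apply: filterS => y; apply: le_lt_trans.
  have := cnormD (f y - f x) (f x); have := cnormD (f x - f y) (f y).
  rewrite !subrK /= ler_norml (_ : cnorm (f y - f x) = cnorm (f x - f y)).
    by move=> ? ?; apply/andP; split; lra.
  exact: (@rnormC R C^o).
exists (Num.max 1 (M0 + 1)) => [|x]; first by rewrite le_max ler01.
have [Kx|nKx] := pselect (K x); last by rewrite le_max ltW// Kf.
rewrite le_max; apply/orP; right.
have := fM (M0 + 1); rewrite ltrDl ltr01 => /(_ isT _ (ex_intro2 _ _ x Kx erefl)).
by apply: le_trans; rewrite ler_norm.
Qed.

Lemma C0_conj f : C0 R X f -> C0 R X (conj_fun f).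
Proof.
move=> f0; apply: C0P => [x e e0|e e0].
  by apply: filterS (C0_near f0 x e0) => y; rewrite /conj_fun -rmorphB cnormJ.
by have [K Kc Kf] := C0_vanish f0 e0; exists K => // x /Kf; rewrite cnormJ.
Qed.

Lemma C0D f g : C0 R X f -> C0 R X g -> C0 R X (f \+ g).
Proof.
move=> f0 g0; apply: C0P => [x e e0|e e0]; have e2 : 0 < e / 2 by rewrite divr_gt0.
  apply: filterS2 (C0_near f0 x e2) (C0_near g0 x e2) => y fx gx /=.
  rewrite opprD addrACA; apply: le_lt_trans (cnormD _ _) _; lra.
have [K Kc Kf] := C0_vanish f0 e2; have [L Lc Lg] := C0_vanish g0 e2.
exists (K `|` L); first exact: compactU.
move=> x /not_orP[/Kf fx /Lg gx]; apply: le_lt_trans (cnormD _ _) _; lra.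
Qed.

Lemma C0Z (k : C) f : C0 R X f -> C0 R X (k \*o f).
Proof.
move=> f0; have k1 : 0 < cnorm k + 1 by have := cnorm_ge0 k; lra.
have ke (e z : R) : 0 <= z -> z < e / (cnorm k + 1) -> cnorm k * z < e.
  by move=> z0; rewrite ltr_pdivlMr//; nra.
apply: C0P => [x e e0|e e0]; have e2 : 0 < e / (cnorm k + 1) by rewrite divr_gt0.
  apply: filterS (C0_near f0 x e2) => y /= fx.
  by rewrite -mulrBr cnorm_mul ke// cnorm_ge0.
have [K Kc Kf] := C0_vanish f0 e2; exists K => // x /Kf fx /=.
by rewrite cnorm_mul ke// cnorm_ge0.
Qed.

Lemma C0M f g : C0 R X f -> C0 R X g -> C0 R X (f \* g).
Proof.
move=> f0 g0; have [M M0 fM] := C0_bounded f0; have [L L0 gL] := C0_bounded g0.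
have Q0 : 0 < M + L + 1 by lra.
apply: C0P => [x e e0|e e0]; have e2 : 0 < e / (M + L + 1) by rewrite divr_gt0.
  apply: filterS2 (C0_near f0 x e2) (C0_near g0 x e2) => y /=.
  rewrite !ltr_pdivlMr// => fx gx.
  have -> : f x * g x - f y * g y = (f x - f y) * g x + f y * (g x - g y) by ring.
  apply: le_lt_trans (cnormD _ _) _; rewrite !cnorm_mul.
  have := gL x; have := fM y; have := cnorm_ge0 (f x - f y).
  have := cnorm_ge0 (g x - g y); have := cnorm_ge0 (g x); have := cnorm_ge0 (f y); nra.
have [K Kc Kf] := C0_vanish f0 e2.
exists K => // x /Kf /=; rewrite cnorm_mul ltr_pdivlMr// => fx.
have := gL x; have := cnorm_ge0 (f x); have := cnorm_ge0 (g x); nra.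
Qed.

Lemma C0_cst0 : C0 R X (cst 0).
Proof.
apply: C0P => [x e e0|e e0]; first by apply: filterE => y; rewrite subrr /cnorm normr0.
by exists set0; [exact: compact0|move=> x _; rewrite /cnorm normr0].
Qed.

End C0Theory.

(** * Covariant representations on square-summable families *)

Section InducedRepresentation.
Context {R : realType} {X : topologicalType} {G : groupType} {T : choiceType}.
Context {V : hilbertType R}.
Local Notation C := R[i].
Variables (alpha : G -> (X -> C) -> X -> C) (act : G -> T -> T).
Variables (pi : T -> (X -> C) -> V -> V) (U : G -> V -> V).

Hypothesis act1 : forall t, act 1%g t = t.
Hypothesis actM : forall g h t, act (g * h)%g t = act g (act h t).
Hypothesis C0alpha : forall g f, C0 R X f -> C0 R X (alpha g f).
Hypothesis pi_bounded : forall f, C0 R X f ->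
  exists2 M : R, 0 <= M & forall t v, rnorm (pi t f v) <= M * rnorm v.
Hypothesis pi_linear : forall t f, C0 R X f -> linear (pi t f).
Hypothesis piD : forall t f f' v, C0 R X f -> C0 R X f' ->
  pi t (f \+ f') v = pi t f v + pi t f' v.
Hypothesis piZ : forall t (k : C) f v, C0 R X f -> pi t (k \*o f) v = k *: pi t f v.
Hypothesis piM : forall t f f' v, C0 R X f -> C0 R X f' ->
  pi t (f \* f') v = pi t f (pi t f' v).
Hypothesis pi_star : forall t f u v, C0 R X f ->
  inner (pi t f u) v = inner u (pi t (conj_fun f) v).
Hypothesis U_linear : forall g, linear (U g).
Hypothesis U_inner : forall g u v, inner (U g u) (U g v) = inner u v.
Hypothesis U1 : forall v, U 1%g v = v.
Hypothesis UM : forall g h v, U (g * h)%g v = U g (U h v).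
Hypothesis cov : forall g f t v, C0 R X f ->
  pi t (alpha g f) (U g v) = U g (pi (act g^-1%g t) f v).

Let rnormU g v : rnorm (U g v) = rnorm v.
Proof.
have := U_inner g v v; rewrite !inner_rnorm => /complexI/eqP.
by rewrite eqrXn2 ?rnorm_ge0// => /eqP.
Qed.

Definition l2_pi_fun (f : X -> C) (x : l2 T V) : T -> V := fun t => pi t f (x t).

(** [insubd] returns 0 when the family is not square-summable; for f in C_0 the uniform bound on the
    [pi t f] excludes this. *)
Definition l2_pi (f : X -> C) (x : l2 T V) : l2 T V := insubd 0 (l2_pi_fun f x).

Lemma l2_piE f x t : C0 R X f -> l2_pi f x t = pi t f (x t).
Proof.
move=> /pi_bounded[M M0 fM].
rewrite /l2_pi -[l2_fun _]/(val _) insubdK//; apply/l2_predP.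
exists (M ^+ 2 * l2_sqnorm x) => J.
apply: (@le_trans _ _ (M ^+ 2 * sqsum x J)); last first.
  by rewrite ler_wpM2l ?sqr_ge0// sqsum_le_sqnorm.
rewrite /sqsum mulr_sumr; apply: ler_sum => s _.
rewrite -exprMn ler_sqr ?nnegrE ?rnorm_ge0 ?mulr_ge0 ?rnorm_ge0//.
exact: fM.
Qed.

Definition l2_U_fun g (x : l2 T V) : T -> V := fun t => U g (x (act g^-1%g t)).

Definition l2_U g (x : l2 T V) : l2 T V := insubd 0 (l2_U_fun g x).

Let actK g t : act g^-1%g (act g t) = t.
Proof. by rewrite -actM mulVg act1. Qed.

Let actVK g t : act g (act g^-1%g t) = t.
Proof. by rewrite -actM mulgV act1. Qed.

Lemma sqsum_l2_U_fun g x J :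
  sqsum (l2_U_fun g x) J = sqsum x [fset act g^-1%g t | t in J]%fset.
Proof.
rewrite /sqsum big_imfset /=; last first.
  by move=> s t _ _ /(congr1 (act g)); rewrite !actVK.
by apply: eq_bigr => t _; rewrite rnormU.
Qed.

Lemma l2_UE g x t : l2_U g x t = U g (x (act g^-1%g t)).
Proof.
rewrite /l2_U -[l2_fun _]/(val _) insubdK//; apply/l2_predP.
by exists (l2_sqnorm x) => J; rewrite sqsum_l2_U_fun sqsum_le_sqnorm.
Qed.

Lemma l2_sqnormU g x : l2_sqnorm (l2_U g x) = l2_sqnorm x.
Proof.
have Ufun : (l2_U g x : T -> V) = l2_U_fun g x by apply/funext => t; rewrite l2_UE.
apply/le_anti/andP; split; apply: l2_sqnorm_le => J.
  by rewrite Ufun sqsum_l2_U_fun sqsum_le_sqnorm.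
have -> : J = [fset act g^-1%g t | t in [fset act g t | t in J]]%fset.
  rewrite -imfset_comp /=; apply/fsetP => t.
  apply/idP/imfsetP => [tJ|[s /= sJ ->]]; last by rewrite actK.
  by exists t => //=; rewrite actK.
by rewrite -sqsum_l2_U_fun -Ufun sqsum_le_sqnorm.
Qed.

(** A function acts on the fibre over t through [pi t], and g carries the fibre over g^-1 t to the
    one over t; [cov] is what covariance requires between these fibres. The cases of interest are G
    acting on itself by left translation and G acting on N. *)
Lemma l2_covariant_rep : covariant_rep alpha l2_pi l2_U.
Proof.
have UL g : linear (l2_U g).
  by move=> k x y; apply: l2_ext => t; rewrite !(l2_UE, l2DE, l2ZE) U_linear.
split => //.
- move=> f f0 k x y; apply: l2_ext => t.
  by rewrite !(l2_piE, l2DE, l2ZE)// pi_linear.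
- move=> f f0; have [M M0 fM] := pi_bounded f0.
  apply: (rnorm_bounded_continuous M0) => [x y|x].
    apply: l2_ext => t; rewrite !(l2DE, l2NE, l2_piE)//.
    exact: linear_morphB (pi_linear t f0) _ _.
  rewrite !rnorm_l2; apply: l2_norm_le => [|J].
    by rewrite mulr_ge0// l2_norm_ge0.
  rewrite exprMn sqr_l2_norm.
  apply: le_trans (ler_wpM2l (sqr_ge0 M) (sqsum_le_sqnorm x J)).
  rewrite /sqsum mulr_sumr; apply: ler_sum => t _.
  by rewrite l2_piE// -exprMn ler_sqr ?nnegrE ?mulr_ge0 ?rnorm_ge0.
- move=> f f' x f0 f'0; apply: l2_ext => t.
  have ff0 := C0D f0 f'0.
  by rewrite !(l2_piE, l2DE)// piD.
- move=> k f x f0; apply: l2_ext => t.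
  have kf0 := C0Z k f0.
  by rewrite !(l2_piE, l2ZE)// piZ.
- move=> f f' x f0 f'0; apply: l2_ext => t.
  have ff0 := C0M f0 f'0.
  by rewrite !l2_piE// piM.
- move=> f x y f0; apply: inner_l2_ext => t.
  have cf0 := C0_conj f0.
  by rewrite !l2_piE// pi_star.
- have nU g x : rnorm (l2_U g x) = rnorm x.
    by rewrite !rnorm_l2 /l2_norm l2_sqnormU.
  have UB g x y : l2_U g (x - y) = l2_U g x - l2_U g y.
    exact: linear_morphB.
  have UD g x y : l2_U g (x + y) = l2_U g x + l2_U g y.
    exact: linear_morphD.
  have UZ g k x : l2_U g (k *: x) = k *: l2_U g x.
    exact: linear_morphZ.
  (* Inner products are preserved because norms are, by polarization. *)
  have Re g x y : complex.Re (inner (l2_U g x) (l2_U g y)) = complex.Re (inner x y).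
    by rewrite !rnorm_parallelogram -UD -UB !nU.
  move=> g x y; apply/eqP; rewrite eq_complex Re eqxx andTb !Im_inner.
  by rewrite -UZ Re.
- by move=> x; apply: l2_ext => t; rewrite l2_UE invg1 act1 U1.
- by move=> g h x; apply: l2_ext => t; rewrite !l2_UE UM invgM actM.
- move=> g f x f0; apply: l2_ext => t.
  by rewrite !(l2_piE, l2_UE) ?cov//; exact: C0alpha.
Qed.

End InducedRepresentation.

(** * Crossed products *)

(** Expand the sum of (a_i - S/n)^2 >= 0, where S is the sum and n the number of terms. *)
Lemma sqr_sum_le {R : realType} (I : eqType) (r : seq I) (a : I -> R) :
  (\sum_(i <- r) a i) ^+ 2 <= (size r)%:R * \sum_(i <- r) a i ^+ 2.
Proof.
have [->|r0] := eqVneq r [::]; first by rewrite !big_nil expr0n mulr0.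
have n0 : 0 < (size r)%:R :> R by rewrite ltr0n lt0n size_eq0.
set S := \sum_(i <- r) a i; set Q := \sum_(i <- r) _; set n := (size r)%:R in n0 *.
have : 0 <= \sum_(i <- r) (a i - S / n) ^+ 2 by apply: sumr_ge0 => i _; rewrite sqr_ge0.
rewrite (eq_bigr (fun i => a i ^+ 2 + ((- 2 * (S / n)) * a i + (S / n) ^+ 2))).
  rewrite !big_split /= -mulr_sumr big_const_seq count_predT iter_addr_0.
  rewrite -/S -/Q -[_ *+ size r]mulr_natl -/n => H.
  have : 0 <= n * (Q + (-2 * (S / n) * S + n * (S / n) ^+ 2)) by rewrite mulr_ge0// ltW.
  have -> : n * (Q + (-2 * (S / n) * S + n * (S / n) ^+ 2)) = n * Q - S ^+ 2.
    by field; rewrite gt_eqF.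
  by rewrite subr_ge0.
by move=> i _; ring.
Qed.

(** * Monomials and Fourier multipliers in a crossed product *)

Section GroupAction.
Context {R : realType} {X : topologicalType} {G : groupType}.
Local Notation C := R[i].
Variable sg : G -> X -> X.
Hypothesis sg1 : forall x, sg 1%g x = x.
Hypothesis sgM : forall g h x, sg (g * h)%g x = sg h (sg g x).
Hypothesis sg_continuous : forall g, continuous (sg g).

(** [sg] is a right action, to be read as x |-> g^-1 x, so that [pull] is a left action on
    functions. *)
Definition pull (g : G) (f : X -> C) : X -> C := fun x => f (sg g x).

Lemma sgK g : cancel (sg g) (sg g^-1%g).
Proof. by move=> x; rewrite -sgM mulgV sg1. Qed.

Lemma C0_pull g f : C0 R X f -> C0 R X (pull g f).
Proof.
move=> f0; apply: C0P => [x e e0|e e0].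
  have := C0_near f0 (sg g x) e0; move/(@sg_continuous g x).
  by rewrite /nbhs /=; apply: filterS.
have [K Kc Kf] := C0_vanish f0 e0; exists (sg g^-1%g @` K).
  by apply: continuous_compact => //; apply: continuous_subspaceT.
move=> x nKx; apply: Kf => Kx; apply: nKx; exists (sg g x) => //.
exact: sgK.
Qed.

Section Representation.
Variables (V : hilbertType R) (pi : (X -> C) -> V -> V) (U : G -> V -> V).
Hypothesis rep : covariant_rep pull pi U.

Lemma rep_cst0 v : pi (cst 0) v = 0.
Proof.
have -> : cst 0 = (0 : C) \*o cst 0 :> (X -> C) by apply/funext => x /=; rewrite mul0r.
by rewrite (repZ rep)// ?scale0r//; exact: C0_cst0.
Qed.

Lemma rnorm_U g v : rnorm (U g v) = rnorm v.
Proof.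
have := unitary_inner rep g v v; rewrite !inner_rnorm => /complexI/eqP.
by rewrite eqrXn2 ?rnorm_ge0// => /eqP.
Qed.

(* With h = |f|^2/M^2 <= 1 and k = 1 - sqrt(1 - h), one has
   |v|^2 - <pi(h)v, v> = |v - pi(k)v|^2 >= 0; k vanishes at infinity although
   sqrt(1 - h) does not. *)
Lemma rep_contractive f (M : R) v : C0 R X f -> 0 <= M ->
  (forall x, cnorm (f x) <= M) -> rnorm (pi f v) <= M * rnorm v.
Proof.
move=> f0; rewrite le_eqVlt => /predU1P[<- fM|M0 fM].
  have -> : f = cst 0.
    by apply/funext => x; apply: (@rnorm0_eq0 R C^o); exact: fM.
  by rewrite rep_cst0 rnorm0 mul0r.
pose h : X -> C := (real_complex R (M ^- 2)) \*o (conj_fun f \* f).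
have h0 : C0 R X h by apply: C0Z; apply: C0M => //; exact: C0_conj.
pose r x : R := cnorm (f x) ^+ 2 / M ^+ 2.
have hE x : h x = real_complex R (r x).
  rewrite /h /= /conj_fun mulrC [_^* * _]mulrC -normCK cnormE /r.
  by rewrite rmorphM -rmorphXn /=.
have r0 x : 0 <= r x by rewrite /r divr_ge0// sqr_ge0.
have r1 x : r x <= 1.
  rewrite /r ler_pdivrMr ?exprn_gt0// mul1r ler_sqr ?nnegrE ?fM//.
  - exact: cnorm_ge0.
  - exact: ltW.
pose k x : C := real_complex R (1 - Num.sqrt (1 - r x)).
have cr (a : R) : cnorm (real_complex R a) = `|a|.
  by rewrite /cnorm normc_def /= expr0n addr0 sqrtr_sqr.
have k0 : C0 R X k.
  apply: C0P => [x e e0|e e0].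
    (* For a, b >= 0 one has |sqrt a - sqrt b|^2 <= |a - b|; hence the tolerance e^2 for h. *)
    have e2 : 0 < e ^+ 2 by rewrite exprn_gt0.
    apply: filterS (C0_near h0 x e2) => y.
    rewrite !hE /k -!rmorphB !cr /= opprD addrACA subrr add0r opprK.
    have := @sqr_sqrtr _ (1 - r x); have := @sqr_sqrtr _ (1 - r y).
    rewrite !subr_ge0 => /(_ (r1 y)) + /(_ (r1 x)).
    have := sqrtr_ge0 (1 - r x); have := sqrtr_ge0 (1 - r y).
    move: (Num.sqrt _) (Num.sqrt _) => a b a0 b0 aE bE.
    rewrite ltr_norml => /andP[l1 l2]; rewrite ltr_norml; apply/andP; split; nra.
  (* 1 - sqrt(1 - r) <= r for 0 <= r <= 1, so k is small wherever h is. *)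
  have [K Kc Kh] := C0_vanish h0 e0; exists K => // x /Kh.
  rewrite hE /k !cr ger0_norm// => re.
  have := @sqr_sqrtr _ (1 - r x); rewrite subr_ge0 => /(_ (r1 x)).
  have := sqrtr_ge0 (1 - r x); have := r0 x.
  move: (Num.sqrt _) => a rx a0 aE.
  by rewrite ltr_norml; apply/andP; split; nra.
have kc : conj_fun k = k by apply/funext => x; rewrite /conj_fun /k [_^*]conjc_real.
have hk : h \+ (k \* k) = k \+ k.
  apply/funext => x; rewrite /= hE /k -!rmorphM -!rmorphD /=.
  have := @sqr_sqrtr _ (1 - r x); rewrite subr_ge0 => /(_ (r1 x)).
  move: (Num.sqrt _) => a aE; congr (real_complex R _); lra.
have pk : inner (pi k v) (pi k v) = inner v (pi (k \* k) v).
  by rewrite (repM rep)// (rep_star rep)// kc.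
have ph : inner v (pi h v) = real_complex R (rnorm (pi f v) ^+ 2 / M ^+ 2).
  have cf0 := C0_conj f0.
  rewrite /h (repZ rep)//; last exact: C0M.
  rewrite (repM rep)// innerZr [_^*]conjc_real.
  have -> : inner v (pi (conj_fun f) (pi f v)) = inner (pi f v) (pi f v).
    by rewrite (rep_star rep).
  by rewrite inner_rnorm -rmorphM mulrC.
have kk0 : C0 R X (k \* k) by exact: C0M.
have := sqr_ge0 (rnorm (v - pi k v)).
rewrite rnormD_sqr rnormN innerNr raddfN /=.
have /(congr1 (@complex.Re R)) := pk; rewrite inner_rnorm /= => ->.
have /(congr1 (fun g => complex.Re (inner v (pi g v)))) := hk.
rewrite !(repD rep)// !innerDr ph !raddfD /= => E ge0.
have : rnorm (pi f v) ^+ 2 / M ^+ 2 <= rnorm v ^+ 2 by lra.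
rewrite ler_pdivrMr ?exprn_gt0// -exprMn.
rewrite ler_sqr ?nnegrE ?mulr_ge0 ?rnorm_ge0 ?(ltW M0)//.
by rewrite mulrC.
Qed.

Lemma integratedE (F : G -> X -> C) (s : {fset G}) v :
  (forall g, g \notin s -> F g = cst 0) ->
  integrated pi U F v = \sum_(g <- s) pi (F g) (U g v).
Proof. by move=> Fs; apply: fsbigTE => g /Fs ->; exact: rep_cst0. Qed.

End Representation.

Definition single (f : X -> C) (g : G) : G -> X -> C :=
  fun h => if h == g then f else cst 0.

Lemma Cc_fset F : Cc R X G F ->
  exists s : {fset G}, forall g, g \notin s -> F g = cst 0.
Proof.
move=> [Ff _]; exists (fset_set [set g | F g <> cst 0]) => g.
by rewrite in_fset_set// notin_setE /= => /contrapT.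
Qed.

Lemma fset_Cc F (s : {fset G}) : (forall g, g \notin s -> F g = cst 0) ->
  (forall g, C0 R X (F g)) -> Cc R X G F.
Proof.
move=> Fs F0; split => //; apply: (sub_finite_set (B := [set` s])).
  by move=> g /= Fg; apply: contra_notT Fg => /Fs.
exact: finite_fset.
Qed.

Lemma Cc_single f g : C0 R X f -> Cc R X G (single f g).
Proof.
move=> f0; apply: (@fset_Cc _ [fset g]%fset) => h; rewrite /single.
  by rewrite inE => /negPf ->.
by case: ifP => _ //; exact: C0_cst0.
Qed.

Section Algebra.
Variables (A : cstarAlgType R) (j : (G -> X -> C) -> A).
Hypothesis cp : crossed_product pull j.

(** The product f u_g of a function and the canonical unitary of g; u_g itself need not belong to
    the algebra. *)
Definition mono (f : X -> C) (g : G) : A := j (single f g).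

Lemma monoD f f' g : C0 R X f -> C0 R X f' ->
  mono (f \+ f') g = mono f g + mono f' g.
Proof.
move=> f0 f'0; rewrite /mono -(cpD cp); [|exact: Cc_single..].
congr j; apply/funext => h; rewrite /single; case: ifP => _ //.
by apply/funext => x /=; rewrite addr0.
Qed.

Lemma monoZ (k : C) f g : C0 R X f -> mono (k \*o f) g = k *: mono f g.
Proof.
move=> f0; rewrite /mono -(cpZ cp); last exact: Cc_single.
congr j; apply/funext => h; rewrite /single; case: ifP => _ //.
by apply/funext => x /=; rewrite mulr0.
Qed.

Lemma mono0 g : mono (cst 0) g = 0.
Proof.
have -> : cst 0 = (0 : C) \*o cst 0 :> (X -> C) by apply/funext => x /=; rewrite mul0r.
by rewrite monoZ ?scale0r//; exact: C0_cst0.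
Qed.

Lemma mono_sum I (r : seq I) (F : I -> X -> C) g : (forall i, C0 R X (F i)) ->
  C0 R X (fun x => \sum_(i <- r) F i x) /\
  mono (fun x => \sum_(i <- r) F i x) g = \sum_(i <- r) mono (F i) g.
Proof.
move=> F0; elim: r => [|i r [IH0 IH]].
  rewrite (_ : (fun x => _) = cst 0); last by apply/funext => x; rewrite big_nil.
  by rewrite big_nil mono0; split => //; exact: C0_cst0.
rewrite (_ : (fun x => _) = F i \+ (fun x => \sum_(i <- r) F i x)); last first.
  by apply/funext => x; rewrite big_cons.
by rewrite monoD// big_cons IH; split => //; exact: C0D.
Qed.

Lemma monoM f g f' g' : C0 R X f -> C0 R X f' ->
  mono f g ** mono f' g' = mono (f \* pull g f') (g * g')%g.
Proof.
move=> f0 f'0; rewrite /mono -(cpM cp); [|exact: Cc_single..].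
congr j; apply/funext => k; apply/funext => x; rewrite /convolution.
rewrite (fsbigTE [fset g]%fset) => [|h]; last first.
  by rewrite inE /single => /negPf -> /=; rewrite mul0r.
rewrite big_seq_fset1 /single eqxx.
have -> : ((g^-1 * k)%g == g') = (k == (g * g')%g).
  by apply/eqP/eqP => [<-|->]; rewrite mulgA (mulgV, mulVg) mul1g.
by case: ifP => _ //=; rewrite /pull /= mulr0.
Qed.

Lemma mono_star f g : C0 R X f ->
  (mono f g)^#* = mono (pull g^-1%g (conj_fun f)) g^-1%g.
Proof.
move=> f0; rewrite /mono -(cp_star cp); last exact: Cc_single.
congr j; apply/funext => k; rewrite /involution /single.
have -> : (k == g^-1%g) = (k^-1%g == g).
  by apply/eqP/eqP => [->|<-]; rewrite invgK.
case: eqP => [<-|_]; first by rewrite invgK.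
by apply/funext => x; rewrite /pull /conj_fun /= rmorph0.
Qed.

Lemma rnorm_j_le F (M : R) : Cc R X G F -> 0 <= M ->
  (forall (V : hilbertType R) (pi : (X -> C) -> V -> V) (U : G -> V -> V),
    covariant_rep pull pi U -> forall v, rnorm (integrated pi U F v) <= M * rnorm v) ->
  rnorm (j F) <= M.
Proof.
move=> Fc M0 FM; rewrite -lecR -rnormE; apply: (cp_norm cp Fc).2.
by split=> [|V pi U rep v]; rewrite ?ler0c// !rnormE -rmorphM lecR FM.
Qed.

Lemma integrated_le F (V : hilbertType R) (pi : (X -> C) -> V -> V)
    (U : G -> V -> V) v : Cc R X G F -> covariant_rep pull pi U ->
  rnorm (integrated pi U F v) <= rnorm (j F) * rnorm v.
Proof.
move=> Fc rep; have [[_ FM] _] := cp_norm cp Fc.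
by have := FM V pi U rep v; rewrite !rnormE -rmorphM lecR.
Qed.

Lemma rnorm_mono f g (M : R) : C0 R X f -> 0 <= M ->
  (forall x, cnorm (f x) <= M) -> rnorm (mono f g) <= M.
Proof.
move=> f0 M0 fM; apply: rnorm_j_le => //; first exact: Cc_single.
move=> V pi U rep v; rewrite (integratedE rep (s := [fset g]%fset)) => [|h].
  rewrite big_seq_fset1 /single eqxx -(rnorm_U rep g v).
  exact: (rep_contractive rep).
by rewrite inE /single => /negPf ->.
Qed.

Lemma jE F (s : {fset G}) : Cc R X G F -> (forall g, g \notin s -> F g = cst 0) ->
  j F = \sum_(g <- s) mono (F g) g.
Proof.
move=> Fc; have F0 := Fc.2.
have H (r : seq G) (K : G -> X -> C) : uniq r -> (forall g, C0 R X (K g)) ->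
    (forall g, g \notin r -> K g = cst 0) -> j K = \sum_(g <- r) mono (K g) g.
  elim: r K => [|g r IH] K.
    move=> _ _ K0; rewrite big_nil -(mono0 1%g); congr j; apply/funext => g.
    by rewrite K0// /single; case: ifP.
  move=> /= /andP[gr ur] K0 Kr; rewrite big_cons.
  pose K' h := if h == g then cst 0 else K h.
  have K'0 h : C0 R X (K' h) by rewrite /K'; case: ifP => // _; exact: C0_cst0.
  have K'r h : h \notin r -> K' h = cst 0.
    by rewrite /K'; case: eqP => // /eqP hg hr; rewrite Kr// inE negb_or hg.
  have -> : \sum_(g0 <- r) mono (K g0) g0 = \sum_(g0 <- r) mono (K' g0) g0.
    rewrite big_seq [RHS]big_seq; apply: eq_bigr => h hr.
    by rewrite /K'; case: eqP => // hg; rewrite -hg hr in gr.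
  rewrite -IH// -(cpD cp); last 2 first.
  - exact: Cc_single.
  - by apply: (@fset_Cc _ [fset x in r]%fset) => // h; rewrite inE; exact: K'r.
  congr j; apply/funext => h; rewrite /single /K'; apply/funext => x /=.
  by case: eqP => [->|_]; rewrite ?addr0 ?add0r.
by move=> Fs; apply: H => //; exact: fset_uniq.
Qed.

(** The proportion of K that lies in gK: the coefficient <lambda_g xi, xi> of the left regular
    representation at the unit vector xi = |K|^(-1/2) 1_K. *)
Definition multiplier (K : {fset G}) (g : G) : R :=
  (count (fun k => (g^-1 * k)%g \in K) K)%:R / #|` K|%:R.

Definition multiply (K : {fset G}) (F : G -> X -> C) : G -> X -> C :=
  fun g => real_complex R (multiplier K g) \*o F g.

(* Compression of the representation on l2(G, V) to the vectors 1_K (x) v. *)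
Lemma rnorm_multiply (K : {fset G}) F : K != fset0 -> Cc R X G F ->
  rnorm (j (multiply K F)) <= rnorm (j F).
Proof.
move=> K0 Fc; have [s Fs] := Cc_fset Fc.
have n0 : 0 < #|` K|%:R :> R by rewrite ltr0n cardfs_gt0.
have mFs g : g \notin s -> multiply K F g = cst 0.
  by move=> /Fs; rewrite /multiply => ->; apply/funext => x /=; rewrite mulr0.
have mF0 g : C0 R X (multiply K F g) by apply: C0Z; exact: Fc.2.
apply: rnorm_j_le; [exact: fset_Cc mFs mF0|exact: rnorm_ge0|].
move=> V pi U rep v.
pose act (g h : G) := (g * h)%g.
have act1 t : act 1%g t = t by rewrite /act mul1g.
have actM g h t : act (g * h)%g t = act g (act h t) by rewrite /act mulgA.
have rep2 : covariant_rep pull (l2_pi (fun _ : G => pi)) (l2_U act U).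
  apply: l2_covariant_rep => //.
  - exact: C0_pull.
  - move=> f f0; have [M M0 fM] := C0_bounded f0; exists M => // _ w.
    exact: (rep_contractive rep).
  - by move=> _; exact: (rep_linear rep).
  - by move=> _; exact: (repD rep).
  - by move=> _; exact: (repZ rep).
  - by move=> _; exact: (repM rep).
  - by move=> _; exact: (rep_star rep).
  - exact: (unitary_linear rep).
  - exact: (unitary_inner rep).
  - exact: (unitary1 rep).
  - exact: (unitaryM rep).
  - by move=> g f _ w f0; exact: (Defs.covariance rep).
pose x0 : G -> V := fun g => if g \in K then v else 0.
have sq_x0 J : sqsum x0 J <= #|` K|%:R * rnorm v ^+ 2 by exact: sqsum_indicator.
have x02 : x0 \in l2_pred by apply/l2_predP; exists (#|` K|%:R * rnorm v ^+ 2).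
pose x : l2 G V := MkL2 x02.
pose y := integrated (l2_pi (fun _ : G => pi)) (l2_U act U) F x.
have yx : rnorm y <= rnorm (j F) * rnorm x by exact: integrated_le.
(* The k-th coordinate only receives the g with g^-1 k in K, so that summing over K produces |K|
   times the multiplier. *)
have sumE : \sum_(k <- K) y k = real_complex R #|` K|%:R *: integrated pi U (multiply K F) v.
  rewrite (integratedE rep _ mFs) scaler_sumr.
  rewrite (eq_bigr (fun k => \sum_(g <- s)
    (if (g^-1 * k)%g \in K then pi (F g) (U g v) else 0))).
    rewrite exchange_big /=; apply: eq_bigr => g _.
    rewrite -big_mkcond /= /multiply (repZ rep); last exact: Fc.2.
    rewrite scalerA -rmorphM /multiplier mulrC divfK ?gt_eqF//.
    rewrite big_const_seq iter_addr_0 rmorph_nat scaler_nat; congr (_ *+ _).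
  move=> k kK; rewrite /y (integratedE rep2 _ Fs) l2_sumE.
  apply: eq_bigr => g _; rewrite l2_piE; first last.
  - exact: Fc.2.
  - move=> f f0; have [M M0 fM] := C0_bounded f0; exists M => // _ w.
    exact: (rep_contractive rep).
  rewrite l2_UE //; last exact: (unitary_inner rep).
  rewrite /x /= /x0 /act; case: ifP => // _.
  by rewrite (linear_morph0 (unitary_linear rep g)) (linear_morph0 (rep_linear rep (Fc.2 g))).
set w := integrated _ _ _ _ in sumE *; set M := rnorm (j F) in yx *.
have x2 : rnorm x ^+ 2 <= #|` K|%:R * rnorm v ^+ 2.
  by rewrite rnorm_l2 sqr_l2_norm; exact: l2_sqnorm_le.
have M0 : 0 <= M := rnorm_ge0 _.
have y2 : sqsum y K <= M ^+ 2 * rnorm x ^+ 2.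
  apply: le_trans (sqsum_le_sqnorm y K) _.
  by rewrite -sqr_l2_norm -rnorm_l2 -exprMn ler_sqr ?nnegrE ?mulr_ge0 ?rnorm_ge0.
(* Cauchy-Schwarz over K costs one factor |K| and the norm of x another; both cancel against the
   |K|^2 in front of w. *)
have wy : (#|` K|%:R * rnorm w) ^+ 2 <= #|` K|%:R * sqsum y K.
  apply: le_trans (sqr_sum_le _ _).
  rewrite -(rnormZr _ (ltW n0)) -sumE lerXn2r ?nnegrE ?rnorm_ge0//.
    by apply: sumr_ge0 => k _; exact: rnorm_ge0.
  exact: rnorm_sum.
rewrite -ler_sqr ?nnegrE ?mulr_ge0 ?rnorm_ge0//.
rewrite -(ler_pM2l (exprn_gt0 2 n0)) -exprMn.
apply: le_trans wy _.
have -> : #|` K|%:R ^+ 2 * (M * rnorm v) ^+ 2 =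
  #|` K|%:R * (M ^+ 2 * (#|` K|%:R * rnorm v ^+ 2)) by ring.
by rewrite ler_pM2l//; apply: le_trans y2 _; rewrite ler_wpM2l ?sqr_ge0.
Qed.

End Algebra.
End GroupAction.

Section Indicator.
Context {R : realType} {X : topologicalType}.
Local Notation C := R[i].

Definition ind (B : set X) : X -> C := fun x => (x \in B)%:R.

Lemma ind1 (B : set X) x : B x -> ind B x = 1.
Proof. by move=> Bx; rewrite /ind mem_set. Qed.

Lemma ind0 (B : set X) x : ~ B x -> ind B x = 0.
Proof. by move=> Bx; rewrite /ind memNset. Qed.

Lemma ind_id (B : set X) x : ind B x * ind B x = ind B x.
Proof. by rewrite /ind; case: (_ \in _); rewrite ?mulr0 ?mulr1. Qed.

Lemma conj_ind (B : set X) : conj_fun (ind B) = ind B.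
Proof. by apply/funext => x; rewrite /conj_fun /ind rmorph_nat. Qed.

Lemma C0_ind (B : set X) : clopen B -> compact B -> C0 R X (ind B).
Proof.
move=> [oB cB] kB; apply: C0P => [x e e0|e e0]; last first.
  by exists B => // x /ind0 ->; rewrite /cnorm normr0.
have [Bx|nBx] := pselect (B x).
  have : nbhs x B by exact: open_nbhs_nbhs.
  by apply: filterS => y By; rewrite !ind1// subrr /cnorm normr0.
have : nbhs x (~` B) by apply: open_nbhs_nbhs; split => //; exact: closed_openC.
by apply: filterS => y nBy; rewrite !ind0// subrr /cnorm normr0.
Qed.

End Indicator.

(* [compact_cover] is only available on pointed spaces. *)
Lemma compact_finite_cover {X : topologicalType} {J : choiceType} (K : set X)
    (U : J -> set X) : compact K -> (forall i, open (U i)) ->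
  (forall x, K x -> exists i, U i x) ->
  exists s : seq J, forall x, K x -> exists2 i, i \in s & U i x.
Proof.
move=> Kc oU KU; apply: contrapT => nos.
pose V (s : {fset J}) := [set x | K x /\ forall i, i \in s -> ~ U i x].
have V0 s : exists x, V s x.
  apply: contrapT => nV; apply: nos; exists (s : seq J) => x Kx.
  apply: contrapT => nx; apply: nV; exists x; split => // i si Ux.
  by apply: nx; exists i.
have FF : ProperFilter (filter_from setT V).
  apply: filter_from_proper; last by move=> s _; exact: V0.
  apply: filter_fromT_filter; first by exists fset0.
  move=> s s'; exists (s `|` s')%fset => x [Kx nx].
  by split; split => // i si; apply: nx; rewrite inE si ?orbT.
have [|x [Kx cx]] := Kc _ FF; first by exists fset0 => // x [].
have [i Ui] := KU x Kx.
have [||y [[_ nU] Uy]] := cx (V [fset i]%fset) (U i).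
- by exists [fset i]%fset.
- exact: open_nbhs_nbhs.
by apply: (nU i) => //; rewrite inE.
Qed.

(** * Simplicity and pure infiniteness for topologically free minimal actions *)

Section General.
Context {R : realType} {X : topologicalType} {G : groupType}.
Local Notation C := R[i].
Variable sg : G -> X -> X.
Hypothesis sg1 : forall x, sg 1%g x = x.
Hypothesis sgM : forall g h x, sg (g * h)%g x = sg h (sg g x).
Hypothesis sg_continuous : forall g, continuous (sg g).
Variables (A : cstarAlgType R) (j : (G -> X -> C) -> A).
Hypothesis cp : crossed_product (pull sg) j.
Local Notation mono := (mono j).

(** Folner's condition: translation by g in s moves at most the fraction e of K out of K. *)
Definition folner := forall (s : {fset G}) (e : R), 0 < e ->
  exists2 K : {fset G}, K != fset0 &
    forall g, g \in s -> 1 - e <= multiplier (R := R) K g.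

Lemma multiplier_ge0 (K : {fset G}) g : 0 <= multiplier (R := R) K g.
Proof. by rewrite /multiplier divr_ge0. Qed.

Lemma multiplier_le1 (K : {fset G}) g : multiplier (R := R) K g <= 1.
Proof.
rewrite /multiplier; have [->|K0] := eqVneq K fset0.
  by rewrite cardfs0 invr0 mulr0.
by rewrite ler_pdivrMr ?ltr0n ?cardfs_gt0// mul1r ler_nat count_size.
Qed.

Lemma multiplier_supp (K : {fset G}) g :
  g \notin [fset (k * l^-1)%g | k in K, l in K]%fset -> multiplier (R := R) K g = 0.
Proof.
move=> gK; rewrite /multiplier (_ : count _ _ = 0%N) ?mul0r//.
apply/eqP; rewrite -leqn0 leqNgt -has_count; apply: contra gK => /hasP[k kK gkK].
apply/imfset2P; exists k => //; exists (g^-1 * k)%g => //.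
by rewrite invgM invgK mulgA mulgV mul1g.
Qed.

Lemma CcB F F' : Cc R X G F -> Cc R X G F' ->
  Cc R X G (fun g => F g \+ (-1) \*o F' g) /\
  j (fun g => F g \+ (-1) \*o F' g) = j F - j F'.
Proof.
move=> Fc F'c; have NF : Cc R X G (fun g => (-1) \*o F' g).
  have [s Fs] := Cc_fset F'c; apply: (@fset_Cc _ _ _ _ s) => [g /Fs ->|g].
    by apply/funext => x /=; rewrite mulr0.
  by apply: C0Z; exact: F'c.2.
split; last by rewrite (cpD cp)// (cpZ cp)// scaleN1r.
have [s Fs] := Cc_fset Fc; have [s' Fs'] := Cc_fset F'c.
apply: (@fset_Cc _ _ _ _ (s `|` s')%fset) => [g|g].
  rewrite inE negb_or => /andP[/Fs -> /Fs' ->].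
  by apply/funext => x /=; rewrite mulr0 addr0.
by apply: C0D; [exact: Fc.2|exact: NF.2].
Qed.

Lemma Cc_multiply K F : Cc R X G F -> Cc R X G (multiply K F).
Proof.
move=> Fc; have [s Fs] := Cc_fset Fc.
apply: (@fset_Cc _ _ _ _ s) => [g /Fs|g].
  by rewrite /multiply => ->; apply/funext => x /=; rewrite mulr0.
by apply: C0Z; exact: Fc.2.
Qed.

(** The multiplied element is supported in K K^-1 whatever the support of F, so that the bound
    depends only on K and on the size of the coefficients. *)
Lemma rnorm_multiply_small (K : {fset G}) F (d : R) : Cc R X G F -> 0 <= d ->
  (forall g x, cnorm (F g x) <= d) ->
  rnorm (j (multiply K F)) <=
    #|` [fset (k * l^-1)%g | k in K, l in K]%fset|%:R * d.
Proof.
move=> Fc d0 Fd; set T := [fset _ | _ in _, _ in _]%fset.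
rewrite (@jE _ _ _ _ _ _ cp _ T) => [||g gT]; last first.
- by rewrite /multiply multiplier_supp//; apply/funext => x /=; rewrite mul0r.
- exact: Cc_multiply.
apply: le_trans (rnorm_sum _ _ _) _.
apply: (@le_trans _ _ (\sum_(g <- T) d)).
  apply: ler_sum => g _; apply: (rnorm_mono cp) => //.
    by apply: C0Z; exact: Fc.2.
  move=> x; rewrite /multiply /= cnorm_mul -[leRHS]mul1r.
  apply: ler_pM => //; [exact: cnorm_ge0|exact: cnorm_ge0|].
  by rewrite /cnorm ger0_norm ?ler0c ?multiplier_ge0// multiplier_le1.
by rewrite big_const_seq count_predT iter_addr_0 mulr_natl.
Qed.

Lemma rnorm_multiply_close (F : G -> X -> C) (e : R) : folner -> Cc R X G F -> 0 < e ->
  exists2 K : {fset G}, K != fset0 & rnorm (j F - j (multiply K F)) <= e.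
Proof.
move=> fol Fc e0; have [s Fs] := Cc_fset Fc.
have /choice[M MP] : forall g, exists M : R, 0 <= M /\ forall x, cnorm (F g x) <= M.
  by move=> g; have [M M0 FM] := C0_bounded (Fc.2 g); exists M.
pose S := \sum_(g <- s) M g.
have S0 : 0 <= S by apply: sumr_ge0 => g _; exact: (MP g).1.
have S1 : 0 < S + 1 by lra.
(* S is the sum of bounds for the coefficients; the added 1 covers the case S = 0. *)
have [|K K0 Ks] := fol s (e / (S + 1)); first by rewrite divr_gt0.
exists K => //.
have [_ <-] := CcB Fc (Cc_multiply K Fc).
have Dc := (CcB Fc (Cc_multiply K Fc)).1.
rewrite (@jE _ _ _ _ _ _ cp _ s) => [||g /Fs Fg]; last first.
- by rewrite /multiply Fg; apply/funext => x /=; rewrite !mulr0 addr0.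
- exact: Dc.
apply: le_trans (rnorm_sum _ _ _) _.
apply: (@le_trans _ _ (\sum_(g <- s) (e / (S + 1)) * M g)).
  rewrite big_seq [leRHS]big_seq; apply: ler_sum => g gs.
  have q0 : 0 <= e / (S + 1) by rewrite ltW// divr_gt0.
  apply: (rnorm_mono cp).
  - exact: Dc.2.
  - by rewrite mulr_ge0//; exact: (MP g).1.
  move=> x; rewrite /multiply /=.
  have -> : F g x + -1 * (real_complex R (multiplier K g) * F g x) =
      real_complex R (1 - multiplier K g) * F g x by rewrite rmorphB rmorph1; ring.
  rewrite cnorm_mul; apply: ler_pM; [exact: cnorm_ge0|exact: cnorm_ge0| |exact: (MP g).2].
  have m1 := multiplier_le1 K g; have := Ks g gs.
  by rewrite /cnorm ger0_norm ?ler0c ?subr_ge0//=; lra.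
rewrite -mulr_sumr -/S mulrAC ler_pdivrMr// ler_wpM2l// ?ltW//; lra.
Qed.

(* Otherwise y is approximated by j F with arbitrarily small coefficients F, hence
   by j (multiply K F), which is small as K is finite. *)
Lemma coefficients_faithful (y : A) : folner -> y <> 0 ->
  exists2 d : R, 0 < d & forall F, Cc R X G F -> rnorm (y - j F) < d ->
    exists g x, d < cnorm (F g x).
Proof.
move=> fol /rnorm_gt0 y0; apply: contrapT => H.
(* The triangle inequalities below add up to at most 5 e, against |y| = 8 e. *)
have e0 : 0 < rnorm y / 8 by lra.
set e := rnorm y / 8 in e0.
have [_ [F0 Fc0 <-] yF0] := rnorm_denseP (cp_dense cp) y e0.
have [K K0 FK] := rnorm_multiply_close fol Fc0 e0.
(* K depends only on F0, so d can be chosen small against the size of K K^-1, and F after d. *)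
pose n := #|` [fset (k * l^-1)%g | k in K, l in K]%fset|.
have n0 : 0 < n.+1%:R :> R by rewrite ltr0n.
pose d : R := e / n.+1%:R.
have d0 : 0 < d by rewrite divr_gt0.
have [F [Fc yF Fd]] : exists F, [/\ Cc R X G F, rnorm (y - j F) < d &
    forall g x, cnorm (F g x) <= d].
  apply: contrapT => nF; apply: H; exists d => // F Fc yF.
  apply: contrapT => nFd; apply: nF; exists F; split => // g x.
  by rewrite leNgt; apply/negP => dF; apply: nFd; exists g, x.
have de : d <= e.
  by rewrite /d ler_pdivrMr// ler_peMr// ?(ltW e0)// ler1n.
have mF : rnorm (j (multiply K F)) <= e.
  apply: le_trans (rnorm_multiply_small K Fc (ltW d0) Fd) _.
  rewrite -/n /d mulrCA -[leRHS]mulr1 ler_wpM2l ?ltW//.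
  by rewrite ltr_pdivrMr// mul1r ltr_nat.
have [Dc Dj] := CcB Fc0 Fc.
have := rnorm_multiply sg1 sgM sg_continuous cp K0 Dc.
have -> : multiply K (fun g => F0 g \+ (-1) \*o F g) =
    fun g => multiply K F0 g \+ (-1) \*o multiply K F g.
  by apply/funext => g; apply/funext => x; rewrite /multiply /=; ring.
have [_ ->] := CcB (Cc_multiply K Fc0) (Cc_multiply K Fc).
rewrite Dj => mD.
have := rnorm_dist (j F0) y (j F); rewrite (rnormC (j F0) y) => F0F.
have := rnorm_dist y (j F0) 0.
have := rnorm_dist (j F0) (j (multiply K F0)) 0.
have := rnorm_dist (j (multiply K F0)) (j (multiply K F)) 0.
rewrite !subr0; rewrite /e in mF FK yF0 de.
lra.
Qed.

Variable basic : set X -> Prop.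
Hypothesis basic_clopen : forall B, basic B -> clopen B.
Hypothesis basic_compact : forall B, basic B -> compact B.
Hypothesis basic_free : forall (x : X) (O : set X) (s : {fset G}), nbhs x O ->
  1%g \notin s -> exists B, [/\ basic B, B !=set0, B `<=` O &
    forall g z, g \in s -> B z -> ~ B (sg g z)].

Let C0_basic B : basic B -> C0 R X (ind B).
Proof. by move=> bB; apply: C0_ind; [exact: basic_clopen|exact: basic_compact]. Qed.

Lemma C0_pull1 f : pull sg 1%g f = f :> (X -> C).
Proof. by apply/funext => x; rewrite /pull sg1. Qed.

Lemma projection_mono_ind B : C0 R X (ind B) -> projection (mono (ind B) 1%g).
Proof.
move=> B0; split.
  rewrite (mono_star cp)// invg1 C0_pull1 conj_ind//.
rewrite (monoM cp)// C0_pull1 mul1g; congr mono.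
by apply/funext => x /=; rewrite ind_id.
Qed.

(** For F near y, the coefficient c of F^* F at 1 exceeds d^2 at some point and is nearly constant
    on a small B around or near it, and p F^* F p = 1_B c. Dividing by the value l at that point
    brings the corner within 1/8 + 1/8 of p. *)
Lemma corner_approximation (y : A) : folner -> y <> 0 -> exists B (k : R),
  [/\ basic B, B !=set0, 0 < k & let p := mono (ind B) 1%g in
      rnorm (p - p ** (real_complex R k *: (y^#* ** y)) ** p) <= 1 / 2].
Proof.
move=> fol y0; have [d d0 dP] := coefficients_faithful fol y0.
have Y0 := rnorm_ge0 y; pose D := 2 * rnorm y + 1.
have D0 : 0 < D by rewrite /D; lra.
(* For d' <= 1, |F^* F - y^* y| <= d' (|F| + |y|) <= d' (2 |y| + 1), and this has to be at most d^2
   / 8, an eighth of the lower bound d^2 for l. *)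
pose d' := Num.min (Num.min d 1) (d ^+ 2 / 8 / D).
have d'0 : 0 < d' by rewrite /d' !lt_min d0 ltr01 !divr_gt0 ?exprn_gt0.
have [d'd d'1 d'D] : [/\ d' <= d, d' <= 1 & d' * D <= d ^+ 2 / 8].
  rewrite -ler_pdivlMr// /d' !ge_min !lexx !orbT; split => //.
have [_ [F Fc <-] yF] := rnorm_denseP (cp_dense cp) y d'0.
have [g0 [x0 Fd]] := dP F Fc (lt_le_trans yF d'd).
have [s Fs] := Cc_fset Fc; have jF := jE cp Fc Fs; have F0 := Fc.2.
pose e g h : X -> C := pull sg g^-1%g (conj_fun (F g) \* F h).
have e0 g h : C0 R X (e g h).
  by apply: (C0_pull sg1 sgM sg_continuous); apply: C0M => //; exact: C0_conj.
pose c : X -> C := fun x => \sum_(g <- s) e g g x.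
have c0 : C0 R X c by have [] := mono_sum cp s 1%g (fun g => e0 g g).
have FF : (j F)^#* ** j F = \sum_(g <- s) \sum_(h <- s) mono (e g h) (g^-1 * h)%g.
  rewrite jF cstar_sum cmul_suml; apply: eq_bigr => g _.
  rewrite cmul_sumr; apply: eq_bigr => h _.
  rewrite (mono_star cp)// (monoM cp)//.
  by apply: (C0_pull sg1 sgM sg_continuous); exact: C0_conj.
pose r x : R := \sum_(g <- s) cnorm (F g (sg g^-1%g x)) ^+ 2.
have cE x : c x = real_complex R (r x).
  rewrite /c /r rmorph_sum; apply: eq_bigr => g _.
  by rewrite /e /pull /= /conj_fun mulrC -normCK cnormE -rmorphXn.
(* At this point the term of c for g0 is |F g0 x0|^2, since [e g g] evaluates F g at [sg g^-1 x]. *)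
pose x1 := sg g0 x0; pose l := r x1.
have ld : d ^+ 2 < l.
  have g0s : g0 \in s.
    apply: contraTT Fd => /Fs ->; rewrite -leNgt.
    by rewrite /cnorm normr0 ltW.
  rewrite /l /r (big_fsetD1 g0)//= /x1 (sgK sg1 sgM).
  apply: (@lt_le_trans _ _ (cnorm (F g0 x0) ^+ 2)).
    by rewrite ltr_sqr ?nnegrE ?cnorm_ge0// ltW.
  by rewrite lerDl sumr_ge0// => g _; rewrite sqr_ge0.
have l0 : 0 < l by apply: le_lt_trans ld; rewrite sqr_ge0.
have d28 : 0 < d ^+ 2 / 8 by rewrite divr_gt0// exprn_gt0.
(* These are the group elements occurring in F^* F. Those with g <> h differ from 1 and move B off
   itself, which kills the off-diagonal terms. *)
pose s1 := [fset (g^-1 * h)%g | g in s, h in s]%fset.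
have [|B [bB Bne BO Bs]] := @basic_free x1 _ (s1 `\ 1%g)%fset (C0_near c0 x1 d28).
  by rewrite !inE eqxx.
exists B, l^-1; split => //; first by rewrite invr_gt0.
have B0 := C0_basic bB; have pp := projection_mono_ind B0.
move=> p; rewrite -/p in pp; have p1 := rnorm_projection pp.
have pFFp : p ** ((j F)^#* ** j F) ** p = mono (ind B \* c) 1%g.
  rewrite FF cmul_sumr cmul_suml.
  have -> : ind B \* c = fun x => \sum_(g <- s) (ind B \* e g g) x.
    by apply/funext => x; rewrite /c /= mulr_sumr.
  rewrite (mono_sum cp s 1%g (fun g => C0M B0 (e0 g g))).2.
  rewrite big_seq [RHS]big_seq; apply: eq_bigr => g gs.
  rewrite cmul_sumr cmul_suml (big_fsetD1 g)//= big1_seq ?addr0 => [|h].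
    rewrite mulVg (monoM cp)// (monoM cp)//; last first.
      by apply: C0M => //; rewrite C0_pull1.
    rewrite !C0_pull1 !mul1g; congr mono; apply/funext => x /=.
    by rewrite C0_pull1 mulrAC ind_id.
  rewrite in_fsetD1 => /andP[_ /andP[hg hs]].
  rewrite (monoM cp)// (monoM cp)//; last first.
    by apply: C0M => //; rewrite C0_pull1.
  rewrite C0_pull1 mul1g mulg1 -(mono0 cp (g^-1 * h)%g); congr mono.
  apply/funext => x /=; rewrite /pull.
  have [Bx|nBx] := pselect (B x); last by rewrite (ind0 nBx) !mul0r.
  rewrite [X in _ * X]ind0 ?mulr0//; apply: Bs => //.
  rewrite !inE; apply/andP; split; last by apply: in_imfset2.
  apply: contra hg => /eqP gh.
  by rewrite -(mul1g h) -(mulgV g) -mulgA gh mulg1.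
have -> : p - p ** (real_complex R l^-1 *: (y^#* ** y)) ** p =
    mono (ind B \+ (real_complex R (- l^-1)) \*o (ind B \* c)) 1%g
    + p ** (real_complex R l^-1 *: ((j F)^#* ** j F - y^#* ** y)) ** p.
  rewrite (monoD cp)//; last by apply: C0Z; exact: C0M.
  rewrite (monoZ cp); last exact: C0M.
  rewrite -pFFp -!cscalerAr -!cscalerAl -addrA; congr (_ + _).
  rewrite cmulBr cmulBl scalerBr addrA rmorphN scaleNr addNr add0r.
  by rewrite cmulA.
apply: le_trans (rnormD _ _) _.
have n1 : rnorm (mono (ind B \+ (real_complex R (- l^-1)) \*o (ind B \* c)) 1%g) <= 1 / 8.
  apply: (rnorm_mono cp); [|lra|].
    by apply: C0D => //; apply: C0Z; exact: C0M.
  move=> x /=; have [Bx|nBx] := pselect (B x); last first.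
    by rewrite (ind0 nBx) mul0r mulr0 addr0 /cnorm normr0 divr_ge0.
  rewrite (ind1 Bx) mul1r; have := BO x Bx => /=; rewrite !cE -/l.
  rewrite -rmorphB -rmorphM -(rmorph1 (real_complex R)) -rmorphD /=.
  have cr (a : R) : cnorm (real_complex R a) = `|a|.
    by rewrite /cnorm normc_def /= expr0n addr0 sqrtr_sqr.
  rewrite !cr => lr.
  have -> : 1 + - l^-1 * r x = (l - r x) / l by field; rewrite gt_eqF.
  rewrite normrM normfV (gtr0_norm l0) ler_pdivrMr//; lra.
have n2 : rnorm ((j F)^#* ** j F - y^#* ** y) <= d ^+ 2 / 8.
  have -> : (j F)^#* ** j F - y^#* ** y =
      - ((y - j F)^#* ** y + (j F)^#* ** (y - j F)).
    by rewrite cstarB cmulBl cmulBr addrA subrK opprB.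
  rewrite rnormN; apply: le_trans (rnormD _ _) _.
  have := rnormM (y - j F)^#* y; have := rnormM (j F)^#* (y - j F).
  rewrite !rnorm_star; have := rnorm_dist (j F) y 0; rewrite !subr0 (rnormC (j F)).
  have := rnorm_ge0 (y - j F); have := rnorm_ge0 (j F); rewrite /D in d'D; nra.
have n3 : rnorm (p ** (real_complex R l^-1 *: ((j F)^#* ** j F - y^#* ** y)) ** p) <= 1 / 8.
  set z := _ - _ in n2 *.
  apply: (@le_trans _ _ (rnorm (real_complex R l^-1 *: z))).
    have := rnormM (p ** (real_complex R l^-1 *: z)) p.
    have := rnormM p (real_complex R l^-1 *: z).
    have := rnorm_ge0 p; have := rnorm_ge0 (real_complex R l^-1 *: z).
    have := rnorm_ge0 (p ** (real_complex R l^-1 *: z)); nra.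
  rewrite rnormZr ?invr_ge0 ?(ltW l0)// mulrC ler_pdivrMr//; lra.
lra.
Qed.

Hypothesis basic_minimal : forall B x, basic B -> exists g, B (sg g x).

Section Ideal.
Variables (I : set A) (B : set X).
Hypothesis idI : closed_ideal I.
Hypothesis bB : basic B.
Hypothesis IB : I (mono (ind B) 1%g).

Let ID x y : I x -> I y -> I (x + y). Proof. by case: idI => -[_ _ + _ _]; exact. Qed.
Let IZ k x : I x -> I (k *: x). Proof. by case: idI => -[_ _ _ + _]; exact. Qed.
Let IMr x y : I x -> I (x ** y).
Proof. by case: idI => _ h Ix; case: (h x y Ix). Qed.
Let IMl x y : I x -> I (y ** x).
Proof. by case: idI => _ h Ix; case: (h x y Ix). Qed.

Let B0 : C0 R X (ind B) := C0_basic bB.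

(** Conjugation of 1_B by u_g is replaced by (u_g 1_B) 1_B (1_B u_g^-1), whose three factors belong
    to the algebra. *)
Lemma ideal_translate g : I (mono (pull sg g (ind B)) 1%g).
Proof.
have f0 : C0 R X (pull sg g (ind B)) by exact: (C0_pull sg1 sgM sg_continuous).
have : I (mono (pull sg g (ind B)) g ** mono (ind B) 1%g ** mono (ind B) g^-1%g).
  by apply: IMr; apply: IMl.
rewrite !(monoM cp)//; last exact: C0M.
rewrite mulg1 mulgV; congr (I (mono _ _)); apply/funext => x /=.
by rewrite /pull !ind_id.
Qed.

Lemma ideal_finite_union (s : seq G) : exists u : X -> C,
  [/\ C0 R X u, I (mono u 1%g), forall x, u x = 0 \/ u x = 1 &
      forall x, (exists2 g, g \in s & B (sg g x)) -> u x = 1].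
Proof.
elim: s => [|g s [u [u0 Iu u01 us]]].
  exists (cst 0); split; first exact: C0_cst0.
  - by rewrite (mono0 cp); case: idI => -[].
  - by move=> x; left.
  - by move=> x [].
have f0 : C0 R X (pull sg g (ind B)) by exact: (C0_pull sg1 sgM sg_continuous).
set f := pull sg g (ind B) in f0.
have f01 x : f x = 0 \/ f x = 1.
  by rewrite /f /pull /ind; case: (_ \in _); [right|left].
have fu0 : C0 R X (f \* u) by exact: C0M.
(* f + u - f u is the indicator of the union, and f u is a product with an element of the ideal. *)
exists ((f \+ u) \+ (-1) \*o (f \* u)); split.
- by apply: C0D; [exact: C0D|exact: C0Z].
- rewrite (monoD cp) ?(monoD cp) ?(monoZ cp)//; [|exact: C0D|exact: C0Z].
  apply: ID; first by apply: ID => //; exact: ideal_translate.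
  apply: IZ; have <- : mono f 1%g ** mono u 1%g = mono (f \* u) 1%g.
    by rewrite (monoM cp)// C0_pull1 mul1g.
  exact: IMl.
- move=> x /=; have [->|->] := f01 x; have [->|->] := u01 x;
    rewrite ?(mulr0, mul0r, mul1r, addr0, add0r); [left|right|right|right] => //.
  by rewrite mulr1 addrK.
- move=> x /= [h]; rewrite inE => /predU1P[->|hs] Bh.
    by rewrite /f /pull ind1// mul1r mulN1r addrK.
  by rewrite us ?mulr1; [rewrite addrAC mulN1r subrr add0r|exists h].
Qed.

(** Up to e/2, f lives on a compact set, which finitely many translates of B cover; with u from
    [ideal_finite_union], u f gives an element of the ideal close to that of f. *)
Lemma ideal_mono f g : C0 R X f -> I (mono f g).
Proof.
move=> f0; apply: rnorm_closedP => [|e e0]; first by case: idI => -[].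
have e2 : 0 < e / 2 by rewrite divr_gt0.
have [K Kc Kf] := C0_vanish f0 e2.
have [|x _|s sK] := compact_finite_cover (U := fun g => sg g @^-1` B) Kc.
- move=> h; apply: open_comp; last exact: (basic_clopen bB).1.
  by move=> x _; exact: sg_continuous.
- exact: basic_minimal.
have [u [u0 Iu u01 us]] := ideal_finite_union s.
have uf0 : C0 R X (u \* f) by exact: C0M.
exists (mono (u \* f) g).
  have <- : mono u 1%g ** mono f g = mono (u \* f) g.
    by rewrite (monoM cp)// C0_pull1 mul1g.
  exact: IMr.
have -> : mono f g - mono (u \* f) g = mono (f \+ (-1) \*o (u \* f)) g.
  by rewrite (monoD cp)// ?(monoZ cp)// ?scaleN1r//; exact: C0Z.
apply: (@le_lt_trans _ _ (e / 2)); last lra.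
apply: (rnorm_mono cp); [|exact: ltW|].
  by apply: C0D => //; exact: C0Z.
move=> x /=; have [ux|ux] := u01 x; rewrite ux.
  rewrite mul0r mulr0 addr0 ltW//; apply: Kf => /sK[h hs Bh].
  have : u x = 1 by apply: us; exists h.
  by rewrite ux => /eqP; rewrite eq_sym oner_eq0.
by rewrite mul1r mulN1r subrr /cnorm normr0 ltW.
Qed.

Lemma ideal_full : I = setT.
Proof.
apply/seteqP; split => // x _; apply: rnorm_closedP => [|e e0].
  by case: idI => -[].
have [_ [F Fc <-] xF] := rnorm_denseP (cp_dense cp) x e0.
exists (j F) => //; have [s Fs] := Cc_fset Fc; rewrite (jE cp Fc Fs).
elim/big_rec : _ => [|g z _ Iz]; first by case: idI => -[].
by apply: ID => //; apply: ideal_mono; exact: Fc.2.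
Qed.

End Ideal.

Hypothesis basic_nonempty : exists2 B, basic B & B !=set0.
Hypothesis fol : folner.
Hypothesis basic_infinite : forall B, basic B -> B !=set0 ->
  infinite_projection (mono (ind B) 1%g).

Theorem crossed_product_simple_purely_infinite :
  simple_cstar A /\ purely_infinite A.
Proof.
split; [split|].
- have [B bB B0] := basic_nonempty; exists (mono (ind B) 1%g).
  (* An infinite projection p is not 0: it has a subprojection q <> p, and p = 0 would give q = p q
     = 0. *)
  have [_ [q [[_ qq] pq qp _]]] := basic_infinite bB B0.
  by move=> p0; apply: qp; rewrite -pq p0 cmul0l.
- move=> I idI; have [[y [Iy y0]]|nI] := pselect (exists y, I y /\ y <> 0).
    right; have [B [k [bB _ k0 /= pyp]]] := corner_approximation fol y0.
    have Iyy : I (real_complex R k *: (y^#* ** y)).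
      have [[_ _ _ IZ] IM] := idI; apply: IZ.
      by case: (IM y y^#* Iy).
    apply: (ideal_full idI bB).
    apply: (corner_in_closed_ideal idI Iyy _ _ pyp).
      by rewrite cstarZr cstarM cstarK.
    exact: projection_mono_ind (C0_basic bB).
  left; apply/seteqP; split => [y Iy|_ ->]; last by case: idI => -[].
  by apply: contrapT => y0; apply: nI; exists y.
move=> D hD [y Dy y0].
have [B [k [bB B0 k0 /= pyp]]] := corner_approximation fol y0.
have pp := projection_mono_ind (C0_basic bB).
have [q [Dq qq pq]] := corner_in_hereditary hD Dy pp k0 pyp.
exists q => //; apply: murray_von_neumann_infinite pq _ => //.
exact: basic_infinite.
Qed.

End General.

(** * Amenability of the affine group *)

Section AbelianFolner.
Context {R : realType} {S : eqType} {T : choiceType}.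
Variables (m : S -> T -> T) (x0 : T).
Hypothesis mC : forall s s' x, m s (m s' x) = m s' (m s x).
Hypothesis m_inj : forall s, injective (m s).

(** All s_1^e_1 ... s_r^e_r x0 with exponents at most L, listed with repetitions: relations between
    the generators only make the underlying set smaller. *)
Fixpoint box (ss : seq S) (L : nat) : seq T :=
  if ss is s :: ss' then [seq iter e (m s) x | e <- iota 0 L.+1, x <- box ss' L]
  else [:: x0].

Lemma boxE s ss L :
  box (s :: ss) L = [seq iter e (m s) x | e <- iota 0 L.+1, x <- box ss L].
Proof. by []. Qed.

Lemma size_box ss L : size (box ss L) = (L.+1 ^ size ss)%N.
Proof. by elim: ss => [//|s ss IH]; rewrite size_allpairs size_iota IH expnS. Qed.

Lemma box_mem0 ss L : x0 \in box ss L.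
Proof.
elim: ss => [|s ss IH]; first by rewrite inE.
by rewrite boxE; apply/allpairsP; exists (0%N, x0).
Qed.

Lemma box_step ss L : {subset box ss L <= box ss L.+1} /\
  forall s x, s \in ss -> x \in box ss L -> m s x \in box ss L.+1.
Proof.
elim: ss => [|s ss [IHs IHm]]; first by split.
rewrite !boxE; split => [x|s' x].
  move=> /allpairsP[[e y] [eL yL ->]]; apply/allpairsP; exists (e, y).
  by split=> //; [move: eL; rewrite !mem_iota /=; lia|exact: IHs].
have iterC e y : m s' (iter e (m s) y) = iter e (m s) (m s' y).
  by elim: e => //= e <-; rewrite mC.
rewrite inE => /predU1P[->|s'ss] /allpairsP[[e y] [eL yL ->]]; apply/allpairsP.
  by exists (e.+1, y); split => //; [move: eL; rewrite !mem_iota /=; lia|exact: IHs].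
exists (e, m s' y); split; [move: eL; rewrite !mem_iota /=; lia|exact: IHm|].
by rewrite iterC.
Qed.

(** Take L = (r + 1) M. Then (1 + e)^L >= (1 + M e)^(r + 1) by Bernoulli's inequality, L + 1 <= c (1
    + M e), and M is chosen with c^r < 1 + M e. *)
Lemma exp_gt_poly (e : R) (r : nat) : 0 < e ->
  exists L : nat, (L.+1 ^ r)%:R < (1 + e) ^+ L.
Proof.
move=> e0; pose c : R := r.+1%:R / e + 1.
have c0 : 0 < c by rewrite /c addr_gt0// divr_gt0// ltr0n.
pose M := (Num.truncn (c ^+ r / e)).+1.
have Mc : c ^+ r < 1 + M%:R * e.
  have : c ^+ r / e < M%:R by rewrite truncnS_gt.
  by rewrite ltr_pdivrMr//; lra.
have M0 : 0 <= M%:R * e by rewrite mulr_ge0// ltW.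
exists (r.+1 * M)%N.
apply: (@lt_le_trans _ _ ((1 + M%:R * e) ^+ r.+1)); last first.
  rewrite mulnC exprM lerXn2r ?nnegrE ?exprn_ge0 ?addr_ge0 ?(ltW e0)//.
  elim: (M) => [|k IH]; first by rewrite mul0r addr0 expr0.
  rewrite exprS; apply: (@le_trans _ _ ((1 + e) * (1 + k%:R * e))).
    rewrite -natr1; have : 0 <= k%:R :> R by []; nra.
  by rewrite ler_wpM2l ?addr_ge0 ?(ltW e0).
have rM : (r.+1 * M).+1%:R <= c * (1 + M%:R * e).
  have -> : (r.+1 * M).+1%:R = r.+1%:R * M%:R + 1 :> R by rewrite -natr1 natrM.
  have -> : c * (1 + M%:R * e) = r.+1%:R / e + r.+1%:R * M%:R + 1 + M%:R * e.
    by rewrite /c; field; rewrite gt_eqF.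
  have : 0 <= r.+1%:R / e by rewrite divr_ge0// ltW.
  lra.
apply: (@le_lt_trans _ _ (c ^+ r * (1 + M%:R * e) ^+ r)).
  rewrite -exprMn natrX; apply: lerXn2r rM; rewrite nnegrE ?ler0n//.
  by rewrite mulr_ge0 ?(ltW c0)//; lra.
by rewrite exprS ltr_pM2r// exprn_gt0//; lra.
Qed.

(** Boxes grow polynomially, so for some L the box of size L + 1 has at most 1 + e times the points
    of that of size L. A generator acts injectively and maps the latter into the former, hence moves
    at most the fraction e out of it. *)
Lemma abelian_folner (ss : seq S) (e : R) : 0 < e ->
  exists2 K : {fset T}, K != fset0 & forall s, s \in ss ->
    (1 - e) * #|` K|%:R <= (count (fun x => m s x \in K) K)%:R.
Proof.
move=> e0; pose B L := [fset x in box ss L]%fset.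
have BE x L : (x \in B L) = (x \in box ss L) by rewrite inE.
have B0 L : B L != fset0.
  by apply/fset0Pn; exists x0; rewrite BE box_mem0.
have [L HL] : exists L, #|` B L.+1|%:R <= (1 + e) * #|` B L|%:R.
  apply: contrapT => nL.
  have H L : (1 + e) ^+ L <= #|` B L|%:R.
    elim: L => [|L IH]; first by rewrite expr0 ler1n cardfs_gt0.
    apply: (@le_trans _ _ ((1 + e) * #|` B L|%:R)).
      by rewrite exprS ler_wpM2l ?addr_ge0 ?(ltW e0).
    by rewrite leNgt; apply/negP => /ltW h; apply: nL; exists L.
  have [L LL] := exp_gt_poly (size ss) e0.
  have := lt_le_trans LL (H L); rewrite ltr_nat ltnNge => /negP; apply.
  by rewrite -size_box /B card_fseq size_undup.
exists (B L) => // s sss.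
have BS : (B L `<=` B L.+1)%fset.
  by apply/fsubsetP => x; rewrite !BE; exact: (box_step ss L).1.
pose D := [fset m s x | x in [fset x in B L | m s x \notin B L]]%fset.
have D1 : #|` D| = count (fun x => m s x \notin B L) (B L).
  rewrite card_imfset /=; last exact: m_inj.
  by rewrite -[RHS]size_filter; apply/perm_size/uniq_perm;
    rewrite ?filter_uniq ?fset_uniq// => x; rewrite mem_filter !inE andbC.
have DB : (B L `|` D `<=` B L.+1)%fset.
  rewrite fsubUset BS; apply/fsubsetP => y /imfsetP[x /=].
  by rewrite !inE /= => /andP[xB _] ->; exact: (box_step ss L).2.
have dis : [disjoint B L & D]%fset.
  apply/fdisjointP => y yB; apply/negP => /imfsetP[x /=].
  by rewrite in_fset /= => /andP[_ nB] E; rewrite -E yB in nB.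
have [_] := leq_card_fsetU (B L) D; rewrite dis => /eqP cU.
have := fsubset_leq_card DB; rewrite cU D1 -(ler_nat R) natrD => cD.
have := count_predC (fun x => m s x \in B L) (B L).
move=> /(congr1 (fun n => n%:R : R)); rewrite natrD /predC /= => cC.
move: cD HL cC; rewrite /predC; lra.
Qed.

End AbelianFolner.

Section SemidirectFolner.
Context {R : realType} {a : adic_seq} {H : S_subgroup a}.
Local Notation HT := {h : rat | h \in subgroup_set H}.
Local Notation G := (semidirect H).
Implicit Types (h : HT) (n : N a).

Lemma HTmulC h (k : HT) : HTmul h k = HTmul k h.
Proof. by apply: val_inj; rewrite /= mulrC. Qed.

Lemma HTmulA h (k l : HT) : HTmul h (HTmul k l) = HTmul (HTmul h k) l.
Proof. by apply: val_inj; rewrite /= mulrA. Qed.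

Lemma HTmul_inj h : injective (HTmul h).
Proof.
move=> k l /(congr1 val) /= /(mulfI (HT_neq0 h)) kl; exact: val_inj.
Qed.

Lemma HNmul_inj h : injective (HNmul h).
Proof.
by move=> n n' /(congr1 val) /= /(mulfI (HT_neq0 h)) nn; apply: val_inj.
Qed.

Lemma HNmulD h n n' : HNmul h (n + n') = HNmul h n + HNmul h n'.
Proof. by apply: val_inj; rewrite /= mulrDr. Qed.

Lemma HNmulM h (k : HT) n : HNmul (HTmul h k) n = HNmul h (HNmul k n).
Proof. by apply: val_inj; rewrite /= mulrA. Qed.

Lemma HNmulK h n : HNmul h (HNmul (HTinv h) n) = n.
Proof. by apply: val_inj; rewrite /= mulVKf// HT_neq0. Qed.

(** A Folner set for H is chosen before the one for N, which has to be almost invariant under the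
    finitely many displacements that the first one creates. *)
Lemma semidirect_folner (s : seq G) (e : R) : 0 < e ->
  exists2 K : {fset G}, K != fset0 & forall g, g \in s ->
    (1 - e) * #|` K|%:R <= (count (fun k => (g * k)%g \in K) K)%:R.
Proof.
(* Each of the two Folner sets contributes a factor 1 - d, nonnegative as d <= 1, and (1 - d)^2 >= 1
   - 2 d >= 1 - e. *)
move=> e0; pose d := Num.min (e / 2) 1.
have d0 : 0 < d by rewrite /d lt_min ltr01 divr_gt0.
have [d1 de] : d <= 1 /\ 2 * d <= e.
  split; first by rewrite /d ge_min lexx orbT.
  by rewrite mulrC -ler_pdivlMr// /d ge_min lexx.
have mC (h k l : HT) : HTmul h (HTmul k l) = HTmul k (HTmul h l).
  by rewrite !HTmulA (HTmulC h).
have [KH KH0 KHs] := abelian_folner (HT1 H) mC HTmul_inj [seq g.2 | g <- s] d0.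
have aC (m n p : N a) : m + (n + p) = n + (m + p) by rewrite addrCA.
pose t := [seq HNmul (HTinv (HTmul g.2 h)) g.1 | g <- s, h <- enum_fset KH].
have [KN KN0 KNs] := abelian_folner (0 : N a) aC (fun m => addrI m) t d0.
(* The set of all (h n, h): left translation by g sends (h n, h) to
   (g.2 h (c h + n), g.2 h) with c h = (g.2 h)^-1 g.1. *)
pose K' : seq G := [seq (HNmul h n, h) : G | h <- enum_fset KH, n <- enum_fset KN].
have uK' : uniq K'.
  apply: allpairs_uniq; rewrite ?fset_uniq// => -[h n] [k p] _ _ E.
  have hk : h = k := congr1 snd E.
  have : HNmul h n = HNmul k p := congr1 fst E.
  by rewrite hk => /HNmul_inj ->.
pose K : {fset G} := [fset x in K']%fset.
have KK' : perm_eq K K'.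
  by apply: uniq_perm => // x; rewrite inE.
have KE x : (x \in K) = (x \in K') by rewrite inE.
have cK : #|` K|%:R = #|` KH|%:R * #|` KN|%:R :> R.
  by rewrite -natrM (perm_size KK') size_allpairs.
exists K.
  have /fset0Pn[h hK] := KH0; have /fset0Pn[n nK] := KN0.
  apply/fset0Pn; exists (HNmul h n, h); rewrite KE.
  by apply/allpairsP; exists (h, n).
move=> g gs; rewrite cK.
have -> : count (fun k => (g * k)%g \in K) K = count (fun k => (g * k)%g \in K) K'.
  exact/permP.
pose c h : N a := HNmul (HTinv (HTmul g.2 h)) g.1.
have gK h n : HTmul g.2 h \in KH -> c h + n \in KN ->
    (g * ((HNmul h n, h) : G))%g \in K.
  move=> hK nK; rewrite KE; apply/allpairsP; exists (HTmul g.2 h, c h + n).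
  by split => //=; rewrite HNmulD /c HNmulK HNmulM.
apply: (@le_trans _ _ (\sum_(h <- KH | HTmul g.2 h \in KH)
    (count (fun n => c h + n \in KN) KN)%:R)).
  apply: (@le_trans _ _ (\sum_(h <- KH | HTmul g.2 h \in KH) (1 - d) * #|` KN|%:R)).
    rewrite big_const_seq iter_addr_0 -[leRHS]mulr_natr.
    have := KHs g.2 (map_f _ gs).
    have : 0 <= #|` KN|%:R :> R by []. have : 0 <= #|` KH|%:R :> R by [].
    set u := count _ _; move: (#|` KN|%:R) (#|` KH|%:R) (u%:R) => x y z y0 x0 yz.
    have yz' : (1 - d) * y * ((1 - d) * x) <= z * ((1 - d) * x).
      by rewrite ler_wpM2r// mulr_ge0// subr_ge0.
    have xy0 : 0 <= x * y by rewrite mulr_ge0.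
    rewrite [leRHS]mulrC; apply: le_trans yz'.
    rewrite -subr_ge0.
    have -> : (1 - d) * y * ((1 - d) * x) - (1 - e) * (y * x) =
      (x * y) * (d ^+ 2 + (e - 2 * d)) by ring.
    by rewrite mulr_ge0// addr_ge0 ?sqr_ge0// subr_ge0.
  rewrite big_seq_cond [leRHS]big_seq_cond; apply: ler_sum => h /andP[hK _].
  by apply: KNs; apply/allpairsP; exists (g, h).
rewrite -natr_sum ler_nat /K' count_flatten sumnE !big_map big_mkcond.
apply: leq_sum => h _; case: ifP => // hK.
by rewrite count_map; apply: sub_count => n nK /=; exact: gK.
Qed.

Lemma folner_semidirect : folner (R := R) (G := G).
Proof.
(* [multiplier] counts the k with g^-1 k in K, hence the inverses. *)
move=> s e e0; have [K K0 Ks] := semidirect_folner [seq g^-1%g | g <- s] e0.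
exists K => // g gs; rewrite /multiplier ler_pdivlMr ?ltr0n ?cardfs_gt0//.
exact: Ks (map_f _ gs).
Qed.

End SemidirectFolner.

(** * The group of a-adic numbers *)

Section UniformGroup.
Context {M : UniformZmodule.type}.
Implicit Types (x y z : M) (O : set M).

Lemma sub_entourage (E : set (M * M)) : entourage E -> exists2 U,
  entourage U.1 /\ entourage U.2 &
  forall a b c d : M, U.1 (a, b) -> U.2 (c, d) -> E (a - c, b - d).
Proof.
move=> /sub_unif_continuous [[U1 U2]] /= [U1e U2e] U12.
exists (U1, U2) => // a b c d /= ab cd.
have [] := U12 ((a, b), (c, d)); first by split.
by move=> [[a1 c1] [b1 d1]] /= ? [] <- <- <- <-.
Qed.

(** Uniform continuity of subtraction is applied to the pairs (x, x) and (0, x - y), since x - 0 = x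
    and x - (x - y) = y. *)
Lemma entourage_sub (E : set (M * M)) : entourage E ->
  exists2 V, nbhs (0 : M) V & forall x y, V (x - y) -> E (x, y).
Proof.
move=> /sub_entourage[[U1 U2] /= [U1e U2e] UE].
exists (xsection U2 0); first exact: nbhs_entourage.
move=> x y /xsectionP Uxy; have := UE x x _ _ (entourage_refl _ U1e) Uxy.
by rewrite subr0 subKr.
Qed.

Lemma nbhs_subr x y O : nbhs (x - y) O -> exists A B, [/\ nbhs x A, nbhs y B &
  forall a b, A a -> B b -> O (a - b)].
Proof.
move=> /nbhsP[E /sub_entourage[[U1 U2] /= [U1e U2e] UE] EO].
exists (xsection U1 x), (xsection U2 y).
split; [exact: nbhs_entourage|exact: nbhs_entourage|].
by move=> a b /xsectionP xa /xsectionP yb; apply: EO; apply/xsectionP; exact: UE.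
Qed.

Lemma nbhs_translate x O c : nbhs (x - c) O -> nbhs x (fun y => O (y - c)).
Proof.
move=> /nbhs_subr[A [B [xA cB AB]]]; apply: filterS xA => y Ay.
by apply: AB => //; exact: nbhs_singleton cB.
Qed.

Lemma nbhs0_translate x O : nbhs (0 : M) O -> nbhs x (fun y => O (y - x)).
Proof. by move=> O0; apply: nbhs_translate; rewrite subrr. Qed.

Lemma nbhs_to0 x O : nbhs x O -> nbhs (0 : M) (fun y => O (y + x)).
Proof.
move=> xO; have -> : (fun y => O (y + x)) = (fun y => O (y - - x)).
  by apply/funext => y; rewrite opprK.
by apply: nbhs_translate; rewrite sub0r opprK.
Qed.

Lemma nbhs_rtranslate x O : nbhs (0 : M) O -> nbhs x (fun y => O (x - y)).
Proof.
rewrite -(subrr x) => /nbhs_subr[A [B [xA xB AB]]]; apply: filterS xB => y By.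
by apply: AB => //; exact: nbhs_singleton xA.
Qed.

Lemma continuous_subr c : continuous (fun x : M => x - c).
Proof. by move=> x O; exact: nbhs_translate. Qed.

Lemma closure_in_nbhs0 O : nbhs (0 : M) O ->
  exists2 V, nbhs (0 : M) V & closure V `<=` O.
Proof.
move=> O0; have [|A [B [A0 B0 AB]]] := @nbhs_subr 0 0 O; first by rewrite subrr.
exists A => // x /(_ _ (nbhs0_translate x B0)) [y [Ay By]].
by rewrite -(subKr y x); apply: AB.
Qed.

End UniformGroup.

Lemma ultra_big_union {T : Type} (F : set_system T) (C : nat -> set T) (n : nat) :
  UltraFilter F -> F (fun x => exists2 i, (i < n)%N & C i x) ->
  exists i, F (C i).
Proof.
move=> FU; elim: n => [|n IH].
  by move=> /filter_ex[x []].
move=> Fn; have [FC|FnC] := in_ultra_setVsetC (C n) FU; first by exists n.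
apply: IH; apply: filterS2 Fn FnC => x [k]; rewrite ltnS leq_eqVlt.
by move=> /predU1P[->|kn] Cx nCx //; exists k.
Qed.

Lemma hausdorff_dense_eq {X Y : topologicalType} {Z : Type} (i : Z -> X) (f g : X -> Y) :
  hausdorff_space Y -> dense (range i) -> continuous f -> continuous g ->
  (forall z, f (i z) = g (i z)) -> f =1 g.
Proof.
move=> hY di cf cg fg x; apply: hY => A B fA gB.
have [||y [fy [z _ zy]]] := di (((f @^-1` A) `&` (g @^-1` B))°).
- by exists x; apply: filterI; [exact: cf|exact: cg].
- exact: open_interior.
have [Ay By] := interior_subset fy.
by exists (f y); split => //; move: By; rewrite /preimage /= -zy fg.
Qed.

(** * Compact open subgroups of the a-adic numbers *)

Section Omega.
Context {a : adic_seq} {Omega : UniformZmodule.type} {iota : {additive N a -> Omega}}.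
Hypothesis comp : hausdorff_completion iota.
Implicit Types (q r : rat) (s t : N a).

(** The positive generators of the subgroups in the neighbourhood basis of N. *)
Definition adm q := exists m n j k : nat,
  [/\ (0 < m)%N, (0 < n)%N, (m %| posprod a j)%N,
      (1 <= k)%N /\ (n %| negprod a k)%N & q = m%:R / n%:R].

Definition mult q r := exists z : int, r = q * z%:~R.

Definition lattice q : set (N a) := [set x | mult q (Nval x)].

Lemma adic_basisP U : adic_basis U <-> exists2 q, adm q & U = lattice q.
Proof.
split=> [[m [n [j [k [m0 n0 mj kn ->]]]]]|[q [m [n [j [k [m0 n0 mj kn ->]]]]] ->]].
  by exists (m%:R / n%:R) => //; exists m, n, j, k.
by exists m, n, j, k.
Qed.

Lemma adm_gt0 q : adm q -> 0 < q.
Proof. by move=> [m [n [j [k [m0 n0 _ _ ->]]]]]; rewrite divr_gt0 ?ltr0n. Qed.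

Lemma adm_Nset q (z : int) : adm q -> Nset a (q * z%:~R).
Proof.
move=> [m [n [j [k [m0 n0 _ [k1 /dvdnP[d nE]] ->]]]]].
have d0 : (0 < d)%N by have := negprod_gt0 a k; rewrite nE; case: d {nE}.
exists (z * m%:Z * d%:Z), k; split => //; rewrite nE natrM !intrM -!pmulrn.
by field; rewrite !pnatr_eq0 -!lt0n d0 n0.
Qed.

Definition Nmult q (qa : adm q) (z : int) : N a := MkN (mem_set (adm_Nset z qa)).

Lemma multB q r r' : mult q r -> mult q r' -> mult q (r - r').
Proof. by move=> [z ->] [z' ->]; exists (z - z'); rewrite intrB mulrBr. Qed.

Lemma mult0 q : mult q 0. Proof. by exists 0; rewrite mulr0. Qed.

Lemma multM q r (k : rat) : k != 0 -> mult (k * q) (k * r) <-> mult q r.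
Proof.
move=> k0; split=> -[z E]; exists z; last by rewrite E mulrA.
by apply: (mulfI k0); rewrite E mulrA.
Qed.

Lemma lattice_nbhs0 V : nbhs (0 : Omega) V ->
  exists2 q, adm q & forall t, lattice q t -> V (iota t).
Proof.
move=> V0; have [_ /(_ _)[]] := completion_nbhs0 comp (iota @^-1` V).
  by exists V.
by move=> U /adic_basisP[q qa ->] UV; exists q.
Qed.

Lemma nbhs0_lattice q : adm q ->
  exists2 V, nbhs (0 : Omega) V & forall t, V (iota t) -> lattice q t.
Proof.
move=> qa; have [+ _] := completion_nbhs0 comp (lattice q).
by apply; exists (lattice q) => //; apply/adic_basisP; exists q.
Qed.

(** The closure of q Z in Omega; for admissible q these compact open subgroups form a neighbourhood
    basis at 0. *)
Definition wset q : set Omega := closure (iota @` lattice q).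

Lemma iota_dense (O : set Omega) (x : Omega) : nbhs x O -> exists t, O (iota t).
Proof.
move=> xO; have [||y [Oy [t _ ty]]] := completion_dense comp (O := O°).
- by exists x.
- exact: open_interior.
- by exists t; rewrite ty; exact: interior_subset.
Qed.

Lemma wset_nbhs0 q : adm q -> nbhs (0 : Omega) (wset q).
Proof.
move=> /nbhs0_lattice[V V0 Vq]; apply: filterS (nbhs_interior V0) => y Vy O yO.
have [|t [Vt Ot]] := @iota_dense (V `&` O) y.
  by apply: filterI => //; exact: Vy.
by exists (iota t); split => //; exists t => //; exact: Vq.
Qed.

Lemma wsetB q x y : wset q x -> wset q y -> wset q (x - y).
Proof.
move=> qx qy O /nbhs_subr[A [B [xA yB AB]]].
have [_ [[s qs <-] As]] := qx A xA; have [_ [[t qt <-] Bt]] := qy B yB.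
exists (iota s - iota t); split; last exact: AB.
by exists (s - t); [exact: multB|rewrite raddfB].
Qed.

Lemma wset0 q : wset q 0.
Proof. by apply: subset_closure; exists 0; [exact: mult0|rewrite raddf0]. Qed.

Lemma wsetN q x : wset q x -> wset q (- x).
Proof. by rewrite -sub0r; apply: wsetB; exact: wset0. Qed.

Lemma wsetD q x y : wset q x -> wset q y -> wset q (x + y).
Proof. by move=> qx /wsetN; rewrite -{2}(opprK y); exact: wsetB. Qed.

Lemma wset_closed q : closed (wset q).
Proof. exact: closed_closure. Qed.

Lemma wset_open q : adm q -> open (wset q).
Proof.
move=> qa; rewrite openE => x qx.
apply: filterS (nbhs0_translate x (wset_nbhs0 qa)) => y qy.
by rewrite -(subrK x y); exact: wsetD.
Qed.

(** q Z is an open subgroup of N, hence closed there, so that its closure acquires no new point of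
    N. *)
Lemma wset_iota q t : adm q -> wset q (iota t) <-> mult q (Nval t).
Proof.
move=> qa; split=> [qt|qt]; last by apply: subset_closure; exists t.
have [V V0 Vq] := nbhs0_lattice qa.
have [_ [[s qs <-] Vs]] := qt _ (nbhs0_translate (iota t) V0).
rewrite -(subKr s t : s - (s - t) = t); apply: multB => //.
by apply: Vq; rewrite raddfB.
Qed.

Lemma wset_coset x q : adm q -> exists t, wset q (x - iota t).
Proof.
move=> qa; have [t qt] := iota_dense (nbhs_rtranslate x (wset_nbhs0 qa)).
by exists t.
Qed.

Lemma wset_sub_nbhs0 V : nbhs (0 : Omega) V ->
  exists2 q, adm q & wset q `<=` V.
Proof.
move=> /closure_in_nbhs0[V' /lattice_nbhs0[q qa qV'] V'V]; exists q => //.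
apply: subset_trans V'V; apply: closureS => _ [t qt <-]; exact: qV'.
Qed.

(** That two members of the basis contain a third is read off from the neighbourhoods of 0 in Omega;
    its generator r is a multiple of q because [wset r] is contained in [wset q]. *)
Lemma adm_inter q q' : adm q -> adm q' -> exists (r : rat) (M : nat),
  [/\ adm r, (0 < M)%N, r = M%:R * q & wset r `<=` wset q'].
Proof.
move=> qa q'a.
have [r ra rW] := wset_sub_nbhs0 (filterI (wset_nbhs0 qa) (wset_nbhs0 q'a)).
have : mult q r.
  have /(wset_iota _ qa) : wset q (iota (Nmult ra 1)).
    by apply: (rW _ _).1; apply/wset_iota => //; exists 1.
  by rewrite /= mulr1.
move=> [z rE]; have z0 : 0 < z.
  by have := adm_gt0 ra; rewrite rE pmulr_rgt0 ?(adm_gt0 qa)// ltr0z.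
exists r, `|z|%N; split => //; first by rewrite absz_gt0 gt_eqF.
  by rewrite rE mulrC natr_absz gtr0_norm.
by move=> x /rW[].
Qed.

Lemma wset_cosets q (M : nat) x (qa : adm q) : adm (M%:R * q) -> (0 < M)%N ->
  wset q x -> exists2 i, (i < M)%N & wset (M%:R * q) (x - iota (Nmult qa i%:Z)).
Proof.
move=> ra M0 qx; have [t rt] := wset_coset x ra.
have /(wset_iota _ qa)[z tz] : wset q (iota t).
  rewrite -(subKr x (iota t)); apply: wsetB => //.
  move: rt; apply: closureS => _ [s [w sw] <-]; exists s => //.
  by exists (M%:Z * w); rewrite sw intrM mulrA [q * _]mulrC -pmulrn.
exists `|(z %% M)%Z|%N.
  by rewrite -ltz_nat gez0_abs ?modz_ge0 ?ltz_pmod// -?lt0n// eqz_nat -lt0n.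
rewrite -(subrK (iota t) x) -addrA; apply: wsetD => //; rewrite -raddfB.
apply/wset_iota => //; exists (z %/ M)%Z.
rewrite /= tz gez0_abs ?modz_ge0 ?eqz_nat -?lt0n// {1}(divz_eq z M).
by rewrite intrD mulrDr addrK intrM -pmulrn; ring.
Qed.

(** Complete and totally bounded: for arbitrarily small admissible r = M q, an ultrafilter on
    [wset q] contains one of the M cosets of [wset r], and is therefore Cauchy. *)
Lemma wset_compact q : adm q -> compact (wset q).
Proof.
move=> qa; rewrite compact_ultra => F FU FW.
have FP := @ultra_proper _ _ FU.
have [|x Fx] := completion_complete comp (F := F) _.
  move=> E /entourage_sub[V /wset_sub_nbhs0[q' q'a q'V] VE].
  have [r [M [ra M0 rE rq']]] := adm_inter qa q'a.
  pose C i x := wset r (x - iota (Nmult qa i%:Z)).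
  have [|i FC] := @ultra_big_union _ F C M FU.
    apply: filterS FW => x qx; rewrite /C rE; apply: wset_cosets => //.
    by rewrite -rE.
  exists (C i, C i) => // -[x y] [/= Cx Cy]; apply: VE; apply: q'V; apply: rq'.
  have := wsetB Cx Cy; rewrite opprB addrA subrK //.
exists x; split => //; apply: wset_closed => O /Fx FO.
have FO' : F O := FO.
exact: filter_ex (filterI FW FO').
Qed.

(** The integers a_0 ... a_j are admissible and unbounded because a_i >= 2, and a nonzero t is not a
    multiple of one that exceeds |t|. *)
Lemma iota_inj : injective iota.
Proof.
suff H t : iota t = 0 -> t = 0.
  by move=> s t st; apply/subr0_eq/H; rewrite raddfB st subrr.
move=> t0; apply/eqP; rewrite -val_eqE /=; apply: contraT => /= tn0.
have big j : (j < posprod a j)%N.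
  elim: j => [|j IH]; first by rewrite /posprod big_nat1 (leq_trans _ (adic_ge2 a _)).
  rewrite /posprod big_nat_recr//= -/(posprod a j).
  have := adic_ge2 a j.+1; move: IH; nia.
pose j := Num.truncn `|Nval t|; pose q : rat := (posprod a j)%:R.
have qa : adm q.
  exists (posprod a j), 1%N, j, 1%N; split; rewrite ?dvd1n ?divr1//.
  exact: leq_ltn_trans (big j).
have [z tz] : mult q (Nval t) by apply/wset_iota => //; rewrite t0; exact: wset0.
have : `|Nval t| < q.
  apply: (lt_le_trans (truncnS_gt _)); rewrite /q ler_nat; exact: big.
rewrite tz normrM (ger0_norm (ler0n _ _ : 0 <= q)) gtr_pMr ?(adm_gt0 qa)//.
rewrite -intr_norm -[1]/(1%:~R) ltr_int => z1.
by move: tn0; rewrite tz (_ : z = 0) ?mulr0 ?eqxx//; lia.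
Qed.

Definition cball t q : set Omega := [set x | wset q (x - iota t)].

Lemma cball_clopen t q : adm q -> clopen (cball t q).
Proof.
move=> qa; split.
  by apply: open_comp => [x _|]; [exact: continuous_subr|exact: wset_open].
by apply: closed_comp => [x _|]; [exact: continuous_subr|exact: wset_closed].
Qed.

Lemma cball_compact t q : adm q -> compact (cball t q).
Proof.
move=> qa; have -> : cball t q = (fun x => x - iota (- t)) @` wset q.
  apply/seteqP; split => [x qx|_ [x qx <-]].
    by exists (x - iota t) => //; rewrite raddfN opprK subrK.
  by rewrite /cball /= raddfN opprK addrK.
apply: continuous_compact; last exact: wset_compact.
by apply: continuous_subspaceT => x; exact: continuous_subr.
Qed.

Lemma cball_iota t q s : adm q -> cball t q (iota s) <-> mult q (Nval s - Nval t).
Proof. by move=> qa; rewrite /cball /= -raddfB wset_iota. Qed.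

Lemma C0_ext {R : realType} (f g : Omega -> R[i]) : C0 R Omega f -> C0 R Omega g ->
  (forall t, f (iota t) = g (iota t)) -> f = g.
Proof.
move=> f0 g0 fg; apply/funext => x; apply/subr0_eq/(@rnorm0_eq0 R R[i]^o).
apply/ler_addgt0Pl => e e0; have e2 : 0 < e / 2 by rewrite divr_gt0.
have [t [ft gt]] := iota_dense (filterI (C0_near f0 x e2) (C0_near g0 x e2)).
have := cnormD (f x - f (iota t)) (g (iota t) - g x).
rewrite -/(cnorm _) fg addrA subrK (_ : cnorm (g (iota t) - g x) = cnorm (g x - g (iota t))).
  by rewrite fg in ft; lra.
exact: (@rnormC R R[i]^o).
Qed.

Lemma C0_cball {R : realType} t q : adm q -> C0 R Omega (ind (cball t q)).
Proof. by move=> qa; apply: C0_ind; [exact: cball_clopen|exact: cball_compact]. Qed.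

Lemma ind_cball {R : realType} t q s : adm q ->
  ind (cball t q) (iota s) = (`[< mult q (Nval s - Nval t) >])%:R :> R[i].
Proof.
move=> qa; have cb := @cball_iota t q s qa.
by case: asboolP => [/cb h|h]; [rewrite ind1|rewrite ind0// => /cb].
Qed.

(** A prime of P divides a_l for arbitrarily large l, so p m divides a longer product a_0 ... a_l
    whenever m divides a_0 ... a_j. Fractions u / v of integers that preserve admissibility are
    stable under products and inverses; they need not be reduced. *)
Lemma S_adm (s : rat) : Sset a s -> exists u v : nat,
  [/\ (0 < u)%N, (0 < v)%N, s = u%:R / v%:R,
      forall q, adm q -> adm (u%:R * q) & forall q, adm q -> adm (v%:R * q)].
Proof.
move=> Ss; pose P (x : rat) := exists u v : nat, [/\ (0 < u)%N, (0 < v)%N,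
  x = u%:R / v%:R, forall q, adm q -> adm (u%:R * q) &
  forall q, adm q -> adm (v%:R * q)].
suff : [set x | P x] s by [].
apply: Ss; split=> [|_ [p [pp _ pinf] <-]].
  split=> [x [u [v [u0 v0 -> _ _]]]||x y|x].
  - by rewrite divr_gt0 ?ltr0n.
  - by exists 1%N, 1%N; split; rewrite ?divr1// => q; rewrite mul1r.
  - move=> [u [v [u0 v0 -> ua va]]] [u' [v' [u'0 v'0 -> u'a v'a]]].
    exists (u * u')%N, (v * v')%N; rewrite !muln_gt0 u0 v0 u'0 v'0; split => //.
    + by rewrite !natrM mulf_div.
    + by move=> q qa; rewrite natrM -mulrA; apply: ua; exact: u'a.
    + by move=> q qa; rewrite natrM -mulrA; apply: va; exact: v'a.
  - by move=> [u [v [u0 v0 -> ua va]]]; exists v, u; rewrite invf_div.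
exists p, 1%N; rewrite divr1 prime_gt0//; split => // q; last by rewrite mul1r.
move=> [m [n [j [k [m0 n0 mj kn ->]]]]].
have [l jl pl] : exists2 l : nat, (j < l)%N & (p %| a l)%N.
  apply: contrapT => nol; apply: pinf.
  apply: (@sub_finite_set _ _ (Posz @` `I_j.+1)); last exact/finite_image/finite_II.
  move=> i /= [i0 pi]; exists `|i|%N; last by rewrite gez0_abs.
  rewrite ltnNge; apply/negP => ji; apply: nol; exists `|i|%N => //.
  by rewrite gez0_abs.
exists (p * m)%N, n, l, k; split => //; last by rewrite natrM mulrA.
  by rewrite muln_gt0 prime_gt0.
case: l jl pl => // l jl pl; rewrite /posprod big_nat_recr//= mulnC.
rewrite dvdn_mul// (dvdn_trans mj)// /posprod.
by rewrite [X in (_ %| X)%N](big_cat_nat _ (n := j.+1))//=; exact: dvdn_mulr.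
Qed.

End Omega.
Arguments wset {a Omega} iota q.
Arguments cball {a Omega} iota t q.

(** * The affine action and its topological freeness *)

Section AffineAction.
Context {a : adic_seq} {Omega : UniformZmodule.type} {iota : {additive N a -> Omega}}.
Hypothesis comp : hausdorff_completion iota.
Variable dot : rat -> Omega -> Omega.
Hypothesis dotP : extends_multiplication iota dot.
Variable H : S_subgroup a.
Local Notation G := (semidirect H).
Implicit Types (s t : N a) (g : G).

(* The action of g^-1, on Omega and on N. *)
Definition aff g (x : Omega) : Omega := dot (val g.2)^-1 (x - iota g.1).
Definition affN g t : N a := HNmul (HTinv g.2) (t - g.1).

Lemma aff_iota g t : aff g (iota t) = iota (affN g t).
Proof.
rewrite /aff -raddfB /affN /HNmul.
by have [_ ->] := dotP (subgroup_S (HTP (HTinv g.2))).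
Qed.

Lemma aff_continuous g : continuous (aff g).
Proof.
move=> x; apply: (@continuous_comp _ _ _ (fun x => x - iota g.1) (dot (val g.2)^-1)).
  exact: continuous_subr.
by have [+ _] := dotP (subgroup_S (HTP (HTinv g.2))); exact.
Qed.

Lemma affNE g t : Nval (affN g t) = (val g.2)^-1 * (Nval t - Nval g.1).
Proof. by []. Qed.

Lemma affN1 t : affN 1%g t = t.
Proof. by apply: val_inj; rewrite /= invr1 mul1r subr0. Qed.

Lemma affNM g h t : affN (g * h)%g t = affN h (affN g t).
Proof.
apply: val_inj; rewrite /= invfM; have := HT_neq0 g.2; have := HT_neq0 h.2.
by rewrite /=; move: (sval g.2) (sval h.2) => u v v0 u0; field; rewrite u0 v0.
Qed.

Lemma aff1 x : aff 1%g x = x.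
Proof.
apply: (hausdorff_dense_eq (completion_hausdorff comp) (completion_dense comp)
  (@aff_continuous 1%g) (fun x => cvg_id)) => t.
by rewrite aff_iota affN1.
Qed.

Lemma affM g h x : aff (g * h)%g x = aff h (aff g x).
Proof.
have ghc : continuous (aff h \o aff g).
  by move=> y; exact: (continuous_comp (@aff_continuous g y) (@aff_continuous h _)).
apply: (hausdorff_dense_eq (completion_hausdorff comp) (completion_dense comp)
  (@aff_continuous (g * h)%g) ghc) => t.
by rewrite /= !aff_iota affNM.
Qed.

Definition basic (B : set Omega) := exists t q, adm (a := a) q /\ B = cball iota t q.

Lemma basic_orbit B x : basic B -> exists g, B (aff g x).
Proof.
move=> [t [q [qa ->]]]; have [s sx] := wset_coset comp x qa.
(* A pure translation: it takes x to x - s + t, which lies in t + [wset q] because x - s lies in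
   [wset q]. *)
exists ((s - t, HT1 H) : G); rewrite /cball /=.
have -> : aff ((s - t, HT1 H) : G) x = x - iota (s - t).
  apply: (hausdorff_dense_eq (completion_hausdorff comp) (completion_dense comp)
    (@aff_continuous _) (@continuous_subr _ _)) => r.
  rewrite aff_iota -raddfB; congr (iota _); apply: val_inj.
  by rewrite /= invr1 mul1r.
by rewrite raddfB opprB addrA addrAC addrK.
Qed.

(** A fixed point r of g = (n, h) solves (1 - h) r = n, which has no solution if h = 1 and n <> 0,
    and exactly one rational solution if h <> 1. *)
Lemma affN_fixed g s t : g <> 1%g -> affN g s = s -> affN g t = t -> s = t.
Proof.
move=> g1 gs gt; apply: val_inj => /=.
have h0 := HT_neq0 g.2; set h := val g.2 in h0.
have E r : affN g r = r -> Nval r - Nval g.1 = h * Nval r.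
  move=> /(congr1 (@Nval a)); rewrite affNE -/h => E.
  by rewrite -[in RHS]E mulVKf.
have := E _ gs; have := E _ gt => Et Es.
have [h1|h1] := eqVneq h 1.
  exfalso; apply: g1; move: h1 Es; rewrite /h; case: (g) => n k /= k1; rewrite k1 => Es.
  have n0 : Nval n = 0 by move: Es; rewrite mul1r; lra.
  by congr pair; exact: val_inj.
apply: (mulfI (_ : 1 - h != 0)); first by rewrite subr_eq0 eq_sym.
by move: Es Et; lra.
Qed.

(** Each g <> 1 fixes at most one point of N, while O contains the infinitely many points t0 + i q.
    One of them is fixed by no g in s, and the Hausdorff property separates it from its finitely
    many images. *)
Lemma basic_topologically_free (x : Omega) (O : set Omega) (s : {fset G}) :
  nbhs x O -> 1%g \notin s -> exists B, [/\ basic B, B !=set0, B `<=` O &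
    forall g z, g \in s -> B z -> ~ B (aff g z)].
Proof.
move=> xO s1.
have [t0 Ot0] := iota_dense comp (nbhs_interior xO).
have [q qa qO] := wset_sub_nbhs0 comp (nbhs_to0 (nbhs_interior Ot0)).
pose t i := t0 + Nmult qa (Posz i).
have t_inj : injective t.
  move=> i k /addrI /(congr1 val) /= /(mulfI (lt0r_neq0 (adm_gt0 qa))).
  by move=> /eqP; rewrite eqr_int => /eqP[].
have Ot i : nbhs (iota (t i)) O.
  rewrite /t addrC raddfD; apply: qO; apply/wset_iota => //; by exists (Posz i).
have free1 g : g <> 1%g -> exists b : nat, forall i, (b <= i)%N -> affN g (t i) <> t i.
  move=> g1; have [[i0 gi0]|nf] := pselect (exists i, affN g (t i) = t i).
    exists i0.+1 => i i0i gi; have := affN_fixed g1 gi0 gi.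
    by move=> /t_inj E; rewrite E ltnn in i0i.
  by exists 0%N => i _ gi; apply: nf; exists i.
have [i ti] : exists i, forall g, g \in s -> affN g (t i) <> t i.
  have : forall r : seq G, (forall g, g \in r -> g <> 1%g) ->
      exists b, forall i, (b <= i)%N -> forall g, g \in r -> affN g (t i) <> t i.
    elim=> [_|g r IH r1]; first by exists 0%N.
    have [|b bP] := IH; first by move=> h hr; apply: r1; rewrite inE hr orbT.
    have [|c cP] := free1 g; first by apply: r1; rewrite inE eqxx.
    exists (maxn b c) => i; rewrite geq_max => /andP[bi ci] h.
    by rewrite inE => /predU1P[->|hr]; [exact: cP|exact: bP].
  move=> /(_ s)[|b bP]; last by exists b; exact: bP.
  by move=> g gs g1; rewrite -g1 gs in s1.
pose y := iota (t i).
have sep g : g \in s -> exists2 V, nbhs y V & forall z, V z -> ~ V (aff g z).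
  move=> gs; have : aff g y != y.
    apply/eqP; rewrite aff_iota => /(iota_inj comp); exact: ti.
  move=> ne; have := completion_hausdorff comp; rewrite open_hausdorff => /(_ _ _ ne).
  move=> [[A B] /= [/set_mem Ay /set_mem By] [oA oB /eqP AB]].
  exists (B `&` (aff g @^-1` A)).
    apply: filterI; first exact: open_nbhs_nbhs.
    by apply: aff_continuous; exact: open_nbhs_nbhs.
  move=> z [_ Az] [Bz _]; have : (A `&` B) (aff g z) by [].
  by rewrite AB.
have [V yV Vs] : exists2 V, nbhs y V & forall g z, g \in s -> V z -> ~ V (aff g z).
  have : forall r : seq G, {subset r <= s} ->
      exists2 V, nbhs y V & forall g z, g \in r -> V z -> ~ V (aff g z).
    elim=> [_|g r IH rs]; first by exists setT; [exact: filterT|].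
    have [|V yV VP] := IH; first by move=> h hr; apply: rs; rewrite inE hr orbT.
    have [|W yW WP] := sep g; first by apply: rs; rewrite inE eqxx.
    exists (V `&` W); first exact: filterI.
    move=> h z; rewrite inE => /predU1P[->|hr] [Vz Wz] [Vhz Whz].
      exact: WP Wz Whz.
    exact: VP hr Vz Vhz.
  by move=> /(_ s); apply.
have [r ra rV] := wset_sub_nbhs0 comp (nbhs_to0 (filterI yV (Ot i))).
exists (cball iota (t i) r); split.
- by exists (t i), r.
- by exists y; rewrite /cball /= subrr; exact: wset0.
- by move=> z /rV[_]; rewrite subrK.
- move=> g z gs /rV[+ _] /rV[+ _]; rewrite !subrK; exact: Vs.
Qed.

End AffineAction.

(** * The crossed product of the a-adic numbers *)

(** The decomposition of q Z into v cosets of v q Z. Truth values are added as integers to match a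
    sum of indicator functions. *)
Lemma mult_cosets (q r : rat) (v : nat) : (0 < v)%N -> q != 0 ->
  (\sum_(i < v) (`[< mult (v%:R * q) (r - i%:R * q) >] : nat))%N = `[< mult q r >] :> nat.
Proof.
move=> v0 q0; case: asboolP => [[z rE]|nr]; last first.
  rewrite big1// => i _; case: asboolP => // -[z E]; exfalso; apply: nr.
  exists (v%:Z * z + i%:Z); rewrite intrD intrM -!pmulrn.
  by rewrite -(subrK (i%:R * q) r) E; ring.
have vz : (v : int) != 0 by rewrite eqz_nat -lt0n.
have lt_iv : (`|(z %% v)%Z| < v)%N.
  by rewrite -ltz_nat gez0_abs ?modz_ge0// ltz_pmod// ltz_nat.
rewrite (bigD1 (Ordinal lt_iv))//= big1 ?addn0 => [|i].
  case: asboolP => // -[]; exists (z %/ v)%Z.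
  rewrite pmulrn gez0_abs ?modz_ge0// rE {1}(divz_eq z v) intrD intrM -!pmulrn; ring.
rewrite -val_eqE /= => inz; case: asboolP => // -[w E]; exfalso.
move/negP: inz; apply; rewrite -eqz_nat gez0_abs ?modz_ge0//.
have zE : z = w * v%:Z + i%:Z.
  apply/eqP; rewrite -(eqr_int rat) intrD intrM -!pmulrn; apply/eqP.
  apply: (mulfI q0); rewrite -rE -(subrK (i%:R * q) r) E; ring.
by rewrite zE modzMDl modz_small ?eqxx// lez_nat ltz_nat ltn_ord.
Qed.

Section CrossedProductOmega.
Context {R : realType} {a : adic_seq} {Omega : UniformZmodule.type}.
Context {iota : {additive N a -> Omega}}.
Hypothesis comp : hausdorff_completion iota.
Variable dot : rat -> Omega -> Omega.
Hypothesis dotP : extends_multiplication iota dot.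
Variable H : S_subgroup a.
Local Notation G := (semidirect H).
Local Notation C := R[i].
Local Notation aff := (@aff a Omega iota dot H).
Variables (A : cstarAlgType R) (j : (G -> Omega -> C) -> A).
Hypothesis cp : crossed_product (pull aff) j.
Local Notation mono := (mono j).
Implicit Types (s t : N a) (g : G).

Let aff1g x : aff 1%g x = x. Proof. exact: aff1. Qed.
Let affMg g (h : G) x : aff (g * h)%g x = aff h (aff g x). Proof. exact: affM. Qed.
Let affc g : continuous (aff g). Proof. exact: aff_continuous. Qed.

(* The permutation representation on l2(N), with C_0(Omega) acting through
   restriction to N, does not kill the projection. *)
Lemma mono_cball_neq0 t q : adm (a := a) q -> mono (ind (cball iota t q)) 1%g <> 0.
Proof.
move=> qa.
pose V := (cplx R : hilbertType R).
pose pi (s : N a) (f : Omega -> C) (v : V) : V := f (iota s) *: v.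
pose U (g : G) (v : V) : V := v.
pose act g s := affN g^-1%g s.
have act1 s : act 1%g s = s by rewrite /act invg1 affN1.
have actM g h s : act (g * h)%g s = act g (act h s) by rewrite /act invgM affNM.
have rep : covariant_rep (pull aff) (l2_pi pi) (l2_U act U).
  apply: l2_covariant_rep => //.
  - by move=> g f f0; exact: (C0_pull aff1g affMg affc).
  - move=> f /C0_bounded[M M0 fM]; exists M => // s v.
    by rewrite rnormZ ler_wpM2r ?rnorm_ge0//; exact: fM.
  - by move=> s f _ k u v; rewrite /pi scalerDr !scalerA mulrC.
  - by move=> s f f' v _ _; rewrite /pi scalerDl.
  - by move=> s k f v _; rewrite /pi scalerA.
  - by move=> s f f' v _ _; rewrite /pi scalerA.
  - by move=> s f u v _; rewrite /pi innerZl innerZr /conj_fun conjCK.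
  - by move=> g f s v _; rewrite /pi /U /act /pull invgK aff_iota.
pose x0 : N a -> V := fun s => if s \in [fset t]%fset then (1 : C) else 0.
have x02 : x0 \in l2_pred by apply/l2_predP; eexists; exact: sqsum_indicator.
pose x : l2 (N a) V := MkL2 x02.
set p := ind _; have p0 : C0 R Omega p by exact: C0_cball.
move=> m0; have := integrated_le cp x (Cc_single 1%g p0) rep.
rewrite -/(mono p 1%g) m0 rnorm0 mul0r => /rnorm0_eq0.
rewrite (integratedE rep (s := [fset 1%g]%fset)) => [|g]; last first.
  by rewrite inE /single => /negPf ->.
rewrite big_seq_fset1 /single eqxx => /(congr1 (fun y : l2 (N a) V => y t)).
rewrite l2_piE//; last first.
  move=> f /C0_bounded[M M0 fM]; exists M => // s v.
  by rewrite rnormZ ler_wpM2r ?rnorm_ge0//; exact: fM.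
rewrite l2_UE// /pi /U invg1 act1 /p ind_cball// subrr asboolT; last exact: mult0.
rewrite scale1r /x /= /x0 inE eqxx => /eqP; apply/negP.
exact: (@oner_neq0 C).
Qed.

(** * Infiniteness of the projections of balls *)

Section InfiniteProjection.
Variables (t : N a) (q : rat) (h : {h : rat | h \in subgroup_set H}) (u v : nat).
Hypotheses (qa : adm (a := a) q) (v0 : (0 < v)%N) (vu : (v < u)%N).
Hypothesis hE : val h = u%:R / v%:R.
Hypotheses (ua : adm (a := a) (u%:R * q)) (va : adm (a := a) (v%:R * q)).

(* h maps the piece t + iq + vqZ of t + qZ onto t + iq + uqZ after translation
   by [shift i]; only v < u of the u cosets of uqZ in qZ are reached. *)
Let base (i : nat) : N a := t + Nmult qa i%:Z.
Let shift (i : nat) : G := (base i - HNmul h (base i), h).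
Let cell (n i : nat) : Omega -> C := ind (cball iota (base i) (n%:R * q)).

Let q0 : q != 0. Proof. exact: lt0r_neq0 (adm_gt0 qa). Qed.
Let h0 : val h != 0. Proof. exact: HT_neq0. Qed.

Let cell0 n i : adm (a := a) (n%:R * q) -> C0 R Omega (cell n i).
Proof. exact: C0_cball. Qed.

Let pull0 g f : C0 R Omega f -> C0 R Omega (pull aff g f).
Proof. exact: (C0_pull aff1g affMg affc). Qed.

Let pullK g (f : Omega -> C) : pull aff g (pull aff g^-1%g f) = f.
Proof. by apply/funext => x; rewrite /pull -affMg mulgV aff1g. Qed.

Let pullE g (f : Omega -> C) s : pull aff g f (iota s) = f (iota (affN g s)).
Proof. by rewrite /pull aff_iota. Qed.

Let val_base i : Nval (base i) = Nval t + i%:R * q.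
Proof. by rewrite /base /= [q * _]mulrC -pmulrn. Qed.

Let cellE n i s : adm (a := a) (n%:R * q) ->
  cell n i (iota s) = (`[< mult (n%:R * q) (Nval s - Nval t - i%:R * q) >])%:R.
Proof. by move=> na; rewrite /cell ind_cball// val_base opprD addrA. Qed.

Let cellM n i k : adm (a := a) (n%:R * q) -> (i < n)%N -> (k < n)%N -> i != k ->
  cell n i \* cell n k = cst 0.
Proof.
move=> na iu ku ik; apply: (C0_ext comp) => [||s /=].
- by apply: C0M; exact: cell0.
- exact: C0_cst0.
rewrite !cellE//; case: asboolP => [[z zE]|_]; last by rewrite mul0r.
case: asboolP => [[z' z'E]|_]; last by rewrite mulr0.
exfalso; move/negP: ik; apply; rewrite -eqz_nat.
have E : (i%:Z - k%:Z)%R = n%:Z * (z' - z).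
  apply/eqP; rewrite -(eqr_int rat) intrM !intrB -!pmulrn; apply/eqP.
  apply: (mulfI q0); move: zE z'E; set r := Nval s - Nval t => zE z'E.
  have -> : q * (i%:R - k%:R) = (r - k%:R * q) - (r - i%:R * q) by ring.
  by rewrite zE z'E; ring.
have : (z' - z = 0) \/ (1 <= z' - z) \/ (z' - z <= -1) by lia.
move: iu ku E; move: (z' - z) => d; nia.
Qed.

Let cell_idem n i : cell n i \* cell n i = cell n i.
Proof. by apply/funext => x /=; exact: ind_id. Qed.

(** [shift i] is the dilation by h about [base i], which it fixes, and h v q = u q. *)
Let pull_shift i : pull aff (shift i)^-1%g (cell u i) = cell v i.
Proof.
apply: (C0_ext comp) => [||s]; [by apply: pull0; exact: cell0|exact: cell0|].
rewrite pullE !cellE//; congr ((asbool _)%:R).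
have -> : Nval (affN (shift i)^-1%g s) - Nval t - i%:R * q =
    val h * (Nval s - Nval t - i%:R * q).
  rewrite affNE /= [q * _]mulrC -pmulrn; move: h0 => /=; move: (sval h) => k k0.
  by field; rewrite k0.
have -> : u%:R * q = val h * (v%:R * q).
  by rewrite hE mulrA divfK// pnatr_eq0 -lt0n.
by apply/propext; exact: multM.
Qed.

Let cell_sum : (fun x => \sum_(i < v) cell v i x) = ind (cball iota t q).
Proof.
have vC i : C0 R Omega (cell v i) by exact: cell0.
have S0 := (mono_sum cp (index_enum 'I_v) 1%g (fun i : 'I_v => vC i)).1.
apply: (C0_ext comp) => [//||s]; first exact: C0_cball.
rewrite ind_cball// -(mult_cosets _ v0 q0) natr_sum.
by apply: eq_bigr => i _; rewrite cellE.
Qed.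

(** A partial isometry: its source is the whole ball, cut into v cells, and its range consists of v
    of the u cells of the other size. *)
Let w : A := \sum_(i < v) mono (cell u i) (shift i).

Let w_starM : w^#* ** w = mono (ind (cball iota t q)) 1%g.
Proof.
rewrite /w cstar_sum cmul_suml -cell_sum.
have vC i : C0 R Omega (cell v i) by exact: cell0.
rewrite (mono_sum cp (index_enum 'I_v) 1%g (fun i : 'I_v => vC i)).2.
apply: eq_bigr => i _; rewrite cmul_sumr (bigD1 i)//= big1 ?addr0 => [|k ki].
  rewrite (mono_star cp); last exact: cell0.
  rewrite conj_ind (monoM cp); [|by apply: pull0; exact: cell0|exact: cell0].
  rewrite mulVg pull_shift; congr mono; exact: cell_idem.
rewrite (mono_star cp); last exact: cell0.
rewrite conj_ind (monoM cp); [|by apply: pull0; exact: cell0|exact: cell0].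
have E : cell u i \* cell u k = cst 0.
  by apply: cellM; rewrite ?(ltn_trans _ vu)// eq_sym.
rewrite -[X in mono X](_ : pull aff (shift i)^-1%g (cell u i \* cell u k) = _)//.
by rewrite E; exact: (mono0 cp).
Qed.

Let w_Mstar : w ** w^#* = mono (fun x => \sum_(i < v) cell u i x) 1%g.
Proof.
rewrite /w cstar_sum cmul_suml.
have uC i : C0 R Omega (cell u i) by exact: cell0.
rewrite (mono_sum cp (index_enum 'I_v) 1%g (fun i : 'I_v => uC i)).2.
have E (i k : 'I_v) : mono (cell u i) (shift i) ** (mono (cell u k) (shift k))^#* =
    mono (pull aff (shift i) (cell v i \* cell v k)) (shift i * (shift k)^-1)%g.
  rewrite (mono_star cp); last exact: cell0.
  rewrite conj_ind (monoM cp); [|exact: cell0|by apply: pull0; exact: cell0].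
  rewrite pull_shift; congr mono; rewrite -{1}(pullK (shift i) (cell u i)).
  by rewrite pull_shift.
apply: eq_bigr => i _; rewrite cmul_sumr (bigD1 i)//= big1 ?addr0 => [|k ki].
  by rewrite E mulgV cell_idem -pull_shift pullK.
rewrite E (_ : _ \* _ = cst 0); first exact: (mono0 cp).
by apply: cellM; rewrite // eq_sym.
Qed.

Lemma infinite_cball : infinite_projection (mono (ind (cball iota t q)) 1%g).
Proof.
have p0 : C0 R Omega (ind (cball iota t q)) by exact: C0_cball.
have pp := projection_mono_ind aff1g cp p0; split => //.
have uC i : C0 R Omega (cell u i) by exact: cell0.
have S0 := (mono_sum cp (index_enum 'I_v) 1%g (fun i : 'I_v => uC i)).1.
have wp := partial_isometry_mulr pp w_starM.
exists (w ** w^#*); split; last by exists w; rewrite w_starM.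
- split; first by rewrite cstarM cstarK.
  by rewrite cmulA -(cmulA w) w_starM wp.
- rewrite w_Mstar (monoM cp)// C0_pull1// mul1g; congr mono.
  apply: (C0_ext comp) => [||s]; [exact: C0M|by []|] => /=.
  rewrite mulr_sumr; apply: eq_bigr => i _; rewrite ind_cball// cellE//.
  case: asboolP => [_|nq]; first by rewrite mul1r.
  case: asboolP => [[z zE]|_]; last by rewrite mulr0.
  exfalso; apply: nq; exists (u%:Z * z + i%:Z); rewrite intrD intrM -!pmulrn.
  by rewrite -(subrK (i%:R * q) (Nval s - Nval t)) zE; ring.
(* The cell of index v < u is the first one outside the range of w; it lies in the ball, and its
   projection is not 0. *)
- move=> /(congr1 (fun x => x ** mono (cell u v) 1%g)).
  rewrite w_Mstar !(monoM cp)// !C0_pull1// !mul1g.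
  have -> : (fun x => \sum_(i < v) cell u i x) \* cell u v = cst 0.
    apply/funext => x /=; rewrite mulr_suml big1// => i _.
    have := @cellM u i v ua (ltn_trans (ltn_ord i) vu) vu.
    rewrite neq_ltn ltn_ord => /(_ isT) /(congr1 (fun f => f x)).
    exact.
  rewrite (mono0 cp) => /esym.
  have -> : ind (cball iota t q) \* cell u v = cell u v.
    apply: (C0_ext comp) => [||s]; [exact: C0M|by []|] => /=.
    rewrite ind_cball// cellE//; case: asboolP => [_|nq]; first by rewrite mul1r.
    case: asboolP => [[z zE]|_]; last by rewrite mulr0.
    exfalso; apply: nq; exists (u%:Z * z + v%:Z); rewrite intrD intrM -!pmulrn.
    by rewrite -(subrK (v%:R * q) (Nval s - Nval t)) zE; ring.
  exact: mono_cball_neq0 ua.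
Qed.

End InfiniteProjection.

End CrossedProductOmega.

Lemma S_subgroup_gt1 (a : adic_seq) (H : S_subgroup a) :
  (exists2 h, subgroup_set H h & h <> 1) -> exists2 h, subgroup_set H h & 1 < h.
Proof.
have [H0 _ _ HV] := subgroup_mul H => -[h Hh h1].
have [lt_h|gt_h|//] := ltgtP h 1; last by exists h.
by exists h^-1; [exact: HV|rewrite invf_gt1// H0].
Qed.

Theorem theorem2p7 (R : realType) (a : adic_seq) (P_neq0 : Pset a !=set0)
    (H : S_subgroup a) (H_nontrivial : exists2 h, subgroup_set H h & h <> 1)
    (Omega : UniformZmodule.type) (iota : {additive N a -> Omega})
    (Omega_completion : hausdorff_completion iota)
    (dot : rat -> Omega -> Omega) (dotP : extends_multiplication iota dot)
    (A : cstarAlgType R) (j : (semidirect H -> Omega -> R[i]) -> A)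
    (A_crossed : crossed_product (alpha_aff iota dot) j) :
  simple_cstar A /\ purely_infinite A.
Proof.
pose sg := @aff a Omega iota dot H.
(* [alpha_aff] and [pull] of the affine action are convertible. *)
have cp : crossed_product (pull sg) j := A_crossed.
have comp := Omega_completion.
apply: (@crossed_product_simple_purely_infinite _ _ _ sg _ _ _ _ _ cp (@basic a Omega iota)).
- exact: (aff1 comp dotP).
- exact: (affM comp dotP).
- exact: (aff_continuous dotP).
- by move=> _ [t [q [qa ->]]]; exact: (cball_clopen comp).
- by move=> _ [t [q [qa ->]]]; exact: (cball_compact comp).
- exact: (basic_topologically_free comp dotP).
- exact: (basic_orbit comp dotP).
(* The closure of Z: q = 1 / 1 is admissible since 1 divides every product. *)
- exists (cball iota 0 1); last by exists (iota 0); rewrite /cball /= subrr; exact: wset0.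
  exists 0, 1; split => //; exists 1%N, 1%N, 0%N, 1%N.
  by split; rewrite ?dvd1n ?divr1.
- exact: folner_semidirect.
move=> _ [t [q [qa ->]]] _.
have [h Hh h1] := S_subgroup_gt1 H_nontrivial.
have [u [v [_ v0 hE ua va]]] := S_adm (subgroup_S Hh).
have vu : (v < u)%N by move: h1; rewrite hE ltr_pdivlMr ?ltr0n// mul1r ltr_nat.
exact: (@infinite_cball _ _ _ _ comp _ dotP _ _ _ cp t q (exist _ h (mem_set Hh)) u v
  qa v0 vu hE (ua q qa) (va q qa)).
Qed.
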